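(* Let $A$ be a Lie algebra over $\Bbbk$ and let $M$ be an $A$-module. Then there is an isomorphism $$H^{Leib}_*(A,M)\simeq \mathrm{Tor}_*^{\Gamma_{sh}^{Lie}}\big(t,\mathcal{L}^{Lie}_{sh}(A,M)\big),$$ where $H^{Leib}_*(A,M)$ is the Leibniz homology of $A$ with coefficients in $M$, $\Gamma_{sh}^{Lie}$ is the $\Bbbk$-linear shuffle category associated to the operad $Lie$, $t$ is the right $\Gamma_{sh}^{Lie}$-module defined in the context, and $\mathcal{L}^{Lie}_{sh}(A,M)$ is the shuffle Loday functor.
   Context: $\Bbbk$ is a fixed commutative ground ring, $\Bbbk\text{-Mod}$ its category of modules, and $\otimes=\otimes_{\Bbbk}$. Put $[n]=\{0,1,\dots,n\}$. **Lie algebras and modules.** A Lie algebra is an algebra over the operad $Lie$: a $\Bbbk$-module $A$ with a bilinear bracket satisfying $[a,b]=-[b,a]$ and the Jacobi relation $[a,[b,c]]=[[a,b],c]-[[a,c],b]$ (it is not required that $[a,a]=0$). An $A$-module is a $\Bbbk$-module $M$ with a Lie algebra structure on $M\oplus A$ extending that of $A$, with $[M,A]\subset M$ and $[M,M]=0$; equivalently a bilinear map $[-,-]:M\otimes A\to M$ with $[x,[a,b]]=[[x,a],b]-[[x,b],a]$. **Leibniz homology.** $H^{Leib}_*(A,M)$ is the homology of the complex with $C_n^{Leib}(A,M)=M\otimes A^{\otimes n}$ and differential $$d(a_0\otimes a_1\otimes\cdots\otimes a_n)=\sum_{0\le i<j\le n}(-1)^j a_0\otimes\cdots\otimes a_{i-1}\otimes[a_i,a_j]\otimes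 a_{i+1}\otimes\cdots\otimes\widehat{a_j}\otimes\cdots\otimes a_n,$$ where $a_0\in M$ and $a_1,\dots,a_n\in A$. **The modules $Lie(I)$.** For a finite set $I$, $Lie(I)$ is the corresponding component of the operad $Lie$: the $\Bbbk$-module spanned by bracket monomials in variables $x_i$ ($i\in I$), each variable used exactly once, modulo antisymmetry $[a,b]=-[b,a]$ and Jacobi $[a,[b,c]]=[[a,b],c]-[[a,c],b]$ (applied to any sub-monomials). $Lie(\emptyset)=0$. **The category $\Gamma_{sh}^{Lie}$.** A shuffling surjection $\alpha:[n]\to[m]$ is a surjective map with $\alpha(0)=0$ and $\min\alpha^{-1}(i)<\min\alpha^{-1}(j)$ whenever $i<j$. The $\Bbbk$-linear category $\Gamma_{sh}^{Lie}$ has objects $[n]$, $n\ge 0$, and $$\Gamma_{sh}^{Lie}([n],[m])=\bigoplus_{\alpha}Lie(\alpha^{-1}(0))\otimes\cdots\otimes Lie(\alpha^{-1}(m)),$$ the sum being over shuffling surjections $\alpha:[n]\to[m]$. The composite of $(\alpha,f_0\otimes\cdots\otimes f_m):[n]\to[m]$ followed by $(\beta,g_0\otimes\cdots\otimes g_p):[m]\to[p]$ is $(\beta\alpha,h_0\otimes\cdots\otimes h_p)$ where $h_k$ is obtained from $g_k$ by substituting $f_i$ for $x_i$ for all $i\in\beta^{-1}(k)$ (operadic composition). **The morphism $d_{0,1}$.** $d_{0,1}\in\Gamma_{sh}^{Lie}([1],[0])=Lie(\{0,1\})$ is the element $[x_0,x_1]$. **Modules, tensor product, Tor.** A left (resp.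 right) $\Gamma_{sh}^{Lie}$-module is a covariant (resp. contravariant) $\Bbbk$-linear functor from $\Gamma_{sh}^{Lie}$ to $\Bbbk\text{-Mod}$. For a right module $G$ and a left module $F$, $G\otimes_{\Gamma_{sh}^{Lie}}F$ is the quotient of $\bigoplus_n G([n])\otimes F([n])$ by the relations $G(\varphi)(x)\otimes y= x\otimes F(\varphi)(y)$ for $\varphi\in\Gamma_{sh}^{Lie}([n],[m])$, $x\in G([m])$, $y\in F([n])$. $\mathrm{Tor}_*^{\Gamma_{sh}^{Lie}}(G,-)$ denotes the left derived functors of $G\otimes_{\Gamma_{sh}^{Lie}}-$ on left modules. **The right module $t$.** $t=\mathrm{coker}\big(\Gamma_{sh}^{Lie}(-,[1])\xrightarrow{(d_{0,1})_*}\Gamma_{sh}^{Lie}(-,[0])\big)$, where $(d_{0,1})_*$ is postcomposition with $d_{0,1}$. **Shuffle Loday functor.** $\mathcal{L}^{Lie}_{sh}(A,M):\Gamma_{sh}^{Lie}\to\Bbbk\text{-Mod}$ is the linear functor with $[n]\mapsto M\otimes A^{\otimes n}$ and $(\alpha,f_0\otimes\cdots\otimes f_m)$ sent to the map $a_0\otimes a_1\otimes\cdots\otimes a_n\mapsto b_0\otimes\cdots\otimes b_m$, where $b_i$ is the value obtained by substituting $a_j$ for $x_j$ ($j\in\alpha^{-1}(i)$) in $f_i$. *)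

(* Defs.v *)
From HB Require Import structures.
From mathcomp Require Import all_boot all_order all_algebra.
From mathcomp Require Import generic_quotient boolp zify.
Set Implicit Arguments. Unset Strict Implicit. Unset Printing Implicit Defensive.
Import GRing.Theory Order.TTheory.
Local Open Scope quotient_scope.
Local Open Scope ring_scope.

(* A module "up to a congruence": raw operations satisfying the module axioms
   modulo an equivalence relation. *)
Record modCong (k : comPzRingType) := ModCong {
  mc_car :> Type;
  mc_zero : mc_car;
  mc_add : mc_car -> mc_car -> mc_car;
  mc_scale : k -> mc_car -> mc_car;
  mc_eqv : mc_car -> mc_car -> Prop;
  mc_refl : forall x, mc_eqv x x;
  mc_sym : forall x y, mc_eqv x y -> mc_eqv y x;
  mc_trans : forall x y z, mc_eqv x y -> mc_eqv y z -> mc_eqv x z;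
  mc_addP : forall x x' y y',
    mc_eqv x x' -> mc_eqv y y' -> mc_eqv (mc_add x y) (mc_add x' y');
  mc_scaleP : forall a x x', mc_eqv x x' -> mc_eqv (mc_scale a x) (mc_scale a x');
  mc_addA : forall x y z, mc_eqv (mc_add x (mc_add y z)) (mc_add (mc_add x y) z);
  mc_addC : forall x y, mc_eqv (mc_add x y) (mc_add y x);
  mc_add0 : forall x, mc_eqv (mc_add mc_zero x) x;
  mc_addN : forall x, mc_eqv (mc_add (mc_scale (-1) x) x) mc_zero;
  mc_scaleA : forall a b x,
    mc_eqv (mc_scale a (mc_scale b x)) (mc_scale (a * b) x);
  mc_scale1 : forall x, mc_eqv (mc_scale 1 x) x;
  mc_scaleDr : forall a x y,
    mc_eqv (mc_scale a (mc_add x y)) (mc_add (mc_scale a x) (mc_scale a y));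
  mc_scaleDl : forall a b x,
    mc_eqv (mc_scale (a + b) x) (mc_add (mc_scale a x) (mc_scale b x))
}.

Definition mcRep (k : comPzRingType) (C : modCong k) : Type := mc_car C.
HB.instance Definition _ k (C : modCong k) := gen_eqMixin (mcRep C).
HB.instance Definition _ k (C : modCong k) := gen_choiceMixin (mcRep C).

Section Qmod.
Variables (k : comPzRingType) (C : modCong k).

Definition mcRel : rel (mcRep C) := fun x y => `[< mc_eqv (x : C) y >].

Lemma mcRel_refl : reflexive mcRel.
Proof. by move=> x; apply/asboolP/mc_refl. Qed.
Lemma mcRel_sym : symmetric mcRel.
Proof. by move=> x y; apply/asboolP/asboolP; apply: mc_sym. Qed.
Lemma mcRel_trans : transitive mcRel.
Proof.
by move=> y x z /asboolP xy /asboolP yz; apply/asboolP; apply: mc_trans xy yz.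
Qed.

Canonical mcEquiv := EquivRel mcRel mcRel_refl mcRel_sym mcRel_trans.

Definition qmod := {eq_quot mcEquiv}.
HB.instance Definition _ := Choice.on qmod.

Definition qclass (x : C) : qmod := (\pi_(qmod) (x : mcRep C))%qT.
Definition qrepr (x : qmod) : C := repr x.

Lemma qclassP (x y : C) : qclass x = qclass y <-> mc_eqv x y.
Proof.
split; first by move/eqmodP/asboolP.
by move=> h; apply/eqmodP/asboolP.
Qed.

Lemma qreprK x : qclass (qrepr x) = x.
Proof. exact: reprK. Qed.

Lemma qreprE (x : C) : mc_eqv (qrepr (qclass x)) x.
Proof. by apply/qclassP; rewrite qreprK. Qed.

Definition q_add (x y : qmod) := qclass (mc_add (qrepr x) (qrepr y)).
Definition q_scale a (x : qmod) := qclass (mc_scale a (qrepr x)).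
Definition q_opp (x : qmod) := q_scale (-1) x.

Lemma q_addE (x y : C) : q_add (qclass x) (qclass y) = qclass (mc_add x y).
Proof. by apply/qclassP; apply: mc_addP; apply: qreprE. Qed.
Lemma q_scaleE a (x : C) : q_scale a (qclass x) = qclass (mc_scale a x).
Proof. by apply/qclassP; apply: mc_scaleP; apply: qreprE. Qed.

Lemma q_addA : associative q_add.
Proof.
move=> x y z; rewrite -[x]qreprK -[y]qreprK -[z]qreprK !q_addE.
exact/qclassP/mc_addA.
Qed.
Lemma q_addC : commutative q_add.
Proof. by move=> x y; rewrite -[x]qreprK -[y]qreprK !q_addE; apply/qclassP/mc_addC. Qed.
Lemma q_add0 : left_id (qclass (mc_zero C)) q_add.
Proof. by move=> x; rewrite -[x]qreprK !q_addE; apply/qclassP/mc_add0. Qed.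
Lemma q_addN : left_inverse (qclass (mc_zero C)) q_opp q_add.
Proof.
by move=> x; rewrite -[x]qreprK /q_opp q_scaleE q_addE; apply/qclassP/mc_addN.
Qed.

HB.instance Definition _ :=
  GRing.isZmodule.Build qmod q_addA q_addC q_add0 q_addN.

Lemma q_scaleA a b x : q_scale a (q_scale b x) = q_scale (a * b) x.
Proof. by rewrite -[x]qreprK !q_scaleE; apply/qclassP/mc_scaleA. Qed.
Lemma q_scale1 : left_id 1 q_scale.
Proof. by move=> x; rewrite -[x]qreprK !q_scaleE; apply/qclassP/mc_scale1. Qed.
Lemma q_scaleDr : right_distributive q_scale +%R.
Proof.
move=> a x y; rewrite -[x]qreprK -[y]qreprK /GRing.add /= !(q_addE, q_scaleE).
exact/qclassP/mc_scaleDr.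
Qed.
Lemma q_scaleDl x : {morph q_scale^~ x : a b / a + b}.
Proof.
move=> a b; rewrite -[x]qreprK [in RHS]/GRing.add /= !(q_addE, q_scaleE).
exact/qclassP/mc_scaleDl.
Qed.

HB.instance Definition _ := GRing.Zmodule_isLmodule.Build k qmod
  q_scaleA q_scale1 q_scaleDr q_scaleDl.

Lemma qclass0 : qclass (mc_zero C) = 0. Proof. by []. Qed.
Lemma qclassD (x y : C) : qclass (mc_add x y) = qclass x + qclass y.
Proof. by rewrite -q_addE. Qed.
Lemma qclassZ a (x : C) : qclass (mc_scale a x) = a *: qclass x.
Proof. by rewrite -q_scaleE. Qed.
End Qmod.

Definition linMap (k : comPzRingType) (U V : lmodType k) (f : U -> V)
  (f_lin : linear f) : {linear U -> V} :=
  HB.pack f (GRing.isLinear.Build k U V *:%R f f_lin).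

Definition isoMod (k : comPzRingType) (U V : lmodType k) : Prop :=
  exists f : {linear U -> V}, bijective f.

(* The quotient of Z by Z n B, for submodules Z and B of V. *)
Section Subquot.
Variables (k : comPzRingType) (V : lmodType k).

Record submod := Submod {
  sm_pred :> V -> Prop;
  sm_0 : sm_pred 0;
  sm_lin : forall a x y, sm_pred x -> sm_pred y -> sm_pred (a *: x + y)
}.

Lemma sm_D (S : submod) x y : S x -> S y -> S (x + y).
Proof. by move=> hx hy; rewrite -[x]scale1r; apply: sm_lin. Qed.
Lemma sm_Z (S : submod) a x : S x -> S (a *: x).
Proof. by move=> hx; rewrite -[a *: x]addr0; apply: sm_lin => //; apply: sm_0. Qed.
Lemma sm_B (S : submod) x y : S x -> S y -> S (x - y).
Proof. by move=> hx hy; rewrite -scaleN1r; apply: sm_D => //; apply: sm_Z. Qed.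

Variables (Z B : submod).
Let car := {x : V | Z x}.
Let sq_zero : car := exist _ 0 (sm_0 Z).
Let sq_add (x y : car) : car := exist _ (sval x + sval y) (sm_D (svalP x) (svalP y)).
Let sq_scale a (x : car) : car := exist _ (a *: sval x) (sm_Z a (svalP x)).
Let sq_eqv (x y : car) := B (sval x - sval y).

#[local] Obligation Tactic := idtac.
Program Definition subquotCong : modCong k :=
  @ModCong k car sq_zero sq_add sq_scale sq_eqv _ _ _ _ _ _ _ _ _ _ _ _ _.
Next Obligation. by move=> x; rewrite /sq_eqv subrr; apply: sm_0. Qed.
Next Obligation. by move=> x y h; rewrite /sq_eqv -opprB -scaleN1r; apply: sm_Z. Qed.
Next Obligation.
move=> x y z h1 h2; rewrite /sq_eqv -[sval x](subrK (sval y)) -addrA.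
exact: sm_D.
Qed.
Next Obligation.
by move=> x x' y y' h1 h2; rewrite /sq_eqv /sq_add /sq_scale /sq_zero /= opprD addrACA; apply: sm_D.
Qed.
Next Obligation. by move=> a x x' h; rewrite /sq_eqv /sq_add /sq_scale /sq_zero /= -scalerBr; apply: sm_Z. Qed.
Next Obligation. by move=> x y z; rewrite /sq_eqv /sq_add /sq_scale /sq_zero /= addrA subrr; apply: sm_0. Qed.
Next Obligation. by move=> x y; rewrite /sq_eqv /sq_add /sq_scale /sq_zero /= [sval x + _]addrC subrr; apply: sm_0. Qed.
Next Obligation. by move=> x; rewrite /sq_eqv /sq_add /sq_scale /sq_zero /= add0r subrr; apply: sm_0. Qed.
Next Obligation.
by move=> x; rewrite /sq_eqv /sq_add /sq_scale /sq_zero /= scaleN1r addNr subrr; apply: sm_0.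
Qed.
Next Obligation. by move=> a b x; rewrite /sq_eqv /sq_add /sq_scale /sq_zero /= scalerA subrr; apply: sm_0. Qed.
Next Obligation. by move=> x; rewrite /sq_eqv /sq_add /sq_scale /sq_zero /= scale1r subrr; apply: sm_0. Qed.
Next Obligation. by move=> a x y; rewrite /sq_eqv /sq_add /sq_scale /sq_zero /= scalerDr subrr; apply: sm_0. Qed.
Next Obligation. by move=> a b x; rewrite /sq_eqv /sq_add /sq_scale /sq_zero /= scalerDl subrr; apply: sm_0. Qed.

Definition subquot : lmodType k := qmod subquotCong.
End Subquot.

Inductive fexpr (k : comPzRingType) (T : Type) : Type :=
| Gen of T
| Zero
| Add of fexpr k T & fexpr k T
| Scale of k & fexpr k T.
Arguments Gen {k T}.
Arguments Zero {k T}.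

(* T and R stand for generators and relations: pres below is the k-module they
   present. *)
Inductive feqv (k : comPzRingType) (T : Type)
    (R : fexpr k T -> fexpr k T -> Prop) : fexpr k T -> fexpr k T -> Prop :=
| FRel x y : R x y -> feqv R x y
| FRefl x : feqv R x x
| FSym x y : feqv R x y -> feqv R y x
| FTrans x y z : feqv R x y -> feqv R y z -> feqv R x z
| FAddP x x' y y' : feqv R x x' -> feqv R y y' -> feqv R (Add x y) (Add x' y')
| FScaleP a x x' : feqv R x x' -> feqv R (Scale a x) (Scale a x')
| FAddA x y z : feqv R (Add x (Add y z)) (Add (Add x y) z)
| FAddC x y : feqv R (Add x y) (Add y x)
| FAdd0 x : feqv R (Add Zero x) x
| FAddN x : feqv R (Add (Scale (-1) x) x) Zero
| FScaleA a b x : feqv R (Scale a (Scale b x)) (Scale (a * b) x)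
| FScale1 x : feqv R (Scale 1 x) x
| FScaleDr a x y : feqv R (Scale a (Add x y)) (Add (Scale a x) (Scale a y))
| FScaleDl a b x : feqv R (Scale (a + b) x) (Add (Scale a x) (Scale b x)).

Fixpoint feval (k : comPzRingType) (T : Type) (V : lmodType k) (f : T -> V)
    (x : fexpr k T) : V :=
  match x with
  | Gen t => f t
  | Zero => 0
  | Add x y => feval f x + feval f y
  | Scale a x => a *: feval f x
  end.

Section Pres.
Variables (k : comPzRingType) (T : Type) (R : fexpr k T -> fexpr k T -> Prop).

Definition presCong : modCong k :=
  ModCong (@FRefl k T R) (@FSym k T R) (@FTrans k T R) (@FAddP k T R)
    (@FScaleP k T R) (@FAddA k T R) (@FAddC k T R) (@FAdd0 k T R)
    (@FAddN k T R) (@FScaleA k T R) (@FScale1 k T R) (@FScaleDr k T R)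
    (@FScaleDl k T R).

Definition pres : lmodType k := qmod presCong.
Definition gen (t : T) : pres := qclass (Gen t : presCong).

Lemma pres_rel (x y : fexpr k T) : R x y -> feval gen x = feval gen y.
Proof.
have E z : feval gen z = qclass (z : presCong).
  by elim: z => //= [x' -> y' ->|a x' ->]; rewrite -?qclassD -?qclassZ.
by move=> h; rewrite !E; apply/qclassP/FRel.
Qed.

Lemma pres_ind (P : pres -> Prop) :
  P 0 -> (forall a x y, P x -> P y -> P (a *: x + y)) ->
  (forall t, P (gen t)) -> forall x, P x.
Proof.
move=> P0 PL Pg x; rewrite -[x]qreprK; elim: (qrepr x) => [t||y hy z hz|a y hy].
- exact: Pg.
- exact: P0.
- by rewrite (@qclassD k presCong y z) -[@qclass k presCong y]scale1r; apply: PL.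
- by rewrite (@qclassZ k presCong a y) -[_ *: _]addr0; apply: PL.
Qed.

Variable V : lmodType k.

(* The linear map with gen t |-> f t.  It is defined for every f, through a choice
   of representatives, but is linear and extends f only if f respects R
   (presLift_gen, presLift_lin). *)
Definition presLift (f : T -> V) (x : pres) : V := feval f (qrepr x).

Definition respects (f : T -> V) := forall x y, R x y -> feval f x = feval f y.

Variable f : T -> V.
Hypothesis fR : respects f.

Lemma feval_eqv x y : feqv R x y -> feval f x = feval f y.
Proof.
elim=> //=.
- by move=> ? ? ? _ -> _ ->.
- by move=> ? ? ? ? _ -> _ ->.
- by move=> ? ? ? _ ->.
- by move=> *; rewrite addrA.
- by move=> *; rewrite addrC.
- by move=> *; rewrite add0r.
- by move=> *; rewrite scaleN1r addNr.
- by move=> *; rewrite scalerA.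
- by move=> *; rewrite scale1r.
- by move=> *; rewrite scalerDr.
- by move=> *; rewrite scalerDl.
Qed.

Lemma presLift_class (x : presCong) : presLift f (qclass x) = feval f x.
Proof. exact: (feval_eqv (@qreprE k presCong x)). Qed.

Lemma presLift_gen t : presLift f (gen t) = f t.
Proof. exact: presLift_class. Qed.

Lemma presLift_lin : linear (presLift f).
Proof.
move=> a x y; rewrite -[x]qreprK -[y]qreprK -qclassZ -qclassD !presLift_class //.

Qed.
End Pres.

Section LinFacts.
Variables (k : comPzRingType) (U V : lmodType k) (f : U -> V).
Hypothesis fl : linear f.
Lemma lin0 : f 0 = 0.
Proof. exact: (linear0 (linMap fl)). Qed.
Lemma linD x y : f (x + y) = f x + f y.
Proof. exact: (linearD (linMap fl)). Qed.
Lemma linZ a x : f (a *: x) = a *: f x.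
Proof. exact: (linearZ_LR (linMap fl)). Qed.
End LinFacts.

Lemma pres_eq (k : comPzRingType) (T : Type) (R : fexpr k T -> fexpr k T -> Prop)
    (V : lmodType k) (f g : pres R -> V) :
  linear f -> linear g -> (forall t, f (gen R t) = g (gen R t)) -> f =1 g.
Proof.
move=> fl gl fg; apply: pres_ind => //.
  by rewrite (lin0 fl) (lin0 gl).
by move=> a x y hx hy; rewrite fl gl hx hy.
Qed.

Section DirectSum.
Variables (k : comPzRingType) (J : Type) (V : J -> lmodType k).

Inductive dsumRel : fexpr k {j & V j} -> fexpr k {j & V j} -> Prop :=
| DsumLin j a (x y : V j) :
    dsumRel (Gen (existT _ j (a *: x + y)))
            (Add (Scale a (Gen (existT _ j x))) (Gen (existT _ j y))).

Definition dsum : lmodType k := pres dsumRel.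
Definition dinj j (x : V j) : dsum := gen dsumRel (existT _ j x).

Lemma dinj_lin j : linear (@dinj j).
Proof. by move=> a x y; apply: (pres_rel (DsumLin a x y)). Qed.

Lemma dsum_ind (P : dsum -> Prop) :
  P 0 -> (forall a x y, P x -> P y -> P (a *: x + y)) ->
  (forall j x, P (@dinj j x)) -> forall x, P x.
Proof. by move=> P0 PL Pg; apply: pres_ind => // -[j x]; apply: Pg. Qed.

Variable W : lmodType k.
(* As for presLift, only meaningful when every f j is linear. *)
Definition dsumLift (f : forall j, V j -> W) : dsum -> W :=
  presLift (fun p => f (projT1 p) (projT2 p)).

Variable f : forall j, V j -> W.
Hypothesis fl : forall j, linear (@f j).
Lemma dsum_resp : respects dsumRel (fun p => f (projT2 p)).
Proof. by move=> _ _ [j a x y] /=; apply: fl. Qed.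
Lemma dsumLift_lin : linear (dsumLift f).
Proof. exact/presLift_lin/dsum_resp. Qed.
Lemma dsumLift_inj j (x : V j) : dsumLift f (dinj x) = f x.
Proof. exact: (presLift_gen dsum_resp). Qed.
End DirectSum.

Section Tensor.
Variables (k : comPzRingType) (I : eqType) (V : I -> lmodType k).

Definition fam := forall i, V i.

(* u, v, w agree outside i, and u i = a v i + w i. *)
Definition lin_at (i : I) a (u v w : fam) : Prop :=
  u i = a *: v i + w i /\ forall j, j != i -> u j = v j /\ u j = w j.

Inductive tensRel : fexpr k fam -> fexpr k fam -> Prop :=
| TensLin i a u v w : lin_at i a u v w ->
    tensRel (Gen u) (Add (Scale a (Gen v)) (Gen w)).

Definition tens : lmodType k := pres tensRel.
Definition ptens (u : fam) : tens := gen tensRel u.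

Definition multilinear (W : lmodType k) (f : fam -> W) :=
  forall i a u v w, lin_at i a u v w -> f u = a *: f v + f w.

Lemma ptens_multi : multilinear ptens.
Proof. by move=> i a u v w h; apply: (pres_rel (TensLin h)). Qed.

Lemma tens_ind (P : tens -> Prop) :
  P 0 -> (forall a x y, P x -> P y -> P (a *: x + y)) ->
  (forall u, P (ptens u)) -> forall x, P x.
Proof. exact: pres_ind. Qed.

Variable W : lmodType k.
(* As for presLift, only meaningful when f is multilinear. *)
Definition tensLift (f : fam -> W) : tens -> W := presLift f.

Variable f : fam -> W.
Hypothesis fl : multilinear f.
Lemma tens_resp : respects tensRel f.
Proof. by move=> _ _ [i a u v w] /=; apply: fl. Qed.
Lemma tensLift_lin : linear (tensLift f).
Proof. exact/presLift_lin/tens_resp. Qed.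
Lemma tensLift_p u : tensLift f (ptens u) = f u.
Proof. exact: (presLift_gen tens_resp). Qed.
End Tensor.

Record lieAlg (k : comPzRingType) := LieAlg {
  lie_car :> lmodType k;
  lie_br : lie_car -> lie_car -> lie_car;
  lie_brl : forall b, linear (fun a => lie_br a b);
  lie_brr : forall a, linear (lie_br a);
  lie_anti : forall a b, lie_br a b = - lie_br b a;
  lie_jac : forall a b c,
    lie_br a (lie_br b c) = lie_br (lie_br a b) c - lie_br (lie_br a c) b
}.

Record lieMod (k : comPzRingType) (A : lieAlg k) := LieMod {
  lmod_car :> lmodType k;
  lmod_br : lmod_car -> A -> lmod_car;
  lmod_brl : forall a, linear (fun x => lmod_br x a);
  lmod_brr : forall x, linear (lmod_br x);
  lmod_jac : forall x a b,
    lmod_br x (lie_br a b) = lmod_br (lmod_br x a) b - lmod_br (lmod_br x b) a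
}.

Lemma zmod_shuffle (V : zmodType) (p q r s t u : V) :
  p - q + (r - s) = p - t + (r - u) + (t - s + (u - q)).
Proof.
have E (a b c : V) : a - b + (b - c) = a - c by rewrite addrA subrK.
by rewrite [RHS]addrACA !E addrACA [RHS]addrACA [- q - s]addrC.
Qed.

Section Semidirect.
Variables (k : comPzRingType) (A : lieAlg k) (M : lieMod A).

Definition sd_car : lmodType k := (M * A)%type.
Definition sd_br (u v : sd_car) : sd_car :=
  (lmod_br u.1 v.2 - lmod_br v.1 u.2, lie_br u.2 v.2).

Lemma sd_anti u v : sd_br u v = - sd_br v u.
Proof.
by case: u v => [x a] [y b]; rewrite /sd_br /= {1}lie_anti; congr pair; rewrite /= opprB.
Qed.

Lemma sd_brl v : linear (fun u => sd_br u v).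
Proof.
move=> a [x b] [y c]; case: v => [z d]; rewrite /sd_br; congr pair => /=.
  rewrite (lmod_brl d) (lmod_brr z) scalerBr opprD.
  by rewrite -!addrA; congr (_ + _); rewrite addrCA.
exact: lie_brl.
Qed.

Lemma sd_brr u : linear (sd_br u).
Proof.
move=> a v w; rewrite sd_anti sd_brl opprD -scalerN.
by rewrite -!(sd_anti u).
Qed.

Lemma sd_jac u v w : sd_br u (sd_br v w) = sd_br (sd_br u v) w - sd_br (sd_br u w) v.
Proof.
case: u v w => [x a] [y b] [z c]; rewrite /sd_br /=; congr pair => /=; last first.
  exact: lie_jac.
have BB (p q : M) e : lmod_br (p - q) e = lmod_br p e - lmod_br q e.
  by rewrite addrC -scaleN1r (lmod_brl e) scaleN1r addrC.
rewrite !BB !lmod_jac !opprB.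
exact: zmod_shuffle.
Qed.

Definition semidirect : lieAlg k := LieAlg sd_brl sd_brr sd_anti sd_jac.
End Semidirect.

Inductive tree (T : Type) := Var of T | Br of tree T & tree T.

Fixpoint leaves (T : Type) (t : tree T) : seq T :=
  match t with Var x => [:: x] | Br a b => leaves a ++ leaves b end.

Inductive ctx (T : Type) :=
| Hole | CtxL of ctx T & tree T | CtxR of tree T & ctx T.
Arguments Hole {T}.

Fixpoint plug (T : Type) (c : ctx T) (t : tree T) : tree T :=
  match c with
  | Hole => t
  | CtxL c b => Br (plug c t) b
  | CtxR a c => Br a (plug c t)
  end.

Section Lie.
Variables (k : comPzRingType) (T : finType).

(* Monomials in which each x_i, i in I, appears exactly once, and no other
   variable does. *)
Definition mon (I : {set T}) := {t : tree T | perm_eq (leaves t) (enum I)}.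

(* The context c makes the two relations apply to every sub-monomial. *)
Inductive lieRel (I : {set T}) : fexpr k (mon I) -> fexpr k (mon I) -> Prop :=
| LieAnti c a b (s t : mon I) :
    sval s = plug c (Br a b) -> sval t = plug c (Br b a) ->
    lieRel (Gen s) (Scale (-1) (Gen t))
| LieJac c x y z (s t u : mon I) :
    sval s = plug c (Br x (Br y z)) -> sval t = plug c (Br (Br x y) z) ->
    sval u = plug c (Br (Br x z) y) ->
    lieRel (Gen s) (Add (Gen t) (Scale (-1) (Gen u))).

Definition Lie (I : {set T}) : lmodType k := pres (@lieRel I).
Definition lie_mon (I : {set T}) (t : tree T)
  (tI : perm_eq (leaves t) (enum I)) : Lie I := gen (@lieRel I) (exist _ t tI).

(* The same relations on all monomials; repeated variables are allowed. *)
Inductive freeRel : fexpr k (tree T) -> fexpr k (tree T) -> Prop :=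
| FreeAnti c a b :
    freeRel (Gen (plug c (Br a b))) (Scale (-1) (Gen (plug c (Br b a))))
| FreeJac c x y z :
    freeRel (Gen (plug c (Br x (Br y z))))
      (Add (Gen (plug c (Br (Br x y) z)))
           (Scale (-1) (Gen (plug c (Br (Br x z) y))))).

Definition freeLie_car : lmodType k := pres freeRel.
Definition ftree (t : tree T) : freeLie_car := gen freeRel t.

Definition free_brr (a : tree T) : freeLie_car -> freeLie_car :=
  presLift (fun b => ftree (Br a b)).
Definition free_br (x y : freeLie_car) : freeLie_car :=
  presLift (fun a => free_brr a y) x.

Lemma ftree_anti c a b : ftree (plug c (Br a b)) = - ftree (plug c (Br b a)).
Proof. by have := pres_rel (FreeAnti c a b); rewrite /= scaleN1r. Qed.
Lemma ftree_jac c x y z : ftree (plug c (Br x (Br y z))) =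
  ftree (plug c (Br (Br x y) z)) - ftree (plug c (Br (Br x z) y)).
Proof. by have := pres_rel (FreeJac c x y z); rewrite /= scaleN1r. Qed.

Lemma free_brr_resp a : respects freeRel (fun b => ftree (Br a b)).
Proof.
move=> _ _ [c x y|c x y z] /=; rewrite scaleN1r.
  exact: (ftree_anti (CtxR a c)).
exact: (ftree_jac (CtxR a c)).
Qed.
Lemma free_brr_lin a : linear (free_brr a).
Proof. exact/presLift_lin/free_brr_resp. Qed.
Lemma free_brrE a b : free_brr a (ftree b) = ftree (Br a b).
Proof. exact: (presLift_gen (@free_brr_resp a)). Qed.

Lemma free_brl_resp y : respects freeRel (fun a => free_brr a y).
Proof.
suff [H1 H2] : (forall c a b, free_brr (plug c (Br a b)) y =
                 - free_brr (plug c (Br b a)) y) /\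
               (forall c p q r, free_brr (plug c (Br p (Br q r))) y =
                 free_brr (plug c (Br (Br p q) r)) y
                 - free_brr (plug c (Br (Br p r) q)) y).
  by move=> _ _ [c a b|c p q r] /=; rewrite scaleN1r.
split=> [c a b|c p q r].
  apply: (pres_eq (g := fun y => - free_brr (plug c (Br b a)) y)) y => //.
  - exact: free_brr_lin.
  - by move=> e u v; rewrite free_brr_lin opprD scalerN.
  - by move=> t; rewrite !free_brrE; apply: (ftree_anti (CtxL c t)).
apply: (pres_eq (g := fun y => free_brr (plug c (Br (Br p q) r)) y
                 - free_brr (plug c (Br (Br p r) q)) y)) y => //.
- exact: free_brr_lin.
- by move=> e u v; rewrite !free_brr_lin opprD addrACA scalerBr.
- by move=> t; rewrite !free_brrE; apply: (ftree_jac (CtxL c t)).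
Qed.

Lemma free_brl y : linear (free_br^~ y).
Proof. exact/presLift_lin/free_brl_resp. Qed.
Lemma free_br_tree a y : free_br (ftree a) y = free_brr a y.
Proof. exact: (presLift_gen (@free_brl_resp y)). Qed.
Lemma free_brE a b : free_br (ftree a) (ftree b) = ftree (Br a b).
Proof. by rewrite free_br_tree free_brrE. Qed.
Lemma free_br_linr x : linear (free_br x).
Proof.
move=> e u v; move: x.
apply: (pres_eq (g := fun x => e *: free_br x u + free_br x v)).
- exact: free_brl.
- by move=> a p q; rewrite !free_brl !scalerDr !scalerA mulrC addrACA.
- by move=> t; rewrite !free_br_tree free_brr_lin.
Qed.

Lemma free_anti x y : free_br x y = - free_br y x.
Proof.
move: x; apply: (pres_eq (g := fun x => - free_br y x)).
- exact: free_brl.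
- by move=> e u v; rewrite free_br_linr opprD scalerN.
move=> a; move: y; apply: (pres_eq (g := fun y => - free_br y (ftree a))).
- exact: free_br_linr.
- by move=> e u v; rewrite free_brl opprD scalerN.
by move=> b; rewrite !free_brE; apply: (ftree_anti Hole).
Qed.

Lemma free_jac x y z :
  free_br x (free_br y z) = free_br (free_br x y) z - free_br (free_br x z) y.
Proof.
have subl e (a b c d : freeLie_car) : e *: a + b - (e *: c + d) = e *: (a - c) + (b - d).
  by rewrite opprD addrACA scalerBr.
move: x; apply: (pres_eq
  (g := fun x => free_br (free_br x y) z - free_br (free_br x z) y)).
- exact: free_brl.
- by move=> e u v; rewrite !free_brl subl.
move=> a; move: y; apply: (pres_eq
  (f := fun y => free_br (ftree a) (free_br y z))
  (g := fun y => free_br (free_br (ftree a) y) z - free_br (free_br (ftree a) z) y)).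
- by move=> e u v; rewrite free_brl free_br_linr.
- by move=> e u v; rewrite !free_br_linr free_brl subl.
move=> b; move: z; apply: (pres_eq
  (f := fun z => free_br (ftree a) (free_br (ftree b) z))
  (g := fun z => free_br (free_br (ftree a) (ftree b)) z
                 - free_br (free_br (ftree a) z) (ftree b))).
- by move=> e u v; rewrite !free_br_linr.
- by move=> e u v; rewrite !free_br_linr free_brl subl.
by move=> c; rewrite !free_brE; apply: (ftree_jac Hole).
Qed.

(* The free algebra over the operad Lie on T. *)
Definition freeLie : lieAlg k := LieAlg free_brl free_br_linr free_anti free_jac.

(* The map from Lie(I) to freeLie and the projection back, which kills the
   monomials of any other multidegree; lie_incK shows that lie_inc is injective. *)
Definition lie_inc (I : {set T}) : Lie I -> freeLie :=
  presLift (fun t : mon I => ftree (sval t)).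
Definition lie_proj (I : {set T}) : freeLie -> Lie I :=
  presLift (fun t : tree T =>
    if insub t is Some s then gen (@lieRel I) (s : mon I) else 0).

Lemma lie_inc_resp (I : {set T}) :
  respects (@lieRel I) (fun t : mon I => ftree (sval t)).
Proof.
move=> _ _ [c a b s t hs ht|c x y z s t u hs ht hu] /=; rewrite scaleN1r hs ht.
  exact: ftree_anti.
by rewrite hu; apply: ftree_jac.
Qed.
Lemma lie_inc_lin (I : {set T}) : linear (@lie_inc I).
Proof. exact/presLift_lin/lie_inc_resp. Qed.
Lemma lie_incE (I : {set T}) (s : mon I) : lie_inc (gen (@lieRel I) s) = ftree (sval s).
Proof. exact: (presLift_gen (@lie_inc_resp I)). Qed.

Lemma plug_perm c (s t : tree T) :
  perm_eq (leaves s) (leaves t) -> perm_eq (leaves (plug c s)) (leaves (plug c t)).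
Proof.
by move=> h; elim: c => //= [c IH b|a c IH]; rewrite ?perm_cat2r ?perm_cat2l.
Qed.

Lemma lie_proj_resp (I : {set T}) : respects freeRel (fun t : tree T =>
    if insub t is Some s then gen (@lieRel I) (s : mon I) else 0).
Proof.
have E s t : perm_eq (leaves s) (leaves t) ->
    perm_eq (leaves s) (enum I) = perm_eq (leaves t) (enum I).
  by move/permPl->.
move=> _ _ [c a b|c x y z] /=; rewrite scaleN1r.
  have /E e : perm_eq (leaves (plug c (Br a b))) (leaves (plug c (Br b a))).
    by apply: plug_perm; rewrite /= perm_catC.
  case: insubP => [s hs es|hs].
    case: insubP => [t ht et|]; last by rewrite -e hs.
    have := pres_rel (@LieAnti I c a b s t es et).
    by rewrite /= scaleN1r.
  by case: insubP => [t|_]; rewrite ?oppr0 // -e (negbTE hs).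
have /E e : perm_eq (leaves (plug c (Br x (Br y z)))) (leaves (plug c (Br (Br x y) z))).
  by apply: plug_perm; rewrite /= catA.
have /E e' : perm_eq (leaves (plug c (Br x (Br y z)))) (leaves (plug c (Br (Br x z) y))).
  by apply: plug_perm; rewrite /= -catA perm_cat2l perm_catC.
case: insubP => [s hs es|hs].
  case: insubP => [t ht et|]; last by rewrite -e hs.
  case: insubP => [u hu eu|]; last by rewrite -e' hs.
  have := pres_rel (@LieJac I c x y z s t u es et eu).
  by rewrite /= scaleN1r.
case: insubP => [t|_]; first by rewrite -e (negbTE hs).
by case: insubP => [t|_]; rewrite ?subr0 // -e' (negbTE hs).
Qed.
Lemma lie_proj_lin (I : {set T}) : linear (@lie_proj I).
Proof. exact/presLift_lin/lie_proj_resp. Qed.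
Lemma lie_projE (I : {set T}) (t : tree T) (tI : perm_eq (leaves t) (enum I)) :
  lie_proj I (ftree t) = lie_mon tI.
Proof.
rewrite /lie_proj (presLift_gen (@lie_proj_resp I)).
case: insubP => [s hs es|]; last by rewrite tI.
by congr gen; apply: val_inj.
Qed.
Lemma lie_incK (I : {set T}) : cancel (@lie_inc I) (@lie_proj I).
Proof.
apply: (pres_eq (f := fun x => lie_proj I (lie_inc x)) (g := id)) => //.
  by move=> a x y; rewrite lie_inc_lin lie_proj_lin.
by case=> t tI; rewrite lie_incE (lie_projE tI).
Qed.

Section Eval.
Variables (L : lieAlg k) (a : T -> L).

Fixpoint tree_ev (t : tree T) : L :=
  match t with Var i => a i | Br s t => lie_br (tree_ev s) (tree_ev t) end.

Definition free_ev : freeLie -> L := presLift tree_ev.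
Definition lie_ev (I : {set T}) (f : Lie I) : L := free_ev (lie_inc f).

Lemma free_ev_resp : respects freeRel tree_ev.
Proof.
move=> _ _ [c x y|c x y z] /=; rewrite scaleN1r; elim: c => /=.
- exact: lie_anti.
- by move=> c -> b; rewrite -scaleN1r (linZ (@lie_brl _ _ _)) scaleN1r.
- by move=> b c ->; rewrite -scaleN1r (linZ (@lie_brr _ _ _)) scaleN1r.
- exact: lie_jac.
- move=> c -> b; rewrite -scaleN1r (linD (@lie_brl _ _ _)).
  by rewrite (linZ (@lie_brl _ _ _)) scaleN1r.
- move=> b c ->; rewrite -scaleN1r (linD (@lie_brr _ _ _)).
  by rewrite (linZ (@lie_brr _ _ _)) scaleN1r.
Qed.
Lemma free_ev_lin : linear free_ev.
Proof. exact/presLift_lin/free_ev_resp. Qed.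
Lemma free_evE t : free_ev (ftree t) = tree_ev t.
Proof. exact: (presLift_gen free_ev_resp). Qed.
Lemma lie_ev_lin I : linear (@lie_ev I).
Proof. by move=> e x y; rewrite /lie_ev lie_inc_lin free_ev_lin. Qed.
Lemma lie_evE I (s : mon I) : lie_ev (gen (@lieRel I) s) = tree_ev (sval s).
Proof. by rewrite /lie_ev lie_incE free_evE. Qed.
Lemma free_ev_br x y : free_ev (free_br x y) = lie_br (free_ev x) (free_ev y).
Proof.
move: x; apply: (pres_eq (f := fun x => free_ev (free_br x y))
  (g := fun x => lie_br (free_ev x) (free_ev y))).
- by move=> e u v; rewrite free_brl free_ev_lin.
- by move=> e u v; rewrite free_ev_lin lie_brl.
move=> t; move: y; apply: (pres_eq (f := fun y => free_ev (free_br (ftree t) y))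
  (g := fun y => lie_br (free_ev (ftree t)) (free_ev y))).
- by move=> e u v; rewrite free_br_linr free_ev_lin.
- by move=> e u v; rewrite free_ev_lin lie_brr.
by move=> s; rewrite free_brE !free_evE.
Qed.
End Eval.
End Lie.

Arguments ftree {k T}.
Arguments lie_mon k {T I t}.

(* Operadic composition: substitute f i for x_i in g.  The substitution is computed
   in the free algebra and read back in Lie(K); nothing is lost when the I i are
   disjoint and K is the union of the I i for i in J (lie_comp_inc), and
   lie_comp_mon below gives the value on monomials. *)
Definition lie_comp (k : comPzRingType) (S T : finType) (J : {set T})
    (I : T -> {set S}) (K : {set S}) (g : Lie k J) (f : forall i, Lie k (I i)) :
    Lie k K :=
  lie_proj K (lie_ev (fun i => lie_inc (f i)) g).

Section EvalFacts.
Variables (k : comPzRingType) (T : finType).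

Lemma mon_uniq (I : {set T}) (s : mon I) : uniq (leaves (sval s)).
Proof. by rewrite (perm_uniq (svalP s)) enum_uniq. Qed.
Lemma mon_mem (I : {set T}) (s : mon I) i : (i \in leaves (sval s)) = (i \in I).
Proof. by rewrite (perm_mem (svalP s)) mem_enum. Qed.

Lemma eq_tree_ev (L : lieAlg k) (u v : T -> L) t :
  {in leaves t, u =1 v} -> tree_ev u t = tree_ev v t.
Proof.
elim: t => [i|s hs t ht] /= h; first by apply: h; rewrite inE.
by rewrite hs ?ht // => i hi; apply: h; rewrite mem_cat hi ?orbT.
Qed.

Lemma tree_ev_multi (L : lieAlg k) (u v w : T -> L) e i t :
  uniq (leaves t) -> i \in leaves t -> u i = e *: v i + w i ->
  (forall j, j != i -> u j = v j /\ u j = w j) ->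
  tree_ev u t = e *: tree_ev v t + tree_ev w t.
Proof.
move=> + + hi hj; elim: t => [j|s IHs t IHt] /=.
  by rewrite inE => _ /eqP <-.
rewrite cat_uniq => /and3P[us /hasPn st ut]; rewrite mem_cat => ist.
have out r : i \notin leaves r -> tree_ev u r = tree_ev v r /\ tree_ev u r = tree_ev w r.
  move=> ir; split; apply: eq_tree_ev => j jr.
    by case: (hj j) => //; apply: contraNneq ir => <-.
  by case: (hj j) => //; apply: contraNneq ir => <-.
case/orP: ist => ii.
  have [<- <-] : tree_ev u t = tree_ev v t /\ tree_ev u t = tree_ev w t.
    by apply: out; apply/negP => /st; rewrite /= ii.
  by rewrite IHs // lie_brl.
have [<- <-] : tree_ev u s = tree_ev v s /\ tree_ev u s = tree_ev w s.
  by apply: out; apply: st.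
by rewrite IHt // lie_brr.
Qed.

Lemma eq_lie_ev (L : lieAlg k) (I : {set T}) (u v : T -> L) :
  {in I, u =1 v} -> forall x : Lie k I, lie_ev u x = lie_ev v x.
Proof.
move=> h; apply: pres_eq; try exact: lie_ev_lin.
by move=> s; rewrite !lie_evE; apply: eq_tree_ev => i; rewrite mon_mem; apply: h.
Qed.

Lemma lie_ev_multi (L : lieAlg k) (I : {set T}) (u v w : T -> L) e i (x : Lie k I) :
  i \in I -> u i = e *: v i + w i ->
  (forall j, j != i -> u j = v j /\ u j = w j) ->
  lie_ev u x = e *: lie_ev v x + lie_ev w x.
Proof.
move=> iI hi hj; move: x.
apply: (pres_eq (g := fun x => e *: lie_ev v x + lie_ev w x)).
- exact: lie_ev_lin.
- move=> a p q; rewrite !lie_ev_lin !scalerDr !scalerA (mulrC e) -!scalerA.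
  by rewrite addrACA.
by move=> s; rewrite !lie_evE (tree_ev_multi _ _ hi) ?mon_mem ?mon_uniq.
Qed.

Lemma free_ev_ftree x : free_ev (L := freeLie k T) (fun i => ftree (Var i)) x = x.
Proof.
move: x; apply: (@pres_eq k _ (@freeRel k T) (freeLie_car k T)
  (free_ev (L := freeLie k T) (fun i => ftree (Var i))) id) => //.
  exact: (@free_ev_lin k T (freeLie k T)).
move=> t; rewrite -/(ftree t) (@free_evE k T (freeLie k T)).
by elim: t => //= s -> t ->; rewrite free_brE.
Qed.

Definition homog (I : {set T}) (x : freeLie k T) := lie_inc (lie_proj I x) = x.

Lemma homog_inc (I : {set T}) (x : Lie k I) : homog I (lie_inc x).
Proof. by rewrite /homog lie_incK. Qed.

Lemma homog_tree (I : {set T}) t : perm_eq (leaves t) (enum I) -> homog I (ftree t).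
Proof. by move=> h; rewrite /homog (lie_projE k h) lie_incE. Qed.

Lemma homog_lin (I : {set T}) a x y : homog I x -> homog I y -> homog I (a *: x + y).
Proof. by rewrite /homog lie_proj_lin lie_inc_lin => -> ->. Qed.

Lemma homog0 (I : {set T}) : homog I 0.
Proof. by rewrite /homog (lin0 (@lie_proj_lin k T I)) (lin0 (@lie_inc_lin k T I)). Qed.

Lemma homog_br (I J : {set T}) x y : [disjoint I & J] ->
  homog I x -> homog J y -> homog (I :|: J) (free_br x y).
Proof.
move=> dIJ <- <-; move: (lie_proj I x) (lie_proj J y) => {x y} x y.
move: x; apply: pres_ind.
- rewrite (lin0 (@lie_inc_lin k T I)) (lin0 (@free_brl k T _)); exact: homog0.
- by move=> a p q hp hq; rewrite lie_inc_lin free_brl; apply: homog_lin.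
move=> s; rewrite lie_incE; move: y; apply: pres_ind.
- rewrite (lin0 (@lie_inc_lin k T J)) (lin0 (@free_br_linr k T _)); exact: homog0.
- by move=> a p q hp hq; rewrite lie_inc_lin free_br_linr; apply: homog_lin.
move=> t; rewrite lie_incE free_brE; apply: homog_tree; apply: uniq_perm.
- rewrite /= cat_uniq !mon_uniq andbT /=; apply/hasPn => i /=.
  by rewrite !mon_mem => iJ; apply/negP => iI; move/pred0P: dIJ => /(_ i) /=; rewrite iI iJ.
- exact: enum_uniq.
by move=> i; rewrite /= mem_cat !mon_mem mem_enum inE.
Qed.
End EvalFacts.

Lemma tree_ev_homog (k : comPzRingType) (S T : finType) (I : T -> {set S})
    (f : T -> freeLie k S) t :
  (forall i j, i != j -> [disjoint I i & I j]) -> (forall i, homog (I i) (f i)) ->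
  uniq (leaves t) -> homog (\bigcup_(i in leaves t) I i) (tree_ev f t).
Proof.
move=> dI hf; elim: t => [i _|s IHs t IHt] /=.
  by rewrite (eq_bigl (pred1 i)) ?big_pred1_eq // => j; rewrite !inE.
rewrite cat_uniq => /and3P[us /hasPn st ut].
have -> : \bigcup_(i in leaves s ++ leaves t) I i =
   (\bigcup_(i in leaves s) I i) :|: (\bigcup_(i in leaves t) I i).
  apply/setP => x; rewrite inE; apply/bigcupP/orP.
    by case=> i; rewrite mem_cat => /orP[] ii xi; [left|right]; apply/bigcupP; exists i.
  by case=> /bigcupP[i ii xi]; exists i => //; rewrite mem_cat ii ?orbT.
apply: homog_br; [|exact: IHs|exact: IHt].
rewrite -setI_eq0; apply/eqP/setP => x; rewrite !inE; apply/negP => /andP[].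
move=> /bigcupP[i ii xi] /bigcupP[j jj xj].
have /dI /pred0P /(_ x) /= : i != j by apply: contraTneq ii => ->; apply: st.
by rewrite xi xj.
Qed.

Lemma lie_comp_inc (k : comPzRingType) (S T : finType) (J : {set T})
    (I : T -> {set S}) (K : {set S}) (g : Lie k J) (f : forall i, Lie k (I i)) :
  (forall i j, i != j -> [disjoint I i & I j]) -> K = \bigcup_(i in J) I i ->
  lie_inc (lie_comp K g f) = lie_ev (fun i => lie_inc (f i)) g.
Proof.
move=> dI ->; rewrite /lie_comp; move: g; apply: pres_ind.
- by rewrite !(lin0 (@lie_ev_lin _ _ _ _ _)); apply: homog0.
- by move=> a x y hx hy; rewrite !lie_ev_lin; apply: homog_lin.
move=> s; rewrite lie_evE.
have -> : \bigcup_(i in J) I i = \bigcup_(i in leaves (sval s)) I i.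
  by apply: eq_bigl => i; rewrite mon_mem.
apply: (tree_ev_homog (I := I)) => //; first by move=> i; apply: homog_inc.
exact: mon_uniq.
Qed.

Fixpoint tsubst (S T : Type) (f : T -> tree S) (t : tree T) : tree S :=
  match t with Var i => f i | Br a b => Br (tsubst f a) (tsubst f b) end.

Lemma lie_comp_mon (k : comPzRingType) (S T : finType) (J : {set T})
    (I : T -> {set S}) (K : {set S}) (g : tree T) (f : T -> tree S)
    (gJ : perm_eq (leaves g) (enum J))
    (fI : forall i, perm_eq (leaves (f i)) (enum (I i)))
    (gfK : perm_eq (leaves (tsubst f g)) (enum K)) :
  lie_comp K (lie_mon k gJ) (fun i => lie_mon k (fI i)) = lie_mon k gfK.
Proof.
rewrite -(lie_projE k gfK); congr (lie_proj K _); rewrite lie_evE /= {gJ gfK}.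
by elim: g => [i|a ha b hb] /=; rewrite ?lie_incE // ha hb free_brE.
Qed.

Section Shuffle.

(* The minimum of the preimage of i; the default n.+1 is only reached when that
   preimage is empty. *)
Definition minpre n m (alpha : 'I_n.+1 -> 'I_m.+1) (i : 'I_m.+1) : nat :=
  \big[Order.min/n.+1]_(x : 'I_n.+1 | alpha x == i) (x : nat).

Definition shuffling n m (alpha : {ffun 'I_n.+1 -> 'I_m.+1}) : bool :=
  [&& [forall i, exists x, alpha x == i], alpha ord0 == ord0 &
      [forall i : 'I_m.+1, forall j : 'I_m.+1, (i < j)%N ==> (minpre alpha i < minpre alpha j)%N]].

Definition shsurj n m := {alpha : {ffun 'I_n.+1 -> 'I_m.+1} | shuffling alpha}.

Lemma minpre_le n m (al : 'I_n.+1 -> 'I_m.+1) x : (minpre al (al x) <= x)%N.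
Proof.
by apply: (@bigmin_le_cond _ nat _ n.+1 x (fun y => al y == al x)
             (fun y : 'I_n.+1 => y : nat)).
Qed.

Lemma minpre_ex n m (al : 'I_n.+1 -> 'I_m.+1) i : (exists x, al x = i) ->
  exists2 x, al x = i & minpre al i = x.
Proof.
case=> x0 hx0.
case: (@eq_bigmin _ nat _ n.+1 x0 (fun x => al x == i) (fun x : 'I_n.+1 => x : nat)).
- by rewrite /= hx0.
- by move=> x _; rewrite leEnat ltnW.
by move=> x /eqP hx e; exists x.
Qed.

Lemma shufflingP n m (al : {ffun 'I_n.+1 -> 'I_m.+1}) :
  reflect [/\ forall i, exists x, al x = i, al ord0 = ord0 &
           forall i j : 'I_m.+1, (i < j)%N -> exists2 x, al x = i &
             forall y, al y = j -> (x < y)%N]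
          (shuffling al).
Proof.
apply: (iffP and3P) => [[/forallP h1 /eqP h2 /forallP h3]|[h1 h2 h3]].
  have s i : exists x, al x = i by have /existsP[x /eqP] := h1 i; exists x.
  split=> // i j ij; have /forallP/(_ j)/implyP/(_ ij) := h3 i.
  have [x <- ->] := minpre_ex (s i) => lt; exists x => // y yj.
  by apply: leq_trans lt _; rewrite -yj minpre_le.
split; last 1 first.
- apply/forallP => i; apply/forallP => j; apply/implyP => ij.
  have [x xi xy] := h3 i j ij.
  have [y /xy lt ->] := minpre_ex (h1 j).
  by apply: leq_ltn_trans lt; rewrite -xi minpre_le.
- by apply/forallP => i; have [x e] := h1 i; apply/existsP; exists x; apply/eqP.
- by apply/eqP.
Qed.

Lemma id_shuffling n : shuffling [ffun x : 'I_n.+1 => x].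
Proof.
apply/shufflingP; split=> [i||i j ij]; first by exists i; rewrite ffunE.
  by rewrite ffunE.
by exists i => [|y]; rewrite ffunE // => ->.
Qed.

Lemma comp_shuffling n m p (be : shsurj m p) (al : shsurj n m) :
  shuffling [ffun x => sval be (sval al x)].
Proof.
case: be al => [be /= /shufflingP[b1 b2 b3]] [al /= /shufflingP[a1 a2 a3]].
apply/shufflingP; split=> [i||i j ij].
- by have [y yi] := b1 i; have [x xy] := a1 y; exists x; rewrite ffunE xy.
- by rewrite ffunE a2.
have [b bi lb] := b3 i j ij.
have [c cb cmin] : exists2 c, al c = b & minpre al b = c by apply: minpre_ex.
exists c; first by rewrite ffunE cb.
move=> y; rewrite ffunE => /lb blt; have [x xb lx] := a3 _ _ blt.
by apply: leq_ltn_trans (lx y erefl); rewrite -cmin -xb minpre_le.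
Qed.

Definition shid n : shsurj n n := exist [eta @shuffling n n] _ (id_shuffling n).
Definition shcomp n m p (be : shsurj m p) (al : shsurj n m) : shsurj n p :=
  exist [eta @shuffling n p] _ (comp_shuffling be al).
End Shuffle.

Record linCat (k : comPzRingType) := LinCat {
  ob :> Type;
  mor : ob -> ob -> lmodType k;
  idm : forall x, mor x x;
  cmp : forall x y z, mor y z -> mor x y -> mor x z;
  cmp_linl : forall x y z (f : mor x y), linear (fun g : mor y z => cmp g f);
  cmp_linr : forall x y z (g : mor y z), linear (fun f : mor x y => cmp g f);
  cmp_idl : forall x y (f : mor x y), cmp (idm y) f = f;
  cmp_idr : forall x y (f : mor x y), cmp f (idm x) = f;
  cmp_assoc : forall w x y z (h : mor y z) (g : mor x y) (f : mor w x),
    cmp h (cmp g f) = cmp (cmp h g) f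
}.
Arguments mor {k C} : rename.
Arguments idm {k C} : rename.

Section Modules.
Variables (k : comPzRingType) (C : linCat k).

Record leftMod := LeftMod {
  lm_ob :> C -> lmodType k;
  lm_act : forall x y, mor x y -> lm_ob x -> lm_ob y;
  lm_linl : forall x y u, linear (fun f : mor x y => lm_act f u);
  lm_linr : forall x y (f : mor x y), linear (lm_act f);
  lm_id : forall x u, lm_act (idm x) u = u;
  lm_cmp : forall x y z (g : mor y z) (f : mor x y) u,
    lm_act (cmp g f) u = lm_act g (lm_act f u)
}.

Record rightMod := RightMod {
  rm_ob :> C -> lmodType k;
  rm_act : forall x y, mor x y -> rm_ob y -> rm_ob x;
  rm_linl : forall x y u, linear (fun f : mor x y => rm_act f u);
  rm_linr : forall x y (f : mor x y), linear (rm_act f);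
  rm_id : forall x u, rm_act (idm x) u = u;
  rm_cmp : forall x y z (g : mor y z) (f : mor x y) u,
    rm_act (cmp g f) u = rm_act f (rm_act g u)
}.

Record lmHom (F F' : leftMod) := LmHom {
  lmh :> forall x : C, F x -> F' x;
  lmh_lin : forall x, linear (@lmh x);
  lmh_nat : forall x y (f : mor x y) u, lmh (lm_act f u) = lm_act f (lmh u)
}.

Definition lm_surj (F F' : leftMod) (p : lmHom F F') := forall x (v : F' x), exists u, p x u = v.

Definition projective (P : leftMod) : Prop :=
  forall (F F' : leftMod) (p : lmHom F F') (h : lmHom P F'), lm_surj p ->
    exists h' : lmHom P F, forall x u, p x (h' x u) = h x u.

(* Projective resolutions ... -> P 1 -> P 0 -> F -> 0. *)
Record projRes (F : leftMod) := ProjRes {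
  pr_ob :> nat -> leftMod;
  pr_d : forall n, lmHom (pr_ob n.+1) (pr_ob n);
  pr_aug : lmHom (pr_ob 0) F;
  pr_proj : forall n, projective (pr_ob n);
  pr_surj : lm_surj pr_aug;
  pr_exact0 : forall x (u : pr_ob 0 x),
    pr_aug x u = 0 <-> exists v, pr_d 0 x v = u;
  pr_exact : forall n x (u : pr_ob n.+1 x),
    pr_d n x u = 0 <-> exists v, pr_d n.+1 x v = u
}.

Section TensorC.
Variables (G : rightMod) (F : leftMod).

Definition tensCgen := {x : C & (G x * F x)%type}.
Definition tgen x (g : G x) (u : F x) : fexpr k tensCgen :=
  Gen (existT (fun x : C => (G x * F x)%type) x (g, u)).

Inductive tensCRel : fexpr k tensCgen -> fexpr k tensCgen -> Prop :=
| TensCL x a (g g' : G x) (u : F x) :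
    tensCRel (tgen (a *: g + g') u) (Add (Scale a (tgen g u)) (tgen g' u))
| TensCR x a (g : G x) (u u' : F x) :
    tensCRel (tgen g (a *: u + u')) (Add (Scale a (tgen g u)) (tgen g u'))
| TensCBal x y (f : mor x y) (g : G y) (u : F x) :
    tensCRel (tgen (rm_act f g) u) (tgen g (lm_act f u)).

Definition tensC : lmodType k := pres tensCRel.
Definition ptensC x (g : G x) (u : F x) : tensC :=
  gen tensCRel (existT (fun x : C => (G x * F x)%type) x (g, u)).

Lemma ptensC_linl x a (g g' : G x) (u : F x) :
  ptensC (a *: g + g') u = a *: ptensC g u + ptensC g' u.
Proof. exact: (pres_rel (TensCL a g g' u)). Qed.
Lemma ptensC_linr x a (g : G x) (u u' : F x) :
  ptensC g (a *: u + u') = a *: ptensC g u + ptensC g u'.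
Proof. exact: (pres_rel (TensCR a g u u')). Qed.
Lemma ptensC_bal x y (f : mor x y) (g : G y) (u : F x) :
  ptensC (rm_act f g) u = ptensC g (lm_act f u).
Proof. exact: (pres_rel (TensCBal f g u)). Qed.
End TensorC.

Definition tensC_map (G : rightMod) (F F' : leftMod) (h : lmHom F F') :
    tensC G F -> tensC G F' :=
  presLift (fun p => ptensC (projT2 p).1 (h (projT1 p) (projT2 p).2)).

Lemma tensC_map_resp (G : rightMod) (F F' : leftMod) (h : lmHom F F') : respects (@tensCRel G F)
  (fun p => ptensC (projT2 p).1 (h (projT1 p) (projT2 p).2)).
Proof.
move=> _ _ [x a g g' u|x a g u u'|x y f g u] /=.
- exact: ptensC_linl.
- by rewrite (lmh_lin h) ptensC_linr.
- by rewrite (lmh_nat h) ptensC_bal.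
Qed.
Lemma tensC_map_lin (G : rightMod) (F F' : leftMod) (h : lmHom F F') : linear (tensC_map (G := G) h).
Proof. exact/presLift_lin/tensC_map_resp. Qed.
Lemma tensC_mapE (G : rightMod) (F F' : leftMod) (h : lmHom F F') x (g : G x) (u : F x) :
  tensC_map h (ptensC g u) = ptensC g (h x u).
Proof. exact: (presLift_gen (@tensC_map_resp G F F' h)). Qed.
End Modules.

Section KerIm.
Variables (k : comPzRingType) (U V : lmodType k) (f : {linear U -> V}).

Lemma ker0 : f 0 = 0. Proof. exact: linear0. Qed.
Lemma ker_lin a x y : f x = 0 -> f y = 0 -> f (a *: x + y) = 0.
Proof. by rewrite linearP => -> ->; rewrite scaler0 addr0. Qed.
Definition kerSub : submod U := Submod ker0 ker_lin.

Lemma im0 : exists x, f x = 0. Proof. by exists 0; rewrite linear0. Qed.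
Lemma im_lin a u v : (exists x, f x = u) -> (exists x, f x = v) ->
  exists x, f x = a *: u + v.
Proof. by move=> [x <-] [y <-]; exists (a *: x + y); rewrite linearP. Qed.
Definition imSub : submod V := Submod im0 im_lin.
End KerIm.

Section Full.
Variables (k : comPzRingType) (V : lmodType k).
Definition fullSub : submod V := @Submod k V (fun=> True) I (fun _ _ _ _ _ => I).
End Full.

Definition coker (k : comPzRingType) (U V : lmodType k) (f : {linear U -> V}) :
  lmodType k := subquot (fullSub V) (imSub f).

Record complex (k : comPzRingType) := Complex {
  cx_ob :> nat -> lmodType k;
  cx_d : forall n, {linear cx_ob n.+1 -> cx_ob n};
  cx_dd : forall n u, cx_d n (cx_d n.+1 u) = 0
}.

Definition cycles (k : comPzRingType) (X : complex k) (n : nat) : submod (X n) :=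
  match n with 0 => fullSub (X 0) | n.+1 => kerSub (cx_d X n) end.

Definition homology (k : comPzRingType) (X : complex k) (n : nat) : lmodType k :=
  subquot (cycles X n) (imSub (cx_d X n)).

Section Tor.
Variables (k : comPzRingType) (C : linCat k) (G : rightMod C) (F : leftMod C).
Variable P : projRes F.

Definition tor_d n : {linear tensC G (P n.+1) -> tensC G (P n)} :=
  linMap (tensC_map_lin (pr_d P n)).

Lemma tor_dd n u : tor_d n (tor_d n.+1 u) = 0.
Proof.
move: u; apply: pres_ind => [|a x y hx hy|[x [g u]]].
- by rewrite !linear0.
- by rewrite !linearP hx hy scaler0 addr0.
rewrite -/(ptensC g u) /= !tensC_mapE.
have -> : pr_d P n x (pr_d P n.+1 x u) = 0 by apply/pr_exact; exists u.
by have /lin0 : linear (ptensC (F := P n) g) by move=> a v w; apply: ptensC_linr.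
Qed.

Definition tor_complex : complex k := Complex tor_dd.

(* The value at F of the n-th left derived functor of G (x)_C -, computed with the
   projective resolution P.  Resolutions always exist: see freeRes. *)
Definition Tor (n : nat) : lmodType k := homology tor_complex n.
End Tor.

Lemma free_ev_comp (k : comPzRingType) (S T : finType) (L : lieAlg k)
    (a : S -> L) (b : T -> freeLie k S) (I : {set T}) (x : Lie k I) :
  free_ev a (lie_ev b x) = lie_ev (fun i => free_ev a (b i)) x.
Proof.
move: x; apply: (pres_eq (f := fun x => free_ev a (lie_ev b x))
   (g := fun x => lie_ev (fun i => free_ev a (b i)) x)).
- by move=> e u v; rewrite lie_ev_lin free_ev_lin.
- exact: lie_ev_lin.
move=> s; rewrite !lie_evE; elim: (sval s) => //= p <- q <-.
exact: free_ev_br.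
Qed.

Section Gamma.
Variable k : comPzRingType.

Definition fib n m (al : shsurj n m) (i : 'I_m.+1) : {set 'I_n.+1} :=
  sval al @^-1: [set i].

Definition gam_sum n m (al : shsurj n m) : lmodType k :=
  tens (fun i => Lie k (fib al i)).
Definition gam n m : lmodType k := dsum (@gam_sum n m).

(* The morphism (al, f_0 (x) ... (x) f_m). *)
Definition gpure n m (al : shsurj n m) (f : forall i, Lie k (fib al i)) : gam n m :=
  @dinj k (shsurj n m) (@gam_sum n m) al (ptens f).

Definition gcmp_pure n m p (be : shsurj m p) (g : forall i, Lie k (fib be i))
    (al : shsurj n m) (f : forall i, Lie k (fib al i)) : gam n p :=
  gpure (al := shcomp be al)
    (fun l => lie_comp (fib (shcomp be al) l) (g l) f).

Definition gcmpr n m p (be : shsurj m p) (g : forall i, Lie k (fib be i))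
    (f : gam n m) : gam n p :=
  dsumLift (fun al => tensLift (fun fs => @gcmp_pure n m p be g al fs)) f.
Definition gcmp n m p (g : gam m p) (f : gam n m) : gam n p :=
  dsumLift (fun be => tensLift (fun gs => @gcmpr n m p be gs f)) g.

Lemma in_fib n m (al : shsurj n m) i x : (x \in fib al i) = (sval al x == i).
Proof. by rewrite !inE. Qed.

Lemma fib_disj n m (al : shsurj n m) i j : i != j -> [disjoint fib al i & fib al j].
Proof.
move=> ij; apply/pred0P => x /=; rewrite !in_fib.
by apply/negP => /andP[/eqP-> /eqP e]; rewrite e eqxx in ij.
Qed.

Lemma fib_comp n m p (be : shsurj m p) (al : shsurj n m) l :
  fib (shcomp be al) l = \bigcup_(i in fib be l) fib al i.
Proof.
apply/setP => x; rewrite in_fib /= ffunE; apply/idP/bigcupP => [h|[i]].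
  by exists (sval al x); rewrite in_fib.
by rewrite !in_fib => /eqP <- /eqP ->.
Qed.

Lemma gam_ind n m (P : gam n m -> Prop) :
  P 0 -> (forall a x y, P x -> P y -> P (a *: x + y)) ->
  (forall al f, P (@gpure n m al f)) -> forall x, P x.
Proof.
move=> P0 PL Pg; apply: dsum_ind => // al; apply: tens_ind => //.
- by rewrite (lin0 (@dinj_lin _ _ _ _)).
- by move=> a x y hx hy; rewrite dinj_lin; apply: PL.
- by move=> u; apply: Pg.
Qed.

Lemma gam_eq n m (V : lmodType k) (f g : gam n m -> V) :
  linear f -> linear g -> (forall al u, f (@gpure n m al u) = g (gpure u)) -> f =1 g.
Proof.
move=> fl gl fg; apply: gam_ind => //; first by rewrite (lin0 fl) (lin0 gl).
by move=> a x y hx hy; rewrite fl gl hx hy.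
Qed.

Lemma gpure_multi n m al i a u v w : lin_at i a u v w ->
  @gpure n m al u = a *: gpure v + gpure w.
Proof. by move=> h; rewrite /gpure (ptens_multi h) dinj_lin. Qed.

Lemma gpure_cast n m (al al' : shsurj n m) (x y : 'I_m.+1 -> freeLie k 'I_n.+1) :
  al = al' -> x =1 y ->
  gpure (fun i => lie_proj (fib al i) (x i)) = gpure (fun i => lie_proj (fib al' i) (y i)).
Proof. by move=> <- /funext ->. Qed.

Lemma gpure_proj n m (al : shsurj n m) (f : forall i, Lie k (fib al i)) :
  gpure f = gpure (fun i => lie_proj (fib al i) (lie_inc (f i))).
Proof. by congr gpure; apply: functional_extensionality_dep => i; rewrite lie_incK. Qed.

Lemma gcmp_pure_multi n m p be g al : multilinear (@gcmp_pure n m p be g al).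
Proof.
move=> i e u v w [hi hj]; apply: (@gpure_multi _ _ _ (sval be i) e).
split=> [|l li].
  rewrite /lie_comp (lie_ev_multi (v := fun i => lie_inc (v i))
    (w := fun i => lie_inc (w i)) (e := e) (i := i)) ?lie_proj_lin //.
  - by rewrite in_fib.
  - by rewrite hi lie_inc_lin.
  - by move=> j /hj[-> ->].
by split; rewrite /lie_comp; congr lie_proj; apply: eq_lie_ev => j;
  rewrite in_fib => /eqP jl; case: (hj j) => [|-> ->] //;
  apply: contraNneq li => <-; rewrite jl.
Qed.

Lemma gcmpr_lin n m p be g : linear (@gcmpr n m p be g).
Proof.
apply: dsumLift_lin => al; apply: tensLift_lin; exact: gcmp_pure_multi.
Qed.
Lemma gcmprE n m p be g al f : @gcmpr n m p be g (gpure f) = @gcmp_pure n m p be g al f.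
Proof.
rewrite /gcmpr /gpure dsumLift_inj; last first.
  by move=> al'; apply: tensLift_lin; apply: gcmp_pure_multi.
exact/tensLift_p/gcmp_pure_multi.
Qed.

Lemma gcmpr_multi n m p be f : multilinear (fun g => @gcmpr n m p be g f).
Proof.
move=> l e u v w [hl hj]; move: f.
apply: (gam_eq (g := fun f => e *: gcmpr v f + gcmpr w f)).
- exact: gcmpr_lin.
- move=> a x y; rewrite !gcmpr_lin !scalerDr !scalerA (mulrC e) -!scalerA.
  by rewrite addrACA.
move=> al f; rewrite !gcmprE; apply: (@gpure_multi _ _ _ l e).
split=> [|j /hj[-> ->] //].
by rewrite /lie_comp hl lie_ev_lin lie_proj_lin.
Qed.

Lemma gcmp_linl n m p (f : gam n m) : linear (fun g : gam m p => gcmp g f).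
Proof. by apply: dsumLift_lin => be; apply: tensLift_lin; apply: gcmpr_multi. Qed.
Lemma gcmp_purel n m p be g f : gcmp (gpure g) f = @gcmpr n m p be g f.
Proof.
rewrite /gcmp /gpure dsumLift_inj; last first.
  by move=> al'; apply: tensLift_lin; apply: gcmpr_multi.
by apply: (@tensLift_p _ _ _ _ (fun gs => gcmpr gs f)); apply: gcmpr_multi.
Qed.
Lemma gcmpE n m p be g al f : gcmp (gpure g) (gpure f) = @gcmp_pure n m p be g al f.
Proof. by rewrite gcmp_purel gcmprE. Qed.
Lemma gcmp_linr n m p (g : gam m p) : linear (fun f : gam n m => gcmp g f).
Proof.
move=> e u v; move: g; apply: (gam_eq (f := fun g => gcmp g (e *: u + v))
   (g := fun g => e *: gcmp g u + gcmp g v)).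
- exact: gcmp_linl.
- move=> a x y; rewrite !gcmp_linl !scalerDr !scalerA (mulrC e) -!scalerA.
  by rewrite addrACA.
by move=> be g; rewrite !gcmp_purel gcmpr_lin.
Qed.

Lemma fib_id n i : perm_eq (leaves (Var i)) (enum (fib (shid n) i)).
Proof.
have -> : fib (shid n) i = [set i] by apply/setP => x; rewrite in_fib /= ffunE inE.
by rewrite enum_set1.
Qed.

(* The identity is (id, x_0 (x) ... (x) x_n). *)
Definition gid n : gam n n := gpure (fun i => lie_mon k (fib_id i)).

Lemma shcomp_idl n m (al : shsurj n m) : shcomp (shid m) al = al.
Proof. by apply: val_inj; apply/ffunP => x; rewrite /= !ffunE. Qed.
Lemma shcomp_idr n m (al : shsurj n m) : shcomp al (shid n) = al.
Proof. by apply: val_inj; apply/ffunP => x; rewrite /= !ffunE. Qed.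
Lemma shcompA n m p q (ga : shsurj p q) (be : shsurj m p) (al : shsurj n m) :
  shcomp ga (shcomp be al) = shcomp (shcomp ga be) al.
Proof. by apply: val_inj; apply/ffunP => x; rewrite /= !ffunE. Qed.

Lemma gcmp_idl n m (f : gam n m) : gcmp (gid m) f = f.
Proof.
move: f; apply: (gam_eq (g := id)) => //; first exact: gcmp_linr.
move=> al f; rewrite gcmpE [RHS]gpure_proj; apply: gpure_cast.
  exact: shcomp_idl.
by move=> i; rewrite lie_evE.
Qed.

Lemma gcmp_idr n m (f : gam n m) : gcmp f (gid n) = f.
Proof.
move: f; apply: (gam_eq (f := fun f => gcmp f (gid n)) (g := id)) => //.
  exact: gcmp_linl.
move=> al f; rewrite gcmpE [RHS]gpure_proj; apply: gpure_cast.
  exact: shcomp_idr.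
move=> i; rewrite -[RHS]free_ev_ftree; apply: eq_lie_ev => j _.
by rewrite lie_incE.
Qed.

Lemma lie_comp_gam n m p (be : shsurj m p) (al : shsurj n m)
    (g : forall i, Lie k (fib be i)) (f : forall i, Lie k (fib al i)) l :
  lie_inc (lie_comp (fib (shcomp be al) l) (g l) f) =
  lie_ev (fun i => lie_inc (f i)) (g l).
Proof. by apply: lie_comp_inc; [apply: fib_disj|apply: fib_comp]. Qed.

Lemma gcmp_assoc n m p q (h : gam p q) (g : gam m p) (f : gam n m) :
  gcmp h (gcmp g f) = gcmp (gcmp h g) f.
Proof.
move: h; apply: (gam_eq (f := fun h => gcmp h (gcmp g f))
  (g := fun h => gcmp (gcmp h g) f)).
- exact: gcmp_linl.
- by move=> e u v; rewrite !gcmp_linl.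
move=> ga h; move: g; apply: (gam_eq (f := fun g => gcmp (gpure h) (gcmp g f))
  (g := fun g => gcmp (gcmp (gpure h) g) f)).
- by move=> e u v; rewrite gcmp_linl gcmp_linr.
- by move=> e u v; rewrite gcmp_linr gcmp_linl.
move=> be g; move: f; apply: (gam_eq (f := fun f => gcmp (gpure h) (gcmp (gpure g) f))
  (g := fun f => gcmp (gcmp (gpure h) (gpure g)) f)).
- by move=> e u v; rewrite !gcmp_linr.
- exact: gcmp_linr.
move=> al f; rewrite !gcmpE; apply: gpure_cast; first exact: shcompA.
move=> i; rewrite [in RHS]/lie_ev lie_comp_gam free_ev_comp.
by apply: eq_lie_ev => j _; rewrite lie_comp_gam.
Qed.

Definition Gamma : linCat k := @LinCat k nat gam gid gcmp
  gcmp_linl gcmp_linr gcmp_idl gcmp_idr gcmp_assoc.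

Lemma sh01_shuffling : shuffling (n := 1) [ffun=> ord0 : 'I_1].
Proof.
apply/shufflingP; split=> [i||i j]; last by rewrite [i]ord1 [j]ord1.
  by exists ord0; rewrite ffunE [i]ord1.
by rewrite ffunE.
Qed.
Definition sh01 : shsurj 1 0 := exist [eta @shuffling 1 0] _ sh01_shuffling.

Lemma fib01 (i : 'I_1) : perm_eq (leaves (Br (Var ord0) (Var ord_max))) (enum (fib sh01 i)).
Proof.
apply: uniq_perm => //; first exact: enum_uniq.
move=> x; rewrite mem_enum in_fib /= ffunE !inE [i]ord1 eqxx.
by case: x => [[|[|x]] hx].
Qed.

Definition d01 : gam 1 0 := gpure (fun i => lie_mon k (fib01 i)).
End Gamma.

Arguments gcmp_linr {k n m p}.

Section Coker.
Variables (k : comPzRingType) (U V : lmodType k) (f : {linear U -> V}).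

Definition ckp (v : V) : coker f :=
  qclass (C := subquotCong (fullSub V) (imSub f)) (exist _ v I).
Definition ckrepr (x : coker f) : V :=
  sval (qrepr (C := subquotCong (fullSub V) (imSub f)) x).

Lemma ckreprK x : ckp (ckrepr x) = x.
Proof.
rewrite /ckp /ckrepr -[RHS](@qreprK _ (subquotCong (fullSub V) (imSub f)) x).
by congr qclass; case: (qrepr x) => v [].
Qed.
Lemma ckpP u v : ckp u = ckp v <-> exists x, f x = u - v.
Proof. exact: (@qclassP _ (subquotCong (fullSub V) (imSub f))). Qed.
Lemma ckp_lin : linear ckp.
Proof.
move=> a u v.
pose C := subquotCong (fullSub V) (imSub f).
rewrite /ckp -(@qclassZ _ C) -(@qclassD _ C).
by congr qclass; congr exist.
Qed.
End Coker.

Section T.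
Variable k : comPzRingType.

Definition t_rel n : {linear gam k n 1 -> gam k n 0} :=
  linMap (gcmp_linr (n := n) (d01 k)).
Definition t_ob n : lmodType k := coker (t_rel n).
Definition t_act n m (f : gam k n m) (u : t_ob m) : t_ob n :=
  ckp (t_rel n) (gcmp (ckrepr u) f).

Lemma t_actE n m (f : gam k n m) (g : gam k m 0) :
  t_act f (ckp (t_rel m) g) = ckp (t_rel n) (gcmp g f).
Proof.
apply/ckpP.
have /ckpP[v hv] := ckreprK (ckp (t_rel m) g).
exists (gcmp v f); rewrite /= gcmp_assoc.
move: hv => /= ->.
by rewrite addrC -scaleN1r gcmp_linl scaleN1r addrC.
Qed.

Lemma t_linl n m u : linear (fun f : gam k n m => t_act f u).
Proof. by move=> a f g; rewrite /t_act gcmp_linr ckp_lin. Qed.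
Lemma t_linr n m (f : gam k n m) : linear (t_act f).
Proof.
by move=> a x y; rewrite -[x]ckreprK -[y]ckreprK -ckp_lin !t_actE gcmp_linl ckp_lin.
Qed.
Lemma t_id n (u : t_ob n) : t_act (gid k n) u = u.
Proof. by rewrite -[u]ckreprK t_actE gcmp_idr. Qed.
Lemma t_cmp n m p (g : gam k m p) (f : gam k n m) u :
  t_act (gcmp g f) u = t_act f (t_act g u).
Proof. by rewrite -[u]ckreprK !t_actE gcmp_assoc. Qed.

Definition tmod : rightMod (Gamma k) :=
  @RightMod k (Gamma k) t_ob t_act t_linl t_linr t_id t_cmp.
End T.

Section Loday.
Variables (k : comPzRingType) (A : lieAlg k) (M : lieMod A).

(* The factors of M (x) A^(x)n, with their embeddings in M + A. *)
Definition LVn (v : nat) : lmodType k := if v is 0 then M : lmodType k else A.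
Definition LV n (i : 'I_n.+1) : lmodType k := LVn i.
Definition lv_inn (v : nat) : LVn v -> semidirect M :=
  match v return LVn v -> semidirect M with
  | 0 => fun x => (x, 0) | _.+1 => fun a => (0, a) end.
Definition lv_outn (v : nat) : semidirect M -> LVn v :=
  match v return semidirect M -> LVn v with
  | 0 => fun u => u.1 | _.+1 => fun u => u.2 end.
Definition lv_in n (i : 'I_n.+1) : LV i -> semidirect M := @lv_inn i.
Definition lv_out n (i : 'I_n.+1) : semidirect M -> LV i := @lv_outn i.

Lemma lv_in_lin n (i : 'I_n.+1) : linear (@lv_in n i).
Proof.
case: i => [[|i] hi] a x y; rewrite /lv_in /=; congr pair => /=;
by rewrite ?scaler0 ?addr0.
Qed.
Lemma lv_out_lin n (i : 'I_n.+1) : linear (@lv_out n i).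
Proof. by case: i => [[|i] hi] a x y. Qed.
Lemma lv_inK n (i : 'I_n.+1) : cancel (@lv_in n i) (@lv_out n i).
Proof. by case: i => [[|i] hi]. Qed.

(* u lies in M if v = 0, and in A otherwise, as elements of M + A. *)
Definition in_slot (v : nat) (u : semidirect M) : Prop :=
  if v is 0 then u.2 = 0 else u.1 = 0.
Lemma lv_outK n (i : 'I_n.+1) u : in_slot i u -> lv_in (lv_out i u) = u.
Proof. by case: i => [[|i] hi]; case: u => [x a] /= ->. Qed.
Lemma in_slot_in n (i : 'I_n.+1) (x : LV i) : in_slot i (lv_in x).
Proof. by case: i x => [[|i] hi]. Qed.
Lemma in_slot_br v w u u' : in_slot v u -> in_slot w.+1 u' ->
  in_slot v (lie_br u u').
Proof.
have z a : lmod_br (0 : M) a = 0 by exact: (lin0 (@lmod_brl _ _ M a)).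
have z' a : lie_br (0 : A) a = 0 by exact: (lin0 (@lie_brl _ A a)).
by case: v u u' => [|v] [x a] [y b] /= h h'; rewrite ?h ?h' ?z' ?z ?subr0.
Qed.

Definition lod_ob n : lmodType k := tens (@LV n).

(* b_i is the value of f_i at the a_j, computed in M + A. *)
Definition lod_val n m (al : shsurj n m) (f : forall i, Lie k (fib al i))
    (a : fam (@LV n)) : fam (@LV m) :=
  fun i => lv_out i (lie_ev (fun j => lv_in (a j)) (f i)).

Definition lod_pure n m (phi : gam k n m) (a : fam (@LV n)) : lod_ob m :=
  dsumLift (fun al => tensLift (fun f => ptens (@lod_val n m al f a))) phi.
Definition lod_act n m (phi : gam k n m) : lod_ob n -> lod_ob m :=
  tensLift (lod_pure phi).

Lemma lod_val_multi n m al a :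
  multilinear (fun f => ptens (@lod_val n m al f a)).
Proof.
move=> i e u v w [hi hj]; apply: (@ptens_multi _ _ _ i e).
split=> [|j /hj[e1 e2]]; first by rewrite /lod_val hi lie_ev_lin lv_out_lin.
by rewrite /lod_val -e1 -e2.
Qed.

Lemma lod_pure_lin n m a : linear (fun phi => @lod_pure n m phi a).
Proof. by apply: dsumLift_lin => al; apply: tensLift_lin; apply: lod_val_multi. Qed.
Lemma lod_pureE n m al f a :
  @lod_pure n m (gpure f) a = ptens (@lod_val n m al f a).
Proof.
rewrite /lod_pure /gpure dsumLift_inj; last first.
  by move=> al'; apply: tensLift_lin; apply: lod_val_multi.
by apply: (@tensLift_p _ _ _ _ (fun f => ptens (lod_val f a))); apply: lod_val_multi.
Qed.

Lemma lod_pure_multi n m phi : multilinear (@lod_pure n m phi).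
Proof.
move=> j e u v w [hj hi]; move: phi; apply: (gam_eq
  (f := fun phi => lod_pure phi u) (g := fun phi => e *: lod_pure phi v + lod_pure phi w)).
- exact: lod_pure_lin.
- move=> a x y; rewrite !lod_pure_lin !scalerDr !scalerA (mulrC e) -!scalerA.
  by rewrite addrACA.
move=> al f; rewrite !lod_pureE; apply: (@ptens_multi _ _ _ (sval al j) e).
split=> [|i ij].
  rewrite /lod_val (lie_ev_multi (v := fun i => lv_in (v i))
    (w := fun i => lv_in (w i)) (e := e) (i := j)) ?lv_out_lin //.
  - by rewrite in_fib.
  - by rewrite hj lv_in_lin.
  - by move=> i /hi[-> ->].
by split; rewrite /lod_val; congr lv_out; apply: eq_lie_ev => l;
  rewrite in_fib => /eqP li; case: (hi l) => [|-> ->] //;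
  apply: contraNneq ij => <-; rewrite li.
Qed.

Lemma lod_actE n m phi a : @lod_act n m phi (ptens a) = lod_pure phi a.
Proof. exact/tensLift_p/lod_pure_multi. Qed.
Lemma lod_linr n m phi : linear (@lod_act n m phi).
Proof. exact/tensLift_lin/lod_pure_multi. Qed.
Lemma lod_linl n m u : linear (fun phi => @lod_act n m phi u).
Proof.
move=> e x y; move: u; apply: (pres_eq (f := lod_act (e *: x + y))
  (g := fun u => e *: lod_act x u + lod_act y u)).
- exact: lod_linr.
- move=> a p q; rewrite !lod_linr !scalerDr !scalerA (mulrC e) -!scalerA.
  by rewrite addrACA.
by move=> a; rewrite -/(ptens a) !lod_actE lod_pure_lin.
Qed.

Lemma tree_ev_slot n (a : fam (@LV n)) t : uniq (leaves t) ->
  if ord0 \in leaves t then (tree_ev (fun j => lv_in (a j)) t).2 = 0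
  else (tree_ev (fun j => lv_in (a j)) t).1 = 0.
Proof.
have zl b : lmod_br (0 : M) b = 0 by exact: (lin0 (@lmod_brl _ _ M b)).
have zr x : lmod_br (x : M) 0 = 0 by exact: (lin0 (@lmod_brr _ _ M x)).
have z b : lie_br (0 : A) b = 0 by exact: (lin0 (@lie_brl _ A b)).
have z' b : lie_br b (0 : A) = 0 by exact: (lin0 (@lie_brr _ A b)).
elim: t => [i _|s IHs t IHt] /=.
  rewrite inE eq_sym; have := in_slot_in (a i).
  by case: i (a i) => [[|i] hi].
rewrite cat_uniq mem_cat => /and3P[/IHs hs /hasPn st /IHt ht].
case: ifP hs => [os ->|_ -> /=]; first by rewrite z.
by case: ifP ht => _ -> /=; rewrite ?z' ?zl ?subr0 //.
Qed.

Lemma lie_ev_slot n m (al : shsurj n m) (a : fam (@LV n)) i (f : Lie k (fib al i)) :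
  in_slot i (lie_ev (fun j => lv_in (a j)) f).
Proof.
move: f; apply: pres_ind => [|e x y hx hy|s].
- by rewrite (lin0 (@lie_ev_lin _ _ _ _ _)); case: i => [[|i] hi].
- by rewrite lie_ev_lin; case: i x y hx hy => [[|i] hi] x y /= -> ->; rewrite scaler0 addr0.
rewrite lie_evE; have := tree_ev_slot a (mon_uniq s); rewrite mon_mem in_fib.
have /shufflingP[_ -> _] := svalP al.
by case: i s => [[|i] hi] s.
Qed.

Lemma lod_id n u : @lod_act n n (gid k n) u = u.
Proof.
move: u; apply: (pres_eq (g := id)) => //; first exact: lod_linr.
move=> a; rewrite -/(ptens a) lod_actE lod_pureE; congr ptens.
by apply: functional_extensionality_dep => i; rewrite /lod_val lie_evE /= lv_inK.
Qed.

Lemma lod_cmp n m p (psi : gam k m p) (phi : gam k n m) u :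
  lod_act (gcmp psi phi) u = lod_act psi (lod_act phi u).
Proof.
move: psi; apply: (gam_eq (f := fun psi => lod_act (gcmp psi phi) u)
  (g := fun psi => lod_act psi (lod_act phi u))).
- by move=> e x y; rewrite gcmp_linl lod_linl.
- exact: lod_linl.
move=> be g; move: phi; apply: (gam_eq (f := fun phi => lod_act (gcmp (gpure g) phi) u)
  (g := fun phi => lod_act (gpure g) (lod_act phi u))).
- by move=> e x y; rewrite gcmp_linr lod_linl.
- by move=> e x y; rewrite lod_linl lod_linr.
move=> al f; move: u; apply: (pres_eq
  (f := fun u => lod_act (gcmp (gpure g) (gpure f)) u)
  (g := fun u => lod_act (gpure g) (lod_act (gpure f) u))).
- exact: lod_linr.
- by move=> e x y; rewrite !lod_linr.
move=> a; rewrite -/(ptens a) gcmpE !lod_actE !lod_pureE lod_actE lod_pureE.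
congr ptens; apply: functional_extensionality_dep => i.
rewrite /lod_val [in LHS]/lie_ev lie_comp_gam free_ev_comp; congr lv_out.
apply: eq_lie_ev => j _; rewrite lv_outK //.
exact: lie_ev_slot.
Qed.

Definition Loday : leftMod (Gamma k) :=
  @LeftMod k (Gamma k) lod_ob lod_act lod_linl lod_linr lod_id lod_cmp.

(* a_0, ..., [a_i, a_j], ..., a_n with a_j omitted, where c l is a_l in M + A.
   This is used for i < j only, so omitting a_j does not move the i-th entry. *)
Definition leib_merge n (j : 'I_n.+2) (i : 'I_n.+1) (c : 'I_n.+2 -> semidirect M)
    (l : 'I_n.+1) : semidirect M :=
  if l == i then lie_br (c (lift j l)) (c j) else c (lift j l).

Definition ptensM n (c : 'I_n.+1 -> semidirect M) : lod_ob n :=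
  ptens (fun l => lv_out l (c l)).

Definition leib_pure n (a : fam (@LV n.+1)) : lod_ob n :=
  \sum_(j < n.+2) \sum_(i < n.+1 | (i < j)%N)
     (-1) ^+ j *: ptensM (leib_merge j i (fun l => lv_in (a l))).

Definition leib_d n : lod_ob n.+1 -> lod_ob n := tensLift (@leib_pure n).

Lemma ptensM_multi n (i : 'I_n.+1) e (u v w : 'I_n.+1 -> semidirect M) :
  u i = e *: v i + w i -> (forall l, l != i -> u l = v l /\ u l = w l) ->
  ptensM u = e *: ptensM v + ptensM w.
Proof.
move=> hi hl; apply: (@ptens_multi _ _ _ i e); split; first by rewrite hi lv_out_lin.
by move=> l /hl[-> ->].
Qed.

Lemma lift_neq n (j : 'I_n.+2) (l : 'I_n.+1) : lift j l != j.
Proof. by rewrite eq_sym neq_lift. Qed.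

Lemma leib_merge_multi n (j : 'I_n.+2) (i : 'I_n.+1) s e (u v w : 'I_n.+2 -> semidirect M) :
  u s = e *: v s + w s -> (forall l, l != s -> u l = v l /\ u l = w l) ->
  ptensM (leib_merge j i u) = e *: ptensM (leib_merge j i v) + ptensM (leib_merge j i w).
Proof.
move=> hs hl; case: (unliftP j s) => [r sr|sj]; last first.
  apply: (@ptensM_multi _ i) => [|l li].
    rewrite /leib_merge eqxx; have [<- <-] := hl (lift j i) ltac:(by rewrite sj lift_neq).
    by rewrite -sj hs lie_brr.
  by rewrite /leib_merge (negbTE li); apply: hl; rewrite sj lift_neq.
have [uj uj'] := hl j ltac:(by rewrite sr neq_lift).
apply: (@ptensM_multi _ r) => [|l li].
  rewrite /leib_merge -sr hs; case: ifP => // _.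
  by rewrite -uj -uj' lie_brl.
rewrite /leib_merge; have [<- <-] := hl (lift j l) ltac:(by rewrite sr (inj_eq lift_inj)).
by rewrite -uj -uj'.
Qed.

Lemma sum_lin (I : finType) (P : pred I) (V : lmodType k) e (F G H : I -> V) :
  (forall i, P i -> F i = e *: G i + H i) ->
  \sum_(i | P i) F i = e *: (\sum_(i | P i) G i) + \sum_(i | P i) H i.
Proof. by move=> h; rewrite scaler_sumr -big_split; apply: eq_bigr. Qed.

Lemma leib_pure_multi n : multilinear (@leib_pure n).
Proof.
move=> s e u v w [hs hl]; apply: sum_lin => j _; apply: sum_lin => i _.
rewrite (@leib_merge_multi _ j i s e _ (fun l => lv_in (v l)) (fun l => lv_in (w l))).
- by rewrite scalerDr !scalerA mulrC.
- by rewrite hs lv_in_lin.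
- by move=> l /hl[-> ->].
Qed.

Lemma leib_d_lin n : linear (@leib_d n).
Proof. exact/tensLift_lin/leib_pure_multi. Qed.

Lemma leib_dE n (c : 'I_n.+2 -> semidirect M) : (forall l : 'I_n.+2, in_slot l (c l)) ->
  leib_d (ptensM c) = \sum_(j < n.+2) \sum_(i < n.+1 | (i < j)%N)
     (-1) ^+ j *: ptensM (leib_merge j i c).
Proof.
move=> hc; rewrite /leib_d tensLift_p; last exact: leib_pure_multi.
have e : (fun l : 'I_n.+2 => lv_in (lv_out l (c l))) = c.
  by apply/funext => l; rewrite lv_outK.
by rewrite /leib_pure e.
Qed.

Lemma leib_merge_slot n (j : 'I_n.+2) (i : 'I_n.+1) (c : 'I_n.+2 -> semidirect M) :
  (i < j)%N -> (forall l : 'I_n.+2, in_slot l (c l)) ->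
  forall l : 'I_n.+1, in_slot l (leib_merge j i c l).
Proof.
move=> ij hc l; have sl : in_slot l (c (lift j l)).
  have := hc (lift j l); rewrite /= /bump.
  case: j l {hc} ij => [[|j] hj] [[|l] hl] //= _.
  by rewrite addnS.
rewrite /leib_merge; case: ifP => // _; case: j ij sl => [[|j] hj] // _ sl.
by apply: (@in_slot_br _ j) => //; apply: (hc (Ordinal hj)).
Qed.

Lemma simplicial_sum (V : lmodType k) N (E : 'I_N -> 'I_N.+1 -> V) :
  (forall j i : 'I_N, (j <= i)%N -> E j (lift ord0 i) = E i (widen_ord (leqnSn N) j)) ->
  \sum_(i < N.+1) (-1) ^+ i *: \sum_(j < N) (-1) ^+ j *: E j i = 0 :> V.
Proof.
move=> h; under eq_bigr do rewrite scaler_sumr.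
rewrite exchange_big /=.
have split1 (j : 'I_N) : \sum_(i < N.+1) (-1) ^+ i *: ((-1) ^+ j *: E j i) =
  \sum_(i < N | (i <= j)%N) (-1) ^+ (i + j) *: E j (widen_ord (leqnSn N) i) -
  \sum_(i < N | (j <= i)%N) (-1) ^+ (i + j) *: E i (widen_ord (leqnSn N) j).
  rewrite (bigID (fun i : 'I_N.+1 => (i <= j)%N)) /=; congr (_ + _).
    rewrite big_mkcond big_ord_recr /= leqNgt ltn_ord addr0 -big_mkcond /=.
    by apply: eq_bigr => i _; rewrite scalerA exprD.
  rewrite big_mkcond big_ord_recl /= add0r -big_mkcond /= -sumrN.
  apply: eq_big => i; first by rewrite /bump /= -ltnNge.
  rewrite /bump /= -ltnNge => ji.
  by rewrite h // scalerA -exprD addSn exprS mulN1r scaleNr.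
under eq_bigr do rewrite split1.
rewrite sumrB; apply/eqP; rewrite subr_eq0; apply/eqP.
rewrite [RHS](exchange_big_dep predT) //=.
by apply: eq_bigr => i _; apply: eq_bigr => j _; rewrite addnC.
Qed.

Lemma leib_bump1 i j x : (j <= i)%N -> bump i.+1 (bump j x) = bump j (bump i x).
Proof.
rewrite /bump => ji; case: (leqP j x) => h1; case: (leqP i x) => h2; rewrite /= ?add0n ?add1n ?ltnS.
- by rewrite h2 (leqW h1).
- by rewrite leqNgt h2 /= h1.
- by move: (leq_ltn_trans h2 h1); rewrite ltnNge ji.
- by rewrite ltnNge (ltnW h2) leqNgt h1.
Qed.
Lemma leib_bump2 i j : (j <= i)%N -> bump i.+1 j = j.
Proof. by move=> ji; rewrite /bump ltnNge ji. Qed.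
Lemma leib_bump3 i j : (j <= i)%N -> bump j i = i.+1.
Proof. by move=> ji; rewrite /bump ji. Qed.
Lemma leib_bump4 i j l : (j <= i)%N -> (bump i l < j)%N = (l < j)%N.
Proof. by move=> ji; rewrite /bump; case: (leqP i l) => h; rewrite ?add1n ?add0n //; lia. Qed.
Lemma leib_bump5 i j q : (j <= i)%N -> (bump j q < i.+1)%N = (q < i)%N.
Proof. by move=> ji; rewrite /bump; case: (leqP j q) => h; rewrite ?add1n ?add0n //; lia. Qed.

Lemma leib_presimpl n (c : 'I_n.+3 -> semidirect M) (j i' : 'I_n.+2) : (j <= i')%N ->
  \sum_(i < n.+2 | (i < lift ord0 i')%N) \sum_(l < n.+1 | (l < j)%N)
     ptensM (leib_merge j l (leib_merge (lift ord0 i') i c)) =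
  \sum_(p < n.+2 | (p < widen_ord (leqnSn n.+2) j)%N) \sum_(q < n.+1 | (q < i')%N)
     ptensM (leib_merge i' q (leib_merge (widen_ord (leqnSn n.+2) j) p c)).
Proof.
move=> ji; set kk := lift ord0 i'; set wj := widen_ord _ j.
have kE : kk = i'.+1 :> nat by [].
have wE : wj = j :> nat by [].
clearbody kk wj.
have e1 x : lift kk (lift j x) = lift wj (lift i' x).
  by apply: val_inj; rewrite /= kE wE leib_bump1.
have e2 : lift kk j = wj by apply: val_inj; rewrite /= kE wE leib_bump2.
have e3 : lift wj i' = kk by apply: val_inj; rewrite /= kE wE leib_bump3.
rewrite exchange_big /=.
rewrite [RHS]big_mkcond (bigD1_ord i') //= wE ltnNge ji /= add0r.
rewrite big_mkcond; apply: eq_bigr => l _.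
rewrite leib_bump4 //; case: ifP => // lj.
have lP : (l < i')%N by apply: leq_trans lj ji.
rewrite (bigD1_ord j) /=; last by rewrite kE ltnS.
rewrite [in RHS](bigD1 l) //= (bigD1 l) /=; last by rewrite kE leib_bump5.
rewrite addrA; congr (_ + _).
  rewrite -[ptensM _ in LHS]scale1r; apply/esym/(@ptensM_multi _ l).
    rewrite scale1r /leib_merge !eqxx (eq_sym j) (eq_sym i').
    rewrite !(negbTE (lift_neq _ _)).
    by rewrite -e1 e2 e3 lie_jac subrK.
  move=> x xl; rewrite /leib_merge !(inj_eq lift_inj) (negbTE xl) e1.
  by rewrite (negbTE (lift_neq _ _)).
apply: eq_big => [q|q /andP[_ ql]]; first by rewrite kE leib_bump5.
congr ptensM; apply/funext => x; rewrite /leib_merge !(inj_eq lift_inj).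
rewrite -e1 e3 (eq_sym j) (eq_sym i') !(negbTE (lift_neq _ _)) e2.
have [->|//] := eqVneq x q.
by rewrite (negbTE ql).
Qed.

Lemma leib_dd n u : leib_d (@leib_d n.+1 u) = 0.
Proof.
move: u; apply: pres_ind => [|a x y hx hy|a].
- by rewrite !(lin0 (@leib_d_lin _)).
- by rewrite !leib_d_lin hx hy scaler0 addr0.
rewrite -/(ptens a); pose c l := lv_in (a l).
have hc (l : 'I_n.+3) : in_slot l (c l) by exact: in_slot_in.
have -> : ptens a = ptensM c.
  by congr ptens; apply: functional_extensionality_dep => l; rewrite lv_inK.
rewrite leib_dE //.
have dsum0 (I : finType) (P : pred I) (F : I -> lod_ob n.+1) :
    leib_d (\sum_(i | P i) F i) = \sum_(i | P i) leib_d (F i).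
  exact: (linear_sum (linMap (@leib_d_lin n))).
rewrite dsum0.
rewrite -[RHS](@simplicial_sum _ _ (fun j kk => \sum_(i < n.+2 | (i < kk)%N)
   \sum_(l < n.+1 | (l < j)%N) ptensM (leib_merge j l (leib_merge kk i c)))); last first.
  by move=> j i; apply: leib_presimpl.
apply: eq_bigr => kk _; rewrite dsum0.
under eq_bigr => i ik do
  rewrite (linZ (@leib_d_lin n)) (leib_dE (leib_merge_slot ik hc)).
rewrite -scaler_sumr exchange_big /=; congr (_ *: _); apply: eq_bigr => j _.
rewrite scaler_sumr; apply: eq_bigr => i _.
by rewrite scaler_sumr.
Qed.

Definition leib_complex : complex k :=
  @Complex k lod_ob (fun n => linMap (@leib_d_lin n)) leib_dd.

Definition HLeib (n : nat) : lmodType k := homology leib_complex n.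
End Loday.

Section Kernel.
Variables (k : comPzRingType) (U V : lmodType k) (f : {linear U -> V}).

Lemma zero_lin a (x y : U) : x = 0 -> y = 0 -> a *: x + y = 0.
Proof. by move=> -> ->; rewrite scaler0 addr0. Qed.
Definition zeroSub : submod U := @Submod k U (eq^~ 0) erefl zero_lin.
Let C := subquotCong (kerSub f) zeroSub.
Definition kerm : lmodType k := subquot (kerSub f) zeroSub.
Definition kval (x : kerm) : U := sval (qrepr (C := C) x).
Definition kmk (u : U) (fu : f u = 0) : kerm := qclass (C := C) (exist _ u fu).

Lemma kmkE u fu : kval (@kmk u fu) = u.
Proof.
have := @qreprE _ C (exist _ u fu); rewrite -/(kmk fu) /kval /=.
by move=> h; apply/eqP; rewrite -subr_eq0; apply/eqP.
Qed.
Lemma kvalP x : f (kval x) = 0.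
Proof. exact: (svalP (qrepr (C := C) x)). Qed.
Lemma kval_inj : injective kval.
Proof.
move=> x y e; rewrite -[x](@qreprK _ C) -[y](@qreprK _ C).
by apply/(@qclassP _ C); rewrite /= -[sval _]/(kval x) e subrr.
Qed.
Lemma kval_lin : linear kval.
Proof.
move=> a x y; rewrite -[x](@qreprK _ C) -[y](@qreprK _ C).
rewrite -(@qclassZ _ C) -(@qclassD _ C).
have E (u : C) : kval (qclass u) = sval u.
  by case: u => u fu; apply: (@kmkE u fu).
by rewrite !E.
Qed.
End Kernel.

Section Resolution.
Variables (k : comPzRingType) (C : linCat k).

Section Ker.
Variables (F F' : leftMod C) (h : lmHom F F').
Let hl x : {linear F x -> F' x} := linMap (lmh_lin h (x := x)).
Definition km_ob (x : C) : lmodType k := kerm (hl x).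
Lemma km_actP x y (f : mor x y) (u : km_ob x) : hl y (lm_act f (kval u)) = 0.
Proof.
have := kvalP u; rewrite /= lmh_nat => ->.
exact: (lin0 (@lm_linr _ _ F' x y f)).
Qed.
Definition km_act x y (f : mor x y) (u : km_ob x) : km_ob y := kmk (km_actP f u).
Lemma km_linl x y u : linear (fun f : mor x y => km_act f u).
Proof. by move=> a f g; apply: kval_inj; rewrite (@kval_lin _ _ _ (hl y)) !kmkE lm_linl. Qed.
Lemma km_linr x y (f : mor x y) : linear (km_act f).
Proof. by move=> a u v; apply: kval_inj;
  rewrite kmkE (@kval_lin _ _ _ (hl x)) lm_linr [RHS](@kval_lin _ _ _ (hl y)) !kmkE. Qed.
Lemma km_id x u : km_act (idm x) u = u.
Proof. by apply: kval_inj; rewrite kmkE lm_id. Qed.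
Lemma km_cmp x y z (g : mor y z) (f : mor x y) u :
  km_act (cmp g f) u = km_act g (km_act f u).
Proof. by apply: kval_inj; rewrite !kmkE lm_cmp. Qed.
Definition kmod : leftMod C := LeftMod km_linl km_linr km_id km_cmp.
Lemma kinc_nat x y (f : mor x y) (u : kmod x) :
  kval (lm_act f u) = lm_act f (kval u).
Proof. by rewrite kmkE. Qed.
Definition kinc : lmHom kmod F :=
  @LmHom _ _ kmod F (fun x (u : kmod x) => kval (u : km_ob x))
    (fun x => @kval_lin _ _ _ (hl x)) kinc_nat.
End Ker.

Section Cover.
Variable F : leftMod C.
Let J := {x : C & F x}.
Definition cov_ob (y : C) : lmodType k := dsum (fun j : J => mor (projT1 j) y).
Definition cinj y (j : J) (f : mor (projT1 j) y) : cov_ob y :=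
  @dinj k J (fun j => mor (projT1 j) y) j f.
Lemma cinj_lin y j : linear (@cinj y j).
Proof. exact: (@dinj_lin k J (fun j : J => mor (projT1 j) y) j). Qed.
Definition cov_act y z (f : mor y z) : cov_ob y -> cov_ob z :=
  dsumLift (fun j g => @cinj z j (cmp f g)).
Lemma cov_linr y z (f : mor y z) : linear (cov_act f).
Proof. by apply: dsumLift_lin => j a u v; rewrite cmp_linr cinj_lin. Qed.
Lemma cov_actE y z (f : mor y z) j g : cov_act f (@cinj y j g) = cinj (cmp f g).
Proof.
by apply: dsumLift_inj => i a u v; rewrite cmp_linr cinj_lin.
Qed.
Lemma cov_eq y (V : lmodType k) (f g : cov_ob y -> V) : linear f -> linear g ->
  (forall j u, f (@cinj y j u) = g (cinj u)) -> f =1 g.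
Proof. by move=> fl gl h; apply: pres_eq => // -[j u]; apply: h. Qed.
Lemma cov_linl y z u : linear (fun f : mor y z => cov_act f u).
Proof.
move=> a f g; move: u; apply: (cov_eq (f := cov_act (a *: f + g))
  (g := fun u => a *: cov_act f u + cov_act g u)).
- exact: cov_linr.
- move=> e p q; rewrite !cov_linr !scalerDr !scalerA (mulrC a) -!scalerA.
  by rewrite addrACA.
by move=> j u; rewrite !cov_actE cmp_linl cinj_lin.
Qed.
Lemma cov_id y u : cov_act (idm y) u = u.
Proof.
move: u; apply: (cov_eq (g := id)) => //; first exact: cov_linr.
by move=> j u; rewrite cov_actE cmp_idl.
Qed.
Lemma cov_cmp x y z (g : mor y z) (f : mor x y) u :
  cov_act (cmp g f) u = cov_act g (cov_act f u).
Proof.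
move: u; apply: (cov_eq (g := fun u => cov_act g (cov_act f u))).
- exact: cov_linr.
- by move=> a u v; rewrite !cov_linr.
by move=> j u; rewrite !cov_actE cmp_assoc.
Qed.
(* The direct sum of the representables C(x, -) over all x and u in F x. *)
Definition cover : leftMod C := LeftMod cov_linl cov_linr cov_id cov_cmp.

Section CovMap.
Variables (F' : leftMod C) (w : forall j : J, F' (projT1 j)).
Definition cmap x : cov_ob x -> F' x := dsumLift (fun j f => lm_act f (w j)).
Lemma cmap_lin x : linear (@cmap x).
Proof. by apply: dsumLift_lin => j a f g; rewrite lm_linl. Qed.
Lemma cmapE x j f : cmap (@cinj x j f) = lm_act f (w j).
Proof. by apply: dsumLift_inj => i a g h; rewrite lm_linl. Qed.
Lemma cmap_nat x y (f : mor x y) u : cmap (cov_act f u) = lm_act f (cmap u).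
Proof.
move: u; apply: (cov_eq (f := fun u => cmap (cov_act f u))
  (g := fun u => lm_act f (cmap u))).
- by move=> a u v; rewrite cov_linr cmap_lin.
- by move=> a u v; rewrite cmap_lin lm_linr.
by move=> j g; rewrite cov_actE !cmapE lm_cmp.
Qed.
Definition covMap : lmHom cover F' :=
  @LmHom _ _ cover F' cmap cmap_lin cmap_nat.
End CovMap.

Definition covAug : lmHom cover F := covMap (fun j => projT2 j).

Lemma covAug_surj : lm_surj covAug.
Proof.
move=> x v; exists (@cinj x (existT _ x v) (idm x)).
by rewrite /= cmapE lm_id.
Qed.

Lemma cover_proj : projective cover.
Proof.
move=> G G' p h ps.
have [w hw] : exists w : forall j : J, G (projT1 j),
    forall j, p _ (w j) = h _ (@cinj (projT1 j) j (idm _)).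
  have ex j := cid (ps _ (h _ (@cinj (projT1 j) j (idm _)))).
  by exists (fun j => projT1 (ex j)) => j; apply: (projT2 (ex j)).
exists (covMap w) => x.
apply: (cov_eq (f := fun u => p x (covMap w x u)) (g := fun u => h x u)).
- by move=> a u v; rewrite !(lmh_lin, cmap_lin).
- exact: (@lmh_lin _ _ cover _ h x).
move=> j f; rewrite /= cmapE lmh_nat hw -lmh_nat /=.
by rewrite cov_actE cmp_idr.
Qed.
End Cover.

Section Res.
Variable F : leftMod C.
Fixpoint syz (n : nat) : leftMod C :=
  if n is n.+1 then kmod (covAug (syz n)) else F.

Definition lmComp (F1 F2 F3 : leftMod C) (g : lmHom F2 F3) (f : lmHom F1 F2) :
  lmHom F1 F3.
Proof.
exists (fun x u => g x (f x u)) => [x a u v|x y e u].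
  by rewrite (lmh_lin f) (lmh_lin g).
by rewrite (lmh_nat f) (lmh_nat g).
Defined.

Definition res_ob n : leftMod C := cover (syz n).
Definition res_d n : lmHom (res_ob n.+1) (res_ob n) :=
  lmComp (kinc (covAug (syz n))) (covAug (syz n.+1)).

Lemma res_exact n x (u : res_ob n x) :
  covAug (syz n) x u = 0 <-> exists v, res_d n x v = u.
Proof.
split=> [e|[v <-]]; last first.
  exact: (@kvalP _ _ _ (linMap (lmh_lin (covAug (syz n)) (x := x)))).
have [v hv] := @covAug_surj (syz n.+1) x (kmk (f := linMap (lmh_lin (covAug (syz n)) (x := x))) e).
exists v; rewrite -[RHS](kmkE (f := linMap (lmh_lin (covAug (syz n)) (x := x))) e).
by rewrite -hv.
Qed.

Lemma res_exactS n x (u : res_ob n.+1 x) :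
  res_d n x u = 0 <-> exists v, res_d n.+1 x v = u.
Proof.
rewrite -res_exact; split=> [e|e].
  apply: (@kval_inj _ _ _ (linMap (lmh_lin (covAug (syz n)) (x := x)))).
  by rewrite (lin0 (@kval_lin _ _ _ _)).
rewrite /res_d [LHS]/= -[cmap _ _]/(covAug (syz n.+1) x u) e.
exact: (lin0 (@kval_lin _ _ _ _)).
Qed.

Definition freeRes : projRes F := @ProjRes k C F res_ob res_d (covAug F)
  (fun n => @cover_proj (syz n)) (@covAug_surj F) (@res_exact 0) res_exactS.
End Res.
End Resolution.

(* Main.v *)
Require Import Defs.
From mathcomp Require Import all_boot all_algebra.
From mathcomp Require Import boolp zify.
Set Implicit Arguments. Unset Strict Implicit. Unset Printing Implicit Defensive.
Import GRing.Theory.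
Local Open Scope ring_scope.

(* The elements d_{i,j} of Gamma([n+1], [n]) that bracket x_i with x_j add up, with the
   Leibniz signs, to a morphism [leib_mor n], so every left module F carries a complex
   F([n]), natural in F, which for F = L(A, M) is the Leibniz complex.  Its H_0 is
   t (x) F.  For a projective resolution P of L(A, M) the double complex P_q([n]) thus
   gives the theorem, provided F([n]) is acyclic in positive degrees for F projective,
   hence provided it is so for F = Gamma([r], -).

   A shuffling surjection puts x_1 in the block of x_0 or in the next one, and the
   complex Gamma([r], -) is the cone of the map from the summands of the second kind to
   those of the first given by f_0 (x) f_1 (x) f_2 ... |-> [f_0, f_1] (x) f_2 ...  This
   map is invertible: a Lie monomial containing x_0 and x_1 is, in a unique way, a sum of
   brackets [p, q] with x_0 in p and x_1 in q.  The inverse [Phi] is the evaluation of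
   the free Lie algebra L in an extension of L by L (+) L (+) L (x) L in which
   [p, q] = p (x) q, with x_0 and x_1 sent to the two copies of L. *)

(** * Double complexes *)

(** Choice with default 0, so that lifts can be picked by recursion in all bidegrees, including
    those where none exists. *)
Definition pick_or0 (k : comPzRingType) (V : lmodType k) (P : V -> Prop) : V :=
  if pselect (exists x, P x) is left h then projT1 (cid h) else 0.

Lemma pick_or0P (k : comPzRingType) (V : lmodType k) (P : V -> Prop) :
  (exists x, P x) -> P (pick_or0 P).
Proof. by move=> h; rewrite /pick_or0; case: pselect => // h'; case: cid. Qed.

Section Zigzag.
Variables (k : comPzRingType) (A B : complex k) (X : nat -> nat -> lmodType k).
Variables (del : forall q m, {linear X q.+1 m -> X q m})
  (d : forall q m, {linear X q m.+1 -> X q m})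
  (eps : forall m, {linear X 0 m -> A m}) (eta : forall q, {linear X q 0 -> B q}).

(* Only the x q m with q + m = n matter; indexing by both q and m avoids casts. *)
Definition zigzag n (a : A n) (b : B n) : Prop :=
  exists x : forall q m, X q m,
    [/\ eps n (x 0 n) = a, eta n (x n 0) = b &
        forall q m, (q + m).+1 = n -> d q m (x q m.+1) = del q m (x q.+1 m)].

Lemma zigzag_lin n c a a' b b' :
  @zigzag n a b -> @zigzag n a' b' -> @zigzag n (c *: a + a') (c *: b + b').
Proof.
move=> [x [<- <- hx]] [y [<- <- hy]].
exists (fun q m => c *: x q m + y q m); split; try exact: linearP.
by move=> q m e; rewrite !linearP hx // hy.
Qed.

Hypotheses (dC : forall q m u, del q m (d q.+1 m u) = d q m (del q m.+1 u))
  (dd : forall q m u, d q m (d q m.+1 u) = 0)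
  (eps_surj : forall m a, exists u, eps m u = a)
  (eps_ker : forall m u, eps m u = 0 -> exists v, del 0 m v = u)
  (del_ker : forall q m u, del q m u = 0 -> exists v, del q.+1 m v = u)
  (eps_d : forall m u, eps m (d 0 m u) = cx_d A m (eps m.+1 u))
  (eta_del : forall q u, eta q (del q 0 u) = cx_d B q (eta q.+1 u))
  (eta_d : forall q u, eta q (d q 0 u) = 0).

(** Lift [a] along [eps], then lift repeatedly along [del]: each [d q m (x q m.+1)] is liftable, at
    first because [a] is a cycle and afterwards by [dC] and [dd]. *)
Lemma zigzag_total n (a : A n) :
  cycles A n a -> exists2 b, cycles B n b & zigzag a b.
Proof.
move=> ca.
(* The family [x] runs over all bidegrees, so [a] is first extended by 0 outside degree [n]. *)
have [a' a'n] : exists a' : forall m, A m, a' n = a.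
  exists (fun m => if eqVneq n m is EqNotNeq e then eq_rect n (fun m => A m) a m e else 0).
  by case: eqVneq => [e|]; rewrite ?eqxx // eq_axiomK.
pose x := fix x q : forall m, X q m :=
  match q with
  | 0 => fun m => pick_or0 (fun u => eps m u = a' m)
  | q.+1 => fun m => pick_or0 (fun u => del q m u = d q m (x q m.+1))
  end.
have x0 m : eps m (x 0 m) = a' m.
  exact: (@pick_or0P _ _ (fun u => eps m u = a' m)) (eps_surj _).
have hx q m : (q + m).+1 = n -> d q m (x q m.+1) = del q m (x q.+1 m).
  elim: q m => [|q IH] m e; apply/esym;
    apply: (@pick_or0P _ _ (fun u => del _ m u = d _ m (x _ m.+1))).
    apply: eps_ker; rewrite eps_d x0.
    by move: a' a'n ca {x x0} => a' <-; rewrite -e.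
  by apply: del_ker; rewrite dC -IH ?dd // addnS -e addSn.
exists (eta n (x n 0)); last by exists x; split=> //; rewrite x0.
(* In degree 0 every element is a cycle; above, the boundary of [eta n (x n 0)] is [eta] of a [del],
   hence of a [d], and [eta] kills the latter. *)
case: n {a ca a' a'n} x {x0} hx => [|n] // x hx.
by rewrite /= -eta_del -hx ?addn0 // eta_d.
Qed.

(** Going down the zigzag, every [x q m] is a [d]-image plus a [del]-image: the [z] of one step
    serves as the [y] of the next. At the end [eta] kills the first part and turns the second into a
    boundary. *)
Lemma zigzag_boundary n (a : A n) (b : B n) :
  zigzag a b -> (exists a', cx_d A n a' = a) -> exists b', cx_d B n b' = b.
Proof.
move=> [x [x0 xn hx]] [a' ha'].
have H q m : (q + m)%N = n -> exists y z, x q m = d q m y + del q m z.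
  elim: q m => [|q IH] m e.
    move: e a' ha'; rewrite add0n -x0 => <- a' ha'.
    have [y hy] := eps_surj a'.
    have [|z hz] := eps_ker (u := x 0 m - d 0 m y).
      by rewrite linearB eps_d hy ha' subrr.
    by exists y, z; rewrite hz addrC subrK.
  have [|y [z hz]] := IH m.+1; first by rewrite addnS -e addSn.
  have [|w hw] := del_ker (u := x q.+1 m - d q.+1 m z).
    rewrite linearB -hx ?addSn -?e ?addSn // hz linearD dd add0r dC.
    by rewrite subrr.
  by exists z, w; rewrite hw addrC subrK.
have [|y [z hz]] := H n 0; first by rewrite addn0.
by exists (eta n.+1 z); rewrite -eta_del -xn hz linearD eta_d add0r.
Qed.
End Zigzag.

(** Two elements related to the same one differ by an element related to 0, so by a boundary. Hence
    the maps [f] and [g] given by chosen partners do not depend on the choices and are mutually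
    inverse. *)
Lemma homology_iso (k : comPzRingType) (A B : complex k) n (R : A n -> B n -> Prop) :
  (forall c a a' b b', R a b -> R a' b' -> R (c *: a + a') (c *: b + b')) ->
  (forall a, cycles A n a -> exists2 b, cycles B n b & R a b) ->
  (forall b, cycles B n b -> exists2 a, cycles A n a & R a b) ->
  (forall a b, R a b -> (exists a', cx_d A n a' = a) <-> (exists b', cx_d B n b' = b)) ->
  isoMod (homology A n) (homology B n).
Proof.
move=> Rlin RA RB Rim.
pose CA := subquotCong (cycles A n) (imSub (cx_d A n)).
pose CB := subquotCong (cycles B n) (imSub (cx_d B n)).
have RA' (u : CA) : exists v : CB, R (sval u) (sval v).
  by have [b cb r] := RA _ (svalP u); exists (exist _ b cb).
have RB' (v : CB) : exists u : CA, R (sval u) (sval v).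
  by have [a ca r] := RB _ (svalP v); exists (exist _ a ca).
have Rsub a a' b b' : R a b -> R a' b' -> R (a - a') (b - b').
  by move=> r r'; rewrite addrC [b - _]addrC -!scaleN1r; apply: Rlin.
pose f (x : homology A n) : homology B n := qclass (projT1 (cid (RA' (qrepr (C := CA) x)))).
pose g (y : homology B n) : homology A n := qclass (projT1 (cid (RB' (qrepr (C := CB) y)))).
have fE (u : CA) (v : CB) : R (sval u) (sval v) -> f (qclass u) = qclass v.
  move=> r; apply/(@qclassP _ CB); case: cid => /= w rw.
  apply/(Rim _ _ (Rsub _ _ _ _ rw r)).
  exact: (@qreprE _ CA u).
have gE (u : CA) (v : CB) : R (sval u) (sval v) -> g (qclass v) = qclass u.
  move=> r; apply/(@qclassP _ CA); case: cid => /= w rw.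
  apply/(Rim _ _ (Rsub _ _ _ _ rw r)).
  exact: (@qreprE _ CB v).
have fl : linear f.
  move=> c x y; rewrite -[x](@qreprK _ CA) -[y](@qreprK _ CA).
  have [v rv] := RA' (qrepr x); have [w rw] := RA' (qrepr y).
  rewrite (fE _ _ rv) (fE _ _ rw) -!qclassZ -!qclassD.
  exact/fE/Rlin.
exists (linMap fl); exists g => [x|y].
  rewrite -[x](@qreprK _ CA) /=; have [v rv] := RA' (qrepr x).
  by rewrite (fE _ _ rv) (gE _ _ rv).
rewrite -[y](@qreprK _ CB) /=; have [v rv] := RB' (qrepr y).
by rewrite (gE _ _ rv) (fE _ _ rv).
Qed.

Section Balance.
Variables (k : comPzRingType) (A B : complex k) (X : nat -> nat -> lmodType k).
Variables (del : forall q m, {linear X q.+1 m -> X q m})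
  (d : forall q m, {linear X q m.+1 -> X q m})
  (eps : forall m, {linear X 0 m -> A m}) (eta : forall q, {linear X q 0 -> B q}).
Hypotheses (dC : forall q m u, del q m (d q.+1 m u) = d q m (del q m.+1 u))
  (eps_d : forall m u, eps m (d 0 m u) = cx_d A m (eps m.+1 u))
  (eta_del : forall q u, eta q (del q 0 u) = cx_d B q (eta q.+1 u))
  (eps_surj : forall m a, exists u, eps m u = a)
  (eps_exact : forall m u, eps m u = 0 <-> exists v, del 0 m v = u)
  (del_exact : forall q m u, del q m u = 0 <-> exists v, del q.+1 m v = u)
  (eta_surj : forall q b, exists u, eta q u = b)
  (eta_exact : forall q u, eta q u = 0 <-> exists v, d q 0 v = u)
  (d_exact : forall q m u, d q m u = 0 <-> exists v, d q m.+1 v = u).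

(** A zigzag read backwards is a zigzag of the transposed double complex, so the lemmas above apply
    in both directions. *)
Lemma double_complex_iso n : isoMod (homology A n) (homology B n).
Proof.
pose R n (a : A n) b := zigzag del d eps eta a b.
pose R' n (b : B n) a :=
  @zigzag k B A (fun q m => X m q) (fun q m => d m q) (fun q m => del m q) eta eps n b a.
have RR' a b : R n a b <-> R' n b a.
  split=> -[x [x0 xn hx]]; exists (fun q m => x m q); split=> // q m e.
    by rewrite hx // addnC.
  by rewrite hx // addnC.
have dd q m u : d q m (d q m.+1 u) = 0 by apply/d_exact; exists u.
have deldel q m u : del q m (del q.+1 m u) = 0 by apply/del_exact; exists u.
have eps_del m u : eps m (del 0 m u) = 0 by apply/eps_exact; exists u.
have eta_d q u : eta q (d q 0 u) = 0 by apply/eta_exact; exists u.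
have eps_ker m u : eps m u = 0 -> exists v, del 0 m v = u by move/eps_exact.
have del_ker q m u : del q m u = 0 -> exists v, del q.+1 m v = u by move/del_exact.
have eta_ker m u : eta m u = 0 -> exists v, d m 0 v = u by move/eta_exact.
have d_ker q m u : d q m u = 0 -> exists v, d q m.+1 v = u by move/d_exact.
apply: (@homology_iso _ _ _ _ (R n)).
- by move=> *; apply: zigzag_lin.
- exact: (zigzag_total dC dd eps_surj eps_ker del_ker eps_d eta_del eta_d).
- move=> b /(@zigzag_total k B A (fun q m => X m q) (fun q m => d m q) (fun q m => del m q)
    eta eps (fun m q u => esym (dC u)) (fun m q => deldel q m)
    eta_surj eta_ker (fun m q => d_ker q m) eta_del eps_d eps_del)[a ca /RR' r].
  by exists a.
move=> a b r; split; first 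
  exact: (zigzag_boundary dC dd eps_surj eps_ker del_ker eps_d eta_del eta_d r).
have /RR' r' := r.
exact: (@zigzag_boundary k B A (fun q m => X m q) (fun q m => d m q) (fun q m => del m q)
    eta eps (fun m q u => esym (dC u)) (fun m q => deldel q m)
    eta_surj eta_ker (fun m q => d_ker q m) eta_del eps_d eps_del n b a r').
Qed.
End Balance.

(** * Tensor products with t *)

Section TensorT.
Variables (k : comPzRingType) (F : leftMod (Gamma k)).

(** [t] is a quotient of the representable at [0], so the class of the identity generates it. *)
Definition tunit : tmod k 0%N := ckp (t_rel k 0) (gid k 0).
Definition to_tensC (u : F 0%N) : tensC (tmod k) F := ptensC tunit u.

Lemma to_tensC_lin : linear to_tensC.
Proof. by move=> a u v; apply: ptensC_linr. Qed.

Lemma tunit_act n (g : gam k n 0) : rm_act (r := tmod k) (x := n) g tunit = ckp (t_rel k n) g.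
Proof. by rewrite /tunit /= t_actE gcmp_idl. Qed.

Lemma to_tensC_surj x : exists u, to_tensC u = x.
Proof.
move: x; apply: pres_ind => [|a x y [u <-] [v <-]|[n [g u]]].
- by exists 0; apply: lin0 to_tensC_lin.
- by exists (a *: u + v); apply: to_tensC_lin.
exists (lm_act (ckrepr g : @mor k (Gamma k) n 0%N) u).
rewrite /to_tensC -ptensC_bal tunit_act ckreprK.
by [].
Qed.

Definition d01_act : {linear F 1%N -> F 0%N} :=
  linMap (lm_linr (l := F) (d01 k : @mor k (Gamma k) 1%N 0%N)).

(** Left inverse of [to_tensC] modulo the image of [d01]: an element of [t] acts through a chosen
    lift to a morphism into [0]. *)
Definition from_tensC : tensC (tmod k) F -> coker d01_act :=
  presLift (fun p : tensCgen (tmod k) F =>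
    ckp d01_act (lm_act (ckrepr (projT2 p).1 : @mor k (Gamma k) (projT1 p) 0%N) (projT2 p).2)).

(** Independence of the chosen lift: two lifts differ by some [gcmp (d01 k) v], which acts with
    values in the image of [d01_act]. *)
Lemma coker_t_act n (g : gam k n 0) (u : F n) :
  ckp d01_act (lm_act (ckrepr (ckp (t_rel k n) g) : @mor k (Gamma k) n 0%N) u) =
  ckp d01_act (lm_act (g : @mor k (Gamma k) n 0%N) u).
Proof.
have /ckpP[v hv] := ckreprK (ckp (t_rel k n) g).
apply/ckpP; exists (lm_act (v : @mor k (Gamma k) n 1%N) u).
have fl := @lm_linl _ _ F n 0%N u.
rewrite [LHS]/= -lm_cmp.
rewrite [LHS](congr1 (fun w : @mor k (Gamma k) n 0%N => lm_act w u) hv).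
by rewrite addrC -scaleN1r [LHS]fl scaleN1r addrC.
Qed.

Lemma from_tensC_resp : respects (@tensCRel _ _ (tmod k) F)
  (fun p : tensCgen (tmod k) F =>
    ckp d01_act (lm_act (ckrepr (projT2 p).1 : @mor k (Gamma k) (projT1 p) 0%N) (projT2 p).2)).
Proof.
move=> _ _ [n a g g' u|n a g u u'|n m f g u] /=.
- rewrite -[g]ckreprK -[g']ckreprK -ckp_lin !coker_t_act -ckp_lin.
  by congr ckp; apply: lm_linl.
- by rewrite -ckp_lin; congr ckp; apply: lm_linr.
rewrite -[g]ckreprK t_actE !coker_t_act.
by congr ckp; apply: (@lm_cmp _ _ F).
Qed.

Lemma to_tensC_ker u : to_tensC u = 0 <-> exists v, d01_act v = u.
Proof.
have fl := presLift_lin from_tensC_resp.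
split=> [e|[v <-]].
  have : from_tensC (to_tensC u) = ckp d01_act 0.
    by rewrite e (lin0 (@ckp_lin _ _ _ _)); apply: lin0 fl.
  rewrite [LHS](presLift_gen from_tensC_resp) /= coker_t_act.
  by move/ckpP; rewrite subr0 -[gid k 0]/(idm (0%N : Gamma k)) lm_id.
rewrite /to_tensC /= -ptensC_bal tunit_act.
have -> : ckp (t_rel k 1) (d01 k) = 0.
  rewrite -(lin0 (@ckp_lin _ _ _ _)); apply/ckpP; exists (gid k 1).
  by rewrite subr0 /= gcmp_idr.
by have /lin0 : linear (fun g => ptensC (G := tmod k) (x := 1%N : Gamma k) g v)
  by move=> a g g'; apply: ptensC_linl.
Qed.
End TensorT.

Lemma to_tensC_nat (k : comPzRingType) (F F' : leftMod (Gamma k)) (h : lmHom F F') u :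
  tensC_map (G := tmod k) h (to_tensC u) = to_tensC (h 0%N u).
Proof. exact: tensC_mapE. Qed.

(** * The Leibniz differential on tensor powers *)

Section Cons.
Variable X : Type.

Definition fcons m (x : X) (f : 'I_m -> X) (i : 'I_m.+1) : X :=
  if unlift ord0 i is Some j then f j else x.

Lemma fcons0 m x (f : 'I_m -> X) : fcons x f ord0 = x.
Proof. by rewrite /fcons unlift_none. Qed.
Lemma fconsS m x (f : 'I_m -> X) j : fcons x f (lift ord0 j) = f j.
Proof. by rewrite /fcons liftK. Qed.

Lemma fcons_eq m x (f : 'I_m -> X) g :
  g ord0 = x -> (forall j, g (lift ord0 j) = f j) -> g = fcons x f.
Proof.
move=> h0 hS; apply/funext => i; case: (unliftP ord0 i) => [j ->|->].
  by rewrite fconsS.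
by rewrite fcons0.
Qed.

Lemma fcons_eta m (a : 'I_m.+1 -> X) : a = fcons (a ord0) (fun j => a (lift ord0 j)).
Proof. exact: fcons_eq. Qed.

Lemma lift_lift0 m (j : 'I_m.+1) (l : 'I_m) :
  lift (lift ord0 j) (lift ord0 l) = lift ord0 (lift j l).
Proof. by apply: val_inj; rewrite /= /bump /= !add1n ltnS addnS. Qed.
Lemma lift_lift00 m (j : 'I_m.+1) : lift (lift ord0 j) (ord0 : 'I_m.+1) = ord0.
Proof. by apply: val_inj. Qed.

Variable br : X -> X -> X.

(* The entries of a with a j omitted and a (lift j i) replaced by its bracket with
   a j; for i < j the index of the latter entry is i before and after. *)
Definition merge_at m (j : 'I_m.+1) (i : 'I_m) (a : 'I_m.+1 -> X) (l : 'I_m) : X :=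
  if l == i then br (a (lift j l)) (a j) else a (lift j l).

Lemma merge_at_cons0 m (j : 'I_m.+1) p (b : 'I_m.+1 -> X) :
  merge_at (lift ord0 j) ord0 (fcons p b) = fcons (br p (b j)) (fun l => b (lift j l)).
Proof.
apply: fcons_eq => [|l]; rewrite /merge_at ?eqxx ?lift_lift00 ?fcons0 ?fconsS //.
by rewrite (negbTE (_ : lift ord0 l != ord0)) ?lift_lift0 ?fconsS // eq_sym neq_lift.
Qed.

Lemma merge_at_consS m (j : 'I_m.+1) i p (b : 'I_m.+1 -> X) :
  merge_at (lift ord0 j) (lift ord0 i) (fcons p b) = fcons p (merge_at j i b).
Proof.
apply: fcons_eq => [|l]; rewrite /merge_at ?(negbTE (neq_lift _ _)) ?lift_lift00 ?fcons0 //.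
by rewrite (inj_eq lift_inj) lift_lift0 !fconsS.
Qed.

Variables (k : comPzRingType) (V : lmodType k).

(** The Leibniz differential with an arbitrary [G] in place of the tensor symbol, so that it serves
    both for tensors of Lie elements ([dT]) and for tuples of trees ([leib_mor]). *)
Definition bsum m (G : ('I_m -> X) -> V) (a : 'I_m.+1 -> X) : V :=
  \sum_(j < m.+1) (-1) ^+ j *: \sum_(i < m | (i < j)%N) G (merge_at j i a).
(** The alternating sum in which each [b j] is taken out of the tuple and handed to [F], as when it
    acts on factors standing before the tuple. *)
Definition asum m (F : X -> ('I_m -> X) -> V) (b : 'I_m.+1 -> X) : V :=
  \sum_(j < m.+1) (-1) ^+ j *: F (b j) (fun l => b (lift j l)).

(** The terms with i = 0 bracket into [p] and form the [asum]; the others leave [p] alone.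
    Prepending [p] raises j by one, whence the signs, and j = 0 contributes nothing. *)
Lemma bsum_cons m (G : ('I_m.+1 -> X) -> V) p (b : 'I_m.+1 -> X) :
  bsum G (fcons p b) =
  - asum (fun l c => G (fcons (br p l) c)) b - bsum (fun c => G (fcons p c)) b.
Proof.
rewrite /bsum big_ord_recl big_pred0_eq scaler0 add0r -opprD -big_split /= -sumrN.
apply: eq_bigr => j _; rewrite big_mkcond big_ord_recl /= -scalerDr -scaleNr.
rewrite exprS mulN1r merge_at_cons0; congr (_ *: (_ + _)).
by rewrite [RHS]big_mkcond; apply: eq_bigr => i _; rewrite ltnS merge_at_consS.
Qed.

Lemma asum_cons m (F : X -> ('I_m.+1 -> X) -> V) q (b : 'I_m.+1 -> X) :
  asum F (fcons q b) = F q b - asum (fun l c => F l (fcons q c)) b.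
Proof.
rewrite /asum big_ord_recl expr0 scale1r fcons0 -sumrN.
have -> : (fun l => fcons q b (lift ord0 l)) = b by apply/funext => l; rewrite fconsS.
congr (_ + _); apply: eq_bigr => j _; rewrite fconsS -scaleNr exprS mulN1r.
congr (_ *: F _ _); apply: fcons_eq => [|l]; first by rewrite lift_lift00 fcons0.
by rewrite lift_lift0 fconsS.
Qed.
End Cons.

Lemma eq_asum (X : Type) (k : comPzRingType) (V : lmodType k) m
    (F F' : X -> ('I_m -> X) -> V) (b : 'I_m.+1 -> X) :
  (forall j, F (b j) (fun l => b (lift j l)) = F' (b j) (fun l => b (lift j l))) ->
  asum F b = asum F' b.
Proof. by move=> h; apply: eq_bigr => j _; rewrite h. Qed.

Lemma asum_lin (X : Type) (k : comPzRingType) (V : lmodType k) m e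
    (F G H : X -> ('I_m -> X) -> V) (b : 'I_m.+1 -> X) :
  (forall l c, F l c = e *: G l c + H l c) -> asum F b = e *: asum G b + asum H b.
Proof.
move=> h; apply: sum_lin => j _.
by rewrite h scalerDr !scalerA (mulrC e).
Qed.

Lemma bsum_lin (X : Type) (br : X -> X -> X) (k : comPzRingType) (V : lmodType k) m e
    (F G H : ('I_m -> X) -> V) (b : 'I_m.+1 -> X) :
  (forall c, F c = e *: G c + H c) -> bsum br F b = e *: bsum br G b + bsum br H b.
Proof.
move=> h; apply: sum_lin => j _.
rewrite scalerA mulrC -scalerA -scalerDr; congr (_ *: _); exact: sum_lin.
Qed.

Lemma linB (k : comPzRingType) (U V : lmodType k) (f : U -> V) : linear f ->
  {morph f : x y / x - y}.
Proof. by move=> fl x y; rewrite -scaleN1r (linD fl) (linZ fl) scaleN1r. Qed.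

Lemma linN (k : comPzRingType) (U V : lmodType k) (f : U -> V) : linear f ->
  {morph f : x / - x}.
Proof. by move=> fl x; rewrite -scaleN1r (linZ fl) scaleN1r. Qed.

Section Power.
Variables (k : comPzRingType) (V : lmodType k).

Definition tpow m : lmodType k := tens (fun _ : 'I_m => V).
Definition tp m (u : 'I_m -> V) : tpow m := @ptens k _ (fun _ : 'I_m => V) u.

Lemma lin_at_consS m (i : 'I_m) e p (u v w : 'I_m -> V) :
  @lin_at k _ (fun=> V) i e u v w ->
  @lin_at k _ (fun=> V) (lift ord0 i) e (fcons p u) (fcons p v) (fcons p w).
Proof.
move=> [hi hj]; split; first by rewrite !fconsS.
move=> l; case: (unliftP ord0 l) => [j ->|-> _]; last by rewrite !fcons0.
by rewrite (inj_eq lift_inj) !fconsS; apply: hj.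
Qed.

Lemma lin_at_cons0 m e p q r (u : 'I_m -> V) : p = e *: q + r ->
  @lin_at k _ (fun=> V) ord0 e (fcons p u) (fcons q u) (fcons r u).
Proof.
move=> h; split; first by rewrite !fcons0.
by move=> l; case: (unliftP ord0 l) => [j ->|->]; rewrite ?eqxx // !fconsS.
Qed.

Lemma tp_cons0 m e p q (u : 'I_m -> V) :
  tp (fcons (e *: p + q) u) = e *: tp (fcons p u) + tp (fcons q u).
Proof. exact/ptens_multi/lin_at_cons0. Qed.

Lemma tp_cons1 m e p q r (u : 'I_m -> V) :
  tp (fcons r (fcons (e *: p + q) u)) = e *: tp (fcons r (fcons p u)) + tp (fcons r (fcons q u)).
Proof. exact/ptens_multi/lin_at_consS/lin_at_cons0. Qed.

Definition tpair (p q : V) : tpow 2 := tp (fcons p (fcons q (fun=> 0))).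

Lemma tpairl q : linear (tpair^~ q).
Proof. by move=> e p p'; apply: tp_cons0. Qed.
Lemma tpairr p : linear (tpair p).
Proof. by move=> e q q'; apply: tp_cons1. Qed.

Lemma tp2E (u : 'I_2 -> V) : tp u = tpair (u ord0) (u (lift ord0 ord0)).
Proof.
rewrite [u in LHS]fcons_eta; congr (tp (fcons _ _)).
by apply: fcons_eq => // -[].
Qed.

Lemma bilinear_multi (W : lmodType k) (f : V -> V -> W) :
  (forall q, linear (f^~ q)) -> (forall p, linear (f p)) ->
  multilinear (V := fun _ : 'I_2 => V) (fun u => f (u ord0) (u (lift ord0 ord0))).
Proof.
move=> fl fr i e u v w [+ hj]; case: (unliftP ord0 i) hj => [j ->|->] hj hi.
  have [<- <-] := hj ord0 isT; rewrite (ord1 j) in hi.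
  by rewrite hi fr.
have [<- <-] := hj (lift ord0 ord0) isT.
by rewrite hi fl.
Qed.

Definition lift2 (W : lmodType k) (f : V -> V -> W) : tpow 2 -> W :=
  tensLift (V := fun _ : 'I_2 => V) (fun u => f (u ord0) (u (lift ord0 ord0))).

Section Lift2.
Variables (W : lmodType k) (f : V -> V -> W).
Hypotheses (fl : forall q, linear (f^~ q)) (fr : forall p, linear (f p)).
Lemma lift2_lin : linear (lift2 f).
Proof. exact/tensLift_lin/bilinear_multi. Qed.
Lemma lift2E p q : lift2 f (tpair p q) = f p q.
Proof. by rewrite [LHS]tensLift_p; [rewrite fcons0 fconsS fcons0|apply: bilinear_multi]. Qed.
End Lift2.

Lemma tpow2_ind (P : tpow 2 -> Prop) :
  P 0 -> (forall a x y, P x -> P y -> P (a *: x + y)) ->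
  (forall p q, P (tpair p q)) -> forall x, P x.
Proof. by move=> P0 PL Pp; apply: tens_ind => // u; rewrite -/(tp u) tp2E. Qed.

Lemma tpow2_eq (W : lmodType k) (f g : tpow 2 -> W) :
  linear f -> linear g -> (forall p q, f (tpair p q) = g (tpair p q)) -> f =1 g.
Proof.
move=> fl gl h; apply: tpow2_ind => //; first by rewrite (lin0 fl) (lin0 gl).
by move=> a x y hx hy; rewrite fl gl hx hy.
Qed.

(** Allows a tensor that is not pure, such as a value of [Phi], in the first two factors. *)
Definition tcons2 m (w : tpow 2) (c : 'I_m -> V) : tpow m.+2 :=
  lift2 (fun p q => tp (fcons p (fcons q c))) w.

Lemma tcons2_lin m (c : 'I_m -> V) : linear (fun w => tcons2 w c).
Proof. by apply: lift2_lin => p e q q'; [apply: tp_cons0|apply: tp_cons1]. Qed.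
Lemma tcons2E m p q (c : 'I_m -> V) : tcons2 (tpair p q) c = tp (fcons p (fcons q c)).
Proof.
by apply: (lift2E (f := fun p q => tp (fcons p (fcons q c)))) => r e s s';
  [apply: tp_cons0|apply: tp_cons1].
Qed.

Lemma tcons2_multi m w : multilinear (V := fun _ : 'I_m => V) (tcons2 w).
Proof.
move=> i e u v z h; move: w; apply: tpow2_eq; first exact: tcons2_lin.
  move=> a x y; rewrite !tcons2_lin !scalerDr !scalerA (mulrC e) -!scalerA.
  by rewrite addrACA.
move=> p q; rewrite !tcons2E.
exact: (ptens_multi (lin_at_consS p (lin_at_consS q h))).
Qed.
End Power.

Section LeibT.
Variables (k : comPzRingType) (L : lieAlg k).
Local Notation T := (tpow L).

Lemma merge_at_multi m (j : 'I_m.+1) (i : 'I_m) :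
  multilinear (V := fun _ : 'I_m.+1 => lie_car L)
    (fun a => tp (merge_at (@lie_br _ L) j i a) : T m).
Proof.
move=> s e u v w [hs hl]; case: (unliftP j s) hs hl => [r ->|->] hs hl.
  have [uj uj'] := hl j (neq_lift _ _).
  apply: (@ptens_multi _ _ _ r); split=> [|l li].
    by rewrite /merge_at hs -uj -uj'; case: ifP => // _; apply: lie_brl.
  by rewrite /merge_at; have [<- <-] := hl (lift j l) ltac:(by rewrite (inj_eq lift_inj)); rewrite -uj -uj'.
apply: (@ptens_multi _ _ _ i); split=> [|l li].
  rewrite /merge_at eqxx; have [<- <-] := hl (lift j i) ltac:(by rewrite eq_sym neq_lift).
  by rewrite hs lie_brr.
by rewrite /merge_at (negbTE li); apply: hl; rewrite eq_sym neq_lift.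
Qed.

Definition dT m : T m.+1 -> T m :=
  tensLift (V := fun _ : 'I_m.+1 => lie_car L) (bsum (@lie_br _ L) (@tp _ L m)).

Lemma dT_multi m :
  multilinear (V := fun _ : 'I_m.+1 => lie_car L) (bsum (@lie_br _ L) (@tp _ L m)).
Proof.
move=> s e u v w h; apply: sum_lin => j _.
rewrite scalerA mulrC -scalerA -scalerDr; congr (_ *: _); apply: sum_lin => i _.
exact: merge_at_multi h.
Qed.
Lemma dT_lin m : linear (@dT m).
Proof. exact/tensLift_lin/dT_multi. Qed.
Lemma dTE m a : @dT m (tp a) = bsum (@lie_br _ L) (@tp _ L m) a.
Proof. exact/tensLift_p/dT_multi. Qed.

Definition brW (w : T 2) : L := lift2 (@lie_br _ L) w.
Lemma brW_lin : linear brW.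
Proof. exact: lift2_lin (@lie_brl _ L) (@lie_brr _ L). Qed.
Lemma brWE p q : brW (tpair p q) = lie_br p q.
Proof. exact: lift2E (@lie_brl _ L) (@lie_brr _ L) _ _. Qed.

(** The tensor square of the right adjoint action. *)
Definition actW (l : L) (w : T 2) : T 2 :=
  lift2 (fun p q => tpair (lie_br p l) q + tpair p (lie_br q l)) w.

Fact actW_biadd l :
  (forall q : L, linear (fun p : L => tpair (lie_br p l) q + tpair p (lie_br q l))) /\
  (forall p : L, linear (fun q : L => tpair (lie_br p l) q + tpair p (lie_br q l))).
Proof.
split=> r e x y.
  by rewrite lie_brl !tpairl scalerDr addrACA.
by rewrite lie_brl !tpairr scalerDr addrACA.
Qed.
Lemma actW_linr l : linear (actW l).
Proof. by have [h1 h2] := actW_biadd l; apply: lift2_lin. Qed.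
Lemma actWE l p q : actW l (tpair p q) = tpair (lie_br p l) q + tpair p (lie_br q l).
Proof. by have [h1 h2] := actW_biadd l; rewrite [LHS](lift2E h1 h2). Qed.
Lemma actW_linl w : linear (actW^~ w).
Proof.
move=> e l l'; move: w; apply: tpow2_eq; first exact: actW_linr.
  move=> a x y; rewrite !actW_linr !scalerDr !scalerA (mulrC e) -!scalerA.
  by rewrite addrACA.
move=> p q; rewrite !actWE !lie_brr tpairl tpairr scalerDr.
by rewrite addrACA.
Qed.

Lemma actW_jac w l l' : actW (lie_br l l') w = actW l' (actW l w) - actW l (actW l' w).
Proof.
move: w; apply: tpow2_eq; first exact: actW_linr.
  move=> a x y; rewrite !actW_linr opprD addrACA scalerBr.
  by [].
move=> p q; rewrite !actWE !(linD (actW_linr _)) !actWE !lie_jac.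
rewrite (linB (tpairl _)) (linB (tpairr _)).
set a := tpair _ q; set b := tpair _ q; set c := tpair p _; set d := tpair p _.
set x := tpair _ _; set y := tpair _ _.
rewrite (addrC y c) [in RHS](addrACA a) (addrC x d) (addrACA b) (addrC y x) [in RHS]opprD.
by rewrite [RHS]addrACA subrr addr0 opprD addrACA.
Qed.

(* dT on (w, c_0, c_1, ...), where w stands for the first two factors. *)
Lemma dT_tcons2 m w (b : 'I_m.+1 -> L) :
  dT (tcons2 w b) = - tp (fcons (brW w) b) + asum (fun l c => tcons2 (actW l w) c) b
    + bsum (@lie_br _ L) (fun c => tcons2 w c) b.
Proof.
move: w; apply: tpow2_eq.
- by move=> e x y; rewrite tcons2_lin dT_lin.
- move=> e x y; rewrite brW_lin tp_cons0.
  rewrite (asum_lin (F := fun l c => tcons2 (actW l (e *: x + y)) c)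
    (G := fun l c => tcons2 (actW l x) c) (H := fun l c => tcons2 (actW l y) c) (e := e)); last first.
    by move=> l c; rewrite actW_linr tcons2_lin.
  rewrite (bsum_lin (@lie_br _ L) (F := fun c => tcons2 (e *: x + y) c)
    (G := fun c => tcons2 x c) (H := fun c => tcons2 y c) (e := e)); last first.
    by move=> c; rewrite tcons2_lin.
  by rewrite !scalerDr opprD scalerN [RHS]addrACA [in RHS](addrACA (- _)).
move=> p q; rewrite tcons2E dTE brWE !bsum_cons asum_cons !opprD !opprK.
rewrite -!addrA; congr (_ + _); rewrite !addrA; congr (_ + _).
  rewrite /asum -big_split; apply: eq_bigr => j _ /=.
  by rewrite -scalerDr actWE (linD (@tcons2_lin _ _ _ _)) !tcons2E.
apply: eq_bigr => j _; congr (_ *: _); apply: eq_bigr => i _.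
by rewrite tcons2E.
Qed.
End LeibT.

(** * Splitting Lie monomials that contain x_0 and x_1 *)

Section Elimination.
Variables (k : comPzRingType) (L : lieAlg k).

Definition adjoint : lieMod L :=
  @LieMod k L L (@lie_br _ L) (@lie_brl _ L) (@lie_brr _ L) (@lie_jac _ L).

Definition elim_base : lieAlg k := semidirect adjoint.

Definition elim_mod_car : lmodType k := (L * tpow L 2)%type.
(** Here [n.1] has degree (0, 1) and [b.1] degree (1, 0), so the last term is [q, p] = - [p, q] = -
    p (x) q. *)
Definition elim_br (n : elim_mod_car) (b : elim_base) : elim_mod_car :=
  (lie_br n.1 b.2, actW b.2 n.2 - tpair (b.1 : L) n.1).

Lemma elim_brl b : linear (fun n => elim_br n b).
Proof.
move=> e [q t] [q' t']; rewrite /elim_br; congr pair => /=; first exact: lie_brl.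
by rewrite actW_linr tpairr opprD addrACA scalerBr.
Qed.
Lemma elim_brr n : linear (elim_br n).
Proof.
move=> e [p l] [p' l']; rewrite /elim_br; congr pair => /=; first exact: lie_brr.
by rewrite actW_linl tpairl opprD addrACA scalerBr.
Qed.
Lemma elim_jac n b b' : elim_br n (lie_br b b') =
  elim_br (elim_br n b) b' - elim_br (elim_br n b') b.
Proof.
case: n b b' => [q t] [p l] [p' l']; rewrite /elim_br; congr pair => /=.
  exact: lie_jac.
rewrite actW_jac (linB (tpairl _)) !(linB (actW_linr _)) !actWE.
set a := actW _ (actW _ _); set b := actW _ (actW _ _).
set c := tpair _ q; set d := tpair _ q.
set x := tpair _ _; set y := tpair _ _.
rewrite !opprB !opprD !addrA.
by rewrite [RHS](ACl (1*8*6*2*3*5*4*7)) /= !subrK.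
Qed.

(* The extension of L (x) k[e]/e^2 by L (+) (L (x) L): graded by the degrees in two
   distinguished letters, its part of degree (1, 1) is L (x) L with [p, q] = p (x) q. *)
Definition elim_mod : lieMod elim_base := LieMod elim_brl elim_brr elim_jac.
Definition elim : lieAlg k := semidirect elim_mod.
End Elimination.

(** This is the Jacobi identity. It preserves the equation [brW w = ftree t] when [t] is bracketed
    with a tree free of x_0 and x_1. *)
Lemma brW_act (k : comPzRingType) (L : lieAlg k) (l : L) w :
  brW (actW l w) = lie_br (brW w) l.
Proof.
move: w; apply: tpow2_eq.
- by move=> e x y; rewrite actW_linr brW_lin.
- by move=> e x y; rewrite brW_lin lie_brl.
move=> p q; rewrite actWE (linD (@brW_lin _ _)) !brWE.
by rewrite lie_jac addrC subrK.
Qed.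

Section ElimEval.
Variables (k : comPzRingType) (N : nat).
Local Notation Ix := ('I_N.+2).
Local Notation L := (freeLie k Ix).
Local Notation E := (elim L).
Definition one_ord : Ix := lift ord0 ord0.
Local Notation x1 := one_ord.

(* The components of degrees (0, 1), (1, 1), (1, 0), (0, 0) in x_0 and x_1. *)
Definition elim_mk (q : L) (w : tpow L 2) (p l : L) : E := ((q, w), (p, l)).

Lemma elim_brE q w p l q' w' p' l' :
  lie_br (elim_mk q w p l) (elim_mk q' w' p' l') =
  elim_mk (lie_br q l' - lie_br q' l)
    (actW l' w - tpair p' q - (actW l w' - tpair p q'))
    (lie_br p l' - lie_br p' l) (lie_br l l').
Proof. by []. Qed.

Definition elim_gen (j : Ix) : E :=
  if j == ord0 then elim_mk 0 0 (ftree (Var j)) 0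
  else if j == x1 then elim_mk (ftree (Var j)) 0 0 0
  else elim_mk 0 0 0 (ftree (Var j)).

(** A linear span, encoded by its induction principle: membership eliminates directly into any
    predicate closed under linear combinations. *)
Definition in_span2 (s : seq Ix) (w : tpow L 2) : Prop :=
  forall P : tpow L 2 -> Prop, P 0 ->
    (forall a x y, P x -> P y -> P (a *: x + y)) ->
    (forall p q, perm_eq (leaves p ++ leaves q) s ->
       ord0 \in leaves p -> x1 \in leaves q ->
       P (tpair (ftree p) (ftree q))) -> P w.

Lemma in_span2_lin s a x y : in_span2 s x -> in_span2 s y -> in_span2 s (a *: x + y).
Proof. by move=> hx hy P P0 PL Pg; apply: (PL); [apply: hx|apply: hy]. Qed.
Lemma in_span20 s : in_span2 s 0.
Proof. by move=> P. Qed.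
Lemma in_span2N s x : in_span2 s x -> in_span2 s (- x).
Proof.
by move=> h; rewrite -[- x]addr0 -scaleN1r; apply: in_span2_lin => //; apply: in_span20.
Qed.
Lemma in_span2_perm s s' x : perm_eq s s' -> in_span2 s x -> in_span2 s' x.
Proof.
move=> ss h P P0 PL Pg; apply: h => // p q pq; apply: Pg.
exact: perm_trans pq ss.
Qed.
Lemma in_span2_act s t x : in_span2 s x ->
  in_span2 (s ++ leaves t) (actW (ftree t : L) x).
Proof.
move=> h; apply: (h (fun x => in_span2 (s ++ leaves t) (actW (ftree t : L) x))).
- by rewrite (lin0 (@actW_linr _ _ _)); apply: in_span20.
- by move=> a u v hu hv; rewrite actW_linr; apply: in_span2_lin.
move=> p q pq p0 q1; rewrite actWE /= !free_brE -[tpair (ftree (Br p t)) _]scale1r.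
apply: in_span2_lin => P P0 PL Pg; apply: Pg; rewrite //= ?mem_cat ?p0 ?q1 //.
  rewrite -catA (permPl (_ : perm_eq _ (leaves p ++ (leaves q ++ leaves t)))).
    by rewrite catA perm_cat2r.
  by rewrite perm_cat2l perm_catC.
by rewrite catA perm_cat2r.
Qed.

(** The letters x_0 and x_1 occurring in [t] determine its degree, hence the only component that can
    be nonzero. In degree (1, 1) that component writes [t] as a sum of brackets separating the two
    letters. *)
Definition elim_spec (t : tree Ix) (u : E) : Prop :=
  match ord0 \in leaves t, x1 \in leaves t with
  | false, false => u = elim_mk 0 0 0 (ftree t)
  | true, false => u = elim_mk 0 0 (ftree t) 0
  | false, true => u = elim_mk (ftree t) 0 0 0
  | true, true => exists w,
      [/\ u = elim_mk 0 w 0 0, brW w = ftree t & in_span2 (leaves t) w]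
  end.

Lemma elim_specP t : uniq (leaves t) -> elim_spec t (tree_ev elim_gen t).
Proof.
have bl0 (x : L) : lie_br 0 x = 0 by exact: lin0 (@lie_brl _ L x).
have br0 (x : L) : lie_br x 0 = 0 by exact: lin0 (@lie_brr _ L x).
have tl0 (x : L) : tpair 0 x = 0 by exact: lin0 (tpairl x).
have tr0 (x : L) : tpair x 0 = 0 by exact: lin0 (tpairr x).
have al0 w : actW (0 : L) w = 0 by exact: (lin0 (@actW_linl _ L w)).
have ar0 (x : L) : actW x 0 = 0 by exact: lin0 (@actW_linr _ L x).
have brE (a b : tree Ix) : lie_br (ftree a : L) (ftree b) = ftree (Br a b) by exact: free_brE.
have brN (a b : tree Ix) : - lie_br (ftree b : L) (ftree a) = ftree (Br a b).
  by rewrite -lie_anti brE.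
elim: t => [j _|s IHs t IHt].
  rewrite /elim_spec !inE /= /elim_gen ![_ == j]eq_sym.
  have [->|_] := eqVneq j ord0; first by rewrite (negbTE (neq_lift _ _)).
  by have [->|_] := eqVneq j x1.
rewrite [leaves _]/= cat_uniq => /and3P[/IHs hs /hasPn st /IHt ht].
have [w wE] : exists w, w = lie_br (tree_ev elim_gen s) (tree_ev elim_gen t).
  by eexists.
rewrite -[tree_ev _ _]/(lie_br (tree_ev elim_gen s) (tree_ev elim_gen t)) -wE.
move: (tree_ev elim_gen s) (tree_ev elim_gen t) hs ht wE => u v hs ht wE.
have {st}st x : (x \in leaves s) && (x \in leaves t) = false.
  by apply/negP => /andP[xs /st]; rewrite /= xs.
move: (st ord0) (st x1) hs ht; rewrite /elim_spec /= !mem_cat.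
(* No letter lies in both subtrees, so nine cases remain: x_0 and x_1 are each in [s], in [t] or in
   neither. *)
case s0 : (ord0 \in leaves s); case t0 : (ord0 \in leaves t) => //= _;
case s1 : (x1 \in leaves s); case t1 : (x1 \in leaves t) => //= _.
- case=> x [eu hw sw] ev; rewrite wE eu ev elim_brE !(bl0, br0, tl0, tr0, al0, ar0) !subr0.
  exists (actW (ftree t : L) x); split=> //; first by rewrite brW_act hw brE.
  exact: in_span2_act.
- move=> eu ev; rewrite wE eu ev elim_brE !(bl0, br0, tl0, tr0, al0, ar0) !subr0 !sub0r opprK.
  exists (tpair (ftree s : L) (ftree t)); split=> //; first by rewrite brWE.
  by move=> P P0 PL Pg; apply: Pg.
- by move=> eu ev; rewrite wE eu ev elim_brE !(bl0, br0, tl0, tr0, al0, ar0) !subr0 brE.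
- move=> eu ev; rewrite wE eu ev elim_brE !(bl0, br0, tl0, tr0, al0, ar0) !subr0 !sub0r.
  exists (- tpair (ftree t : L) (ftree s)); split=> //.
    by rewrite (linN (@brW_lin _ _)) brWE brN.
  apply: in_span2N; apply: (@in_span2_perm (leaves t ++ leaves s)).
    by rewrite perm_catC.
  by move=> P P0 PL Pg; apply: Pg.
- move=> eu [x [ev hw sw]]; rewrite wE eu ev elim_brE !(bl0, br0, tl0, tr0, al0, ar0) !subr0 !sub0r.
  exists (- actW (ftree s : L) x); split=> //.
    by rewrite (linN (@brW_lin _ _)) brW_act hw brN.
  apply: in_span2N; apply: (@in_span2_perm (leaves t ++ leaves s)).
    by rewrite perm_catC.
  exact: in_span2_act.
- by move=> eu ev; rewrite wE eu ev elim_brE !(bl0, br0, tl0, tr0, al0, ar0) !subr0 !sub0r brN.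
- by move=> eu ev; rewrite wE eu ev elim_brE !(bl0, br0, tl0, tr0, al0, ar0) !subr0 brE.
- by move=> eu ev; rewrite wE eu ev elim_brE !(bl0, br0, tl0, tr0, al0, ar0) !subr0 !sub0r brN.
by move=> eu ev; rewrite wE eu ev elim_brE !(bl0, br0, tl0, tr0, al0, ar0) !subr0 brE.
Qed.

(** The component of degree (1, 1). On a multilinear tree with both letters it is the [w] of
    [elim_spec], a preimage under [brW]; on one lacking either letter it is 0. *)
Definition Phi (a : L) : tpow L 2 := (free_ev elim_gen a : E).1.2.

Lemma Phi_lin : linear Phi.
Proof. by move=> e x y; rewrite /Phi (free_ev_lin (L := E)). Qed.
End ElimEval.

(** * Embedding of Gamma in tensor powers of the free Lie algebra *)

Lemma lin_sum (k : comPzRingType) (U V : lmodType k) (f : U -> V) (I : finType)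
    (P : pred I) (F : I -> U) :
  linear f -> f (\sum_(i | P i) F i) = \sum_(i | P i) f (F i).
Proof. by move=> fl; apply: (linear_sum (linMap fl)). Qed.

Lemma lin_bsum (X : Type) (br : X -> X -> X) (k : comPzRingType) (U V : lmodType k)
    (f : U -> V) m (G : ('I_m -> X) -> U) a : linear f ->
  f (bsum br G a) = bsum br (fun c => f (G c)) a.
Proof.
move=> fl; rewrite /bsum (lin_sum _ _ fl); apply: eq_bigr => j _.
by rewrite (linZ fl) (lin_sum _ _ fl).
Qed.

Lemma tree_ev_merge_at (k : comPzRingType) (T : finType) (L : lieAlg k) (c : T -> L) m
    (j : 'I_m.+1) (i : 'I_m) (a : 'I_m.+1 -> tree T) (l : 'I_m) :
  tree_ev c (merge_at (@Br _) j i a l) = merge_at (@lie_br _ L) j i (fun x => tree_ev c (a x)) l.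
Proof. by rewrite /merge_at; case: ifP. Qed.

Section LeibSquare.
Variables (k : comPzRingType) (L : lieAlg k).
Local Notation M := (adjoint L).

Definition emb (v : nat) (b : L) : semidirect M := if v is 0 then (b, 0) else (0, b).
Lemma emb_lin v : linear (emb v).
Proof. by case: v => [|v] e a b; congr pair; rewrite /= ?scaler0 ?addr0. Qed.
Lemma emb_slot v b : in_slot v (emb v b).
Proof. by case: v. Qed.
Lemma emb_br v w a b : lie_br (emb v a) (emb w.+1 b) = emb v (lie_br a b).
Proof.
have l0 x : lie_br (0 : L) x = 0 by exact: lin0 (@lie_brl _ L x).
case: v => [|v]; congr pair; rewrite /= ?l0 ?subr0 //.
Qed.

Lemma tens_embed_multi m : multilinear (V := fun _ : 'I_m.+1 => lie_car L)
  (fun a => ptensM (M := M) (fun l => emb l (a l))).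
Proof.
move=> i e u v w [hi hj]; apply: (@ptensM_multi _ _ _ _ i).
  by rewrite hi emb_lin.
by move=> l /hj[<- <-].
Qed.
Definition tens_embed m : tpow L m.+1 -> lod_ob M m :=
  tensLift (fun a => ptensM (M := M) (fun l => emb l (a l))).
Lemma tens_embed_lin m : linear (@tens_embed m).
Proof. exact/tensLift_lin/tens_embed_multi. Qed.
Lemma tens_embedE m a : @tens_embed m (tp a) = ptensM (M := M) (fun l => emb l (a l)).
Proof. exact: (tensLift_p (@tens_embed_multi m)). Qed.

Definition unemb v : LVn M v -> L := match v with 0 => id | _ => id end.
Lemma unemb_lin v : linear (@unemb v).
Proof. by case: v. Qed.
Lemma tens_unembed_multi m : multilinear (V := @LV k L M m)
  (fun a => tp (fun l => unemb (a l))).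
Proof.
move=> i e u v w [hi hj]; apply: (@ptens_multi _ _ _ i); split.
  by rewrite hi unemb_lin.
by move=> l /hj[<- <-].
Qed.
Definition tens_unembed m : lod_ob M m -> tpow L m.+1 :=
  tensLift (fun a : fam (@LV k L M m) => tp (fun l => unemb (a l))).

Lemma tens_embedK m : cancel (@tens_embed m) (@tens_unembed m).
Proof.
move=> u; move: u; apply: (pres_eq (g := id)) => //.
  by move=> e x y; rewrite tens_embed_lin [LHS](tensLift_lin (@tens_unembed_multi m)).
move=> a; rewrite -[gen _ a]/(tp a) tens_embedE [LHS](tensLift_p (@tens_unembed_multi m)).
by congr tp; apply/funext => -[[|l] hl].
Qed.

Lemma leib_d_embed m u : leib_d (@tens_embed m.+1 u) = @tens_embed m (dT u).
Proof.
move: u; apply: (pres_eq (f := fun u => leib_d (tens_embed u)) (g := fun u => tens_embed (dT u))).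
- by move=> e x y; rewrite tens_embed_lin leib_d_lin.
- by move=> e x y; rewrite dT_lin tens_embed_lin.
move=> a; rewrite -[gen _ a]/(tp a) tens_embedE leib_dE => [|l]; last exact: emb_slot.
rewrite dTE (lin_bsum _ _ _ (@tens_embed_lin m)).
apply: eq_bigr => j _; rewrite -scaler_sumr; congr (_ *: _); apply: eq_bigr => i ij.
rewrite tens_embedE; congr ptensM; apply/funext => l.
(* As i < j, the index j is positive and the factor [a j] lies in the algebra summand, as [emb_br]
   requires. *)
case: j ij => [[|j] hj] // ij.
rewrite /leib_merge /merge_at; case: eqP => [->|_].
  have li : lift (Ordinal hj) i = i :> nat by rewrite /= /bump leqNgt ij.
  by rewrite -(emb_br _ j) li.
case: l => [[|l] hl] //.
by rewrite /= /bump; case: (_ <= _)%N.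
Qed.

(** Transported from [leib_dd]: [tens_embed] sends tensors injectively to Leibniz chains of [L] with
    coefficients in its adjoint module, compatibly with the differentials. *)
Lemma dT_dT m (u : tpow L m.+3) : dT (dT u) = 0.
Proof.
apply: (can_inj (@tens_embedK m)).
by rewrite -!leib_d_embed leib_dd (lin0 (@tens_embed_lin m)).
Qed.
End LeibSquare.

Section GamPower.
Variables (k : comPzRingType) (n m : nat).
Local Notation L := (freeLie k 'I_n.+1).

Lemma gam_inc_multi (al : shsurj n m) : multilinear (V := fun i => Lie k (fib al i))
  (fun f => tp (fun i => lie_inc (f i) : L)).
Proof.
move=> i e u v w [hi hj]; apply: (@ptens_multi _ _ _ i); split.
  by rewrite hi lie_inc_lin.
by move=> l /hj[<- <-].
Qed.
(** The surjection is forgotten, as the letters in each factor determine it. Composition with the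
    Leibniz morphisms can then be computed on tensors. *)
Definition gam_inc : gam k n m -> tpow L m.+1 :=
  dsumLift (fun al : shsurj n m => tensLift (fun f : fam (fun i => Lie k (fib al i)) =>
    tp (fun i => lie_inc (f i) : L))).
Fact gam_inc_summand (al : shsurj n m) : linear (tensLift (fun f : fam (fun i => Lie k (fib al i)) =>
    tp (fun i => lie_inc (f i) : L))).
Proof. exact/tensLift_lin/gam_inc_multi. Qed.
Lemma gam_inc_lin : linear gam_inc.
Proof. exact: (dsumLift_lin gam_inc_summand). Qed.
Lemma gam_incE al (f : forall i, Lie k (fib al i)) :
  gam_inc (gpure f) = tp (fun i => lie_inc (f i) : L).
Proof.
rewrite /gam_inc /gpure (dsumLift_inj gam_inc_summand).
exact: (tensLift_p (@gam_inc_multi al)).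
Qed.

Lemma gam_retr_multi : multilinear (V := fun _ : 'I_m.+1 => lie_car L)
  (fun u => \sum_(al : shsurj n m) gpure (fun i => lie_proj (fib al i) (u i))).
Proof.
move=> i e u v w [hi hj]; apply: sum_lin => al _; apply: (@gpure_multi _ _ _ _ i).
split; first by rewrite hi lie_proj_lin.
by move=> l /hj[<- <-].
Qed.
(** All surjections are summed over; on the image of a pure morphism only its own surjection
    contributes. *)
Definition gam_retr : tpow L m.+1 -> gam k n m :=
  tensLift (V := fun _ : 'I_m.+1 => lie_car L)
    (fun u => \sum_(al : shsurj n m) gpure (fun i => lie_proj (fib al i) (u i))).
Lemma gam_retr_lin : linear gam_retr.
Proof. exact/tensLift_lin/gam_retr_multi. Qed.

Lemma lie_proj_inc0 (I J : {set 'I_n.+1}) (x : Lie k I) :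
  I != J -> lie_proj J (lie_inc x) = 0.
Proof.
move=> IJ; move: x; apply: (pres_eq (f := fun x => lie_proj J (lie_inc x)) (g := fun=> 0)).
- by move=> e x y; rewrite lie_inc_lin lie_proj_lin.
- by move=> e x y; rewrite scaler0 addr0.
move=> s; rewrite lie_incE /lie_proj (presLift_gen (@lie_proj_resp k _ J)).
case: insubP => // t /perm_mem h _; case/eqP: IJ; apply/setP => x.
by have := h x; rewrite mon_mem mem_enum.
Qed.

Lemma gpure0 (al : shsurj n m) i (f : forall i, Lie k (fib al i)) :
  f i = 0 -> gpure f = 0.
Proof.
move=> h; rewrite (@gpure_multi _ _ _ _ i (-1) f f f) ?scaleN1r ?addNr //.
by split=> //; rewrite h scaler0 addr0.
Qed.

Lemma gam_incK : cancel gam_inc gam_retr.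
Proof.
move=> u; move: u; apply: (gam_eq (g := id)) => //.
  by move=> e x y; rewrite gam_inc_lin gam_retr_lin.
move=> al f; rewrite gam_incE [LHS](tensLift_p gam_retr_multi).
rewrite (bigD1 al) //= [X in _ + X]big1 ?addr0 -?gpure_proj // => be beal.
(* If [be] differs from [al] at [x], their fibres over [sval al x] differ, and the projection of
   that factor is 0. *)
have [x hx] : exists x, sval al x != sval be x.
  apply/existsP; apply: contraR beal => /existsPn h.
  by apply/eqP/val_inj/ffunP => x; apply/eqP; rewrite eq_sym; have := h x; rewrite negbK.
apply: (@gpure0 _ (sval al x)); apply: lie_proj_inc0.
by apply: contraNneq hx => /setP/(_ x); rewrite !in_fib eqxx eq_sym.
Qed.

Definition fits (al : shsurj n m) (t : 'I_m.+1 -> tree 'I_n.+1) : Prop :=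
  forall i, perm_eq (leaves (t i)) (enum (fib al i)).

(** Going through [gam_retr] makes this total in [t]: no surjection and no proof of [fits] has to be
    carried along. *)
Definition gtree (t : 'I_m.+1 -> tree 'I_n.+1) : gam k n m :=
  gam_retr (tp (fun i => ftree (t i) : L)).

Lemma gtreeE al t (h : fits al t) : gtree t = gpure (fun i => lie_mon k (h i)).
Proof.
rewrite -[RHS]gam_incK gam_incE; congr gam_retr; congr tp.
by apply/funext => i; rewrite lie_incE.
Qed.

Lemma gam_inc_tree al t (h : fits al t) : gam_inc (gtree t) = tp (fun i => ftree (t i) : L).
Proof. by rewrite (gtreeE h) gam_incE; congr tp; apply/funext => i; rewrite lie_incE. Qed.
End GamPower.

(** * The Leibniz morphisms *)

Lemma merge_fits n (j : 'I_n.+2) (i : 'I_n.+1) : (i < j)%N ->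
  exists al : shsurj n.+1 n, fits al (merge_at (@Br _) j i (@Var _)).
Proof.
move=> ij.
(* [al] sends [j] to [i] and the remaining indices in order. Since i < j, the minimum of the fibre
   over [a] is [lift j a], so the minima increase. *)
pose al : {ffun 'I_n.+2 -> 'I_n.+1} := [ffun x => if unlift j x is Some y then y else i].
have alE y : al (lift j y) = y by rewrite ffunE liftK.
have alj : al j = i by rewrite ffunE unlift_none.
have al_sh : shuffling al.
  apply/shufflingP; split=> [l||a b ab]; first by exists (lift j l).
    case: (unliftP j ord0) => [y e|e]; last by rewrite -e in ij.
    have -> : ord0 = lift j ord0 by apply: val_inj; rewrite /= /bump leqNgt (leq_ltn_trans _ ij).
    by rewrite alE.
  exists (lift j a) => // y; case: (unliftP j y) => [y' ->|->].
    by rewrite alE => ->; rewrite /= /bump; lia.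
  by rewrite alj => ib; rewrite /= /bump; move: ij; rewrite ib; lia.
exists (exist [eta @shuffling n.+1 n] al al_sh) => l; apply: uniq_perm.
- rewrite /merge_at; case: ifP => //= _.
  by rewrite inE andbT eq_sym neq_lift.
- exact: enum_uniq.
move=> x; rewrite mem_enum in_fib /merge_at [sval _]/=.
case: (unliftP j x) => [y ->|->].
  rewrite alE; case: ifP => _; rewrite !inE /= ?(inj_eq lift_inj) //.
  by rewrite (negbTE (_ : lift j y != j)) ?orbF // eq_sym neq_lift.
rewrite alj [i == l]eq_sym; case: ifP => _; rewrite !inE ?eqxx ?orbT //.
by rewrite (negbTE (neq_lift _ _)).
Qed.

Section Delta.
Variable k : comPzRingType.

Definition leib_mor n : gam k n.+1 n :=
  bsum (@Br _) (@gtree k n.+1 n) (@Var _).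

Lemma eq_bsum_lt (X Y : Type) (br : X -> X -> X) (br' : Y -> Y -> Y) (V : lmodType k) m
    (G : ('I_m -> X) -> V) (G' : ('I_m -> Y) -> V) a a' :
  (forall (j : 'I_m.+1) (i : 'I_m), (i < j)%N -> G (merge_at br j i a) = G' (merge_at br' j i a')) ->
  bsum br G a = bsum br' G' a'.
Proof.
move=> h; apply: eq_bigr => j _; congr (_ *: _); apply: eq_bigr => i ij.
exact: h.
Qed.

Lemma lie_ev_mon n m (al : shsurj n m) t (h : fits al t) (L : lieAlg k) (c : _ -> L) i :
  lie_ev c (lie_mon k (h i)) = tree_ev c (t i).
Proof. by rewrite lie_evE. Qed.

Lemma gam_inc_cmp_tree r n m (al : shsurj n m) t (h : fits al t) (be : shsurj r n)
    (f : forall i, Lie k (fib be i)) :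
  gam_inc (gcmp (gtree k t) (gpure f)) =
  tp (fun i => tree_ev (fun j => lie_inc (f j) : freeLie k _) (t i)).
Proof.
rewrite (gtreeE k h) gcmpE gam_incE; congr tp; apply/funext => i.
by rewrite [LHS](lie_comp_gam (fun i => lie_mon k (h i)) f i) lie_ev_mon.
Qed.

(** Composition is substitution, so composing with the morphism bracketing x_i with x_j brackets the
    corresponding tensor factors. *)
Lemma gam_inc_leib r n (f : gam k r n.+1) :
  gam_inc (gcmp (leib_mor n) f) = dT (gam_inc f).
Proof.
move: f; apply: gam_eq.
- by move=> e x y; rewrite gcmp_linr gam_inc_lin.
- by move=> e x y; rewrite gam_inc_lin dT_lin.
move=> al f; rewrite gam_incE dTE.
have fl : linear (fun g => gam_inc (gcmp g (gpure f)) : tpow (freeLie k 'I_r.+1) n.+1).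
  by move=> e x y; rewrite gcmp_linl gam_inc_lin.
rewrite (lin_bsum _ _ _ fl); apply: eq_bsum_lt => j i ij.
have [be h] := merge_fits ij; rewrite (gam_inc_cmp_tree h); congr tp.
by apply/funext => l; rewrite tree_ev_merge_at.
Qed.

(** [gam_inc] is injective and sends this composite to [dT] applied twice to the image of the
    identity. *)
Lemma leib_mor_sqr n : gcmp (leib_mor n) (leib_mor n.+1) = 0.
Proof.
apply: (can_inj (@gam_incK k n.+2 n)).
rewrite gam_inc_leib -[leib_mor n.+1]gcmp_idr gam_inc_leib dT_dT.
by rewrite (lin0 (@gam_inc_lin _ _ _)).
Qed.

Lemma lod_act_leib (A : lieAlg k) (M : lieMod A) n (u : lod_ob M n.+1) :
  lod_act (leib_mor n) u = leib_d u.
Proof.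
move: u; apply: pres_eq; [exact: lod_linr|exact: leib_d_lin|move=> a].
rewrite -/(ptens a) /leib_d tensLift_p; last exact: leib_pure_multi.
have fl : linear (fun g => lod_act g (ptens a) : lod_ob M n) by apply: lod_linl.
rewrite (lin_bsum _ _ _ fl); apply: eq_bigr => j _; rewrite -scaler_sumr; congr (_ *: _).
apply: eq_bigr => i ij; have [al h] := merge_fits ij.
rewrite (gtreeE k h) lod_actE lod_pureE; congr ptens.
apply: functional_extensionality_dep => l; rewrite /lod_val lie_ev_mon tree_ev_merge_at.
by [].
Qed.

(** Only i = 0, j = 1 occurs, with sign -1. This identifies the end of the complex with the
    presentation of t (x) F. *)
Lemma leib_mor0 : leib_mor 0 = - d01 k.
Proof.
have h : fits sh01 (fun _ : 'I_1 => Br (Var ord0) (Var (ord_max : 'I_2))) by apply: fib01.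
have -> : d01 k = gtree k (fun _ : 'I_1 => Br (Var ord0) (Var (ord_max : 'I_2))).
  by rewrite (gtreeE k h); congr gpure; apply: functional_extensionality_dep => i;
     congr gen; apply: val_inj.
rewrite /leib_mor /bsum !big_ord_recl !big_ord0 addr0 big_pred0_eq scaler0 add0r.
rewrite (big_pred1 ord0) => [|i]; last by rewrite [i]ord1.
rewrite expr1 scaleN1r; congr (- gtree k _); apply/funext => l.
by rewrite [l]ord1 /merge_at eqxx; congr (Br (Var _) (Var _)); apply: val_inj.
Qed.
End Delta.

(** * Contraction of the representables *)

(* The factors are replaced by generators one at a time. *)
Lemma multilinear_span (k : comPzRingType) (I : finType) (V : I -> lmodType k)
    (W : lmodType k) (g : fam V -> W) (S : W -> Prop) (G : forall i, V i -> Prop) :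
  multilinear g -> S 0 -> (forall a x y, S x -> S y -> S (a *: x + y)) ->
  (forall i (Q : V i -> Prop), Q 0 -> (forall a x y, Q x -> Q y -> Q (a *: x + y)) ->
     (forall x, G i x -> Q x) -> forall x, Q x) ->
  (forall u, (forall i, G i (u i)) -> S (g u)) -> forall u, S (g u).
Proof.
move=> gm S0 Slin span Sg u.
suff H (s : seq I) : forall u, (forall i, i \notin s -> G i (u i)) -> S (g u).
  by apply: (H (enum I)) => i; rewrite mem_enum.
elim: s => [|i s IH] {}u hu; first by apply: Sg => i; apply: hu.
have lin_i a (x y : V i) : g (dfwith u (a *: x + y)) = a *: g (dfwith u x) + g (dfwith u y).
  apply: (gm i); split; first by rewrite !dfwith_in.
  by move=> j ji; rewrite !dfwith_out // eq_sym.
have -> : u = dfwith u (u i).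
  apply: functional_extensionality_dep => j; have [<-|ij] := eqVneq i j.
    by rewrite dfwith_in.
  by rewrite dfwith_out.
move: (u i); apply: span.
- by rewrite -(subrr (0 : V i)) -scaleN1r addrC lin_i scaleN1r addNr.
- by move=> a x y hx hy; rewrite lin_i; apply: Slin.
move=> x Gx; apply: IH => j js; have [<-|ij] := eqVneq i j.
  by rewrite dfwith_in.
by rewrite dfwith_out //; apply: hu; rewrite inE negb_or eq_sym ij.
Qed.

Lemma gam_tree_ind (k : comPzRingType) n m (P : gam k n m -> Prop) :
  P 0 -> (forall a x y, P x -> P y -> P (a *: x + y)) ->
  (forall al t, @fits n m al t -> P (gtree k t)) -> forall f, P f.
Proof.
move=> P0 PL Pt; apply: gam_ind => // al.
apply: (@multilinear_span _ _ _ _ _ P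
  (fun i x => exists s : mon (fib al i), x = gen (@lieRel k _ (fib al i)) s)) => //.
- by move=> i e u v w; apply: gpure_multi.
- by move=> i Q Q0 QL Qg; apply: pres_ind => // s; apply: Qg; exists s.
move=> u hu; have ex i := cid (hu i).
pose s i := projT1 (ex i); have hs i : u i = gen _ (s i) := projT2 (ex i).
have h : fits al (fun i => sval (s i)) by move=> i; apply: (svalP (s i)).
have -> : gpure u = gtree k (fun i => sval (s i)); last exact: Pt h.
rewrite (gtreeE k h); congr gpure; apply: functional_extensionality_dep => i.
by rewrite hs; congr gen; apply: val_inj.
Qed.

Section Contraction.
Variables (k : comPzRingType) (N : nat).
Local Notation Ix := ('I_N.+2).
Local Notation L := (freeLie k Ix).
Local Notation x1 := (one_ord N).

Lemma Phi_br (a b : L) q w p l q' w' p' l' :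
  free_ev (@elim_gen k N) a = elim_mk q w p l ->
  free_ev (@elim_gen k N) b = elim_mk q' w' p' l' ->
  Phi (lie_br a b) = actW l' w - tpair p' q - (actW l w' - tpair p q').
Proof. by move=> ha hb; rewrite /Phi free_ev_br ha hb. Qed.

Lemma fits_mem n m (al : shsurj n m) t x i : fits al t -> (x \in leaves (t i)) = (sval al x == i).
Proof. by move=> h; rewrite (perm_mem (h i)) mem_enum in_fib. Qed.

Lemma fits_uniq n m (al : shsurj n m) t i : fits al t -> uniq (leaves (t i)).
Proof. by move=> h; rewrite (perm_uniq (h i)) enum_uniq. Qed.

Lemma fits_elim m (al : shsurj N.+1 m) t i : fits al t ->
  match ord0 == i, sval al x1 == i with
  | false, false => free_ev (@elim_gen k N) (ftree (t i)) = elim_mk 0 0 0 (ftree (t i))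
  | true, false => free_ev (@elim_gen k N) (ftree (t i)) = elim_mk 0 0 (ftree (t i)) 0
  | false, true => free_ev (@elim_gen k N) (ftree (t i)) = elim_mk (ftree (t i)) 0 0 0
  | true, true => exists w, [/\ free_ev (@elim_gen k N) (ftree (t i)) = elim_mk 0 w 0 0,
      brW w = ftree (t i) & in_span2 (leaves (t i)) w]
  end.
Proof.
move=> h; have := elim_specP k (fits_uniq i h); rewrite /elim_spec !(fits_mem _ _ h).
have /shufflingP[_ -> _] := svalP al.
by rewrite free_evE.
Qed.

(** If x_1 were in a later block, block 1 would contain an index below 1; but 0 lies in block 0. *)
Lemma shuffling_one m (al : shsurj N.+1 m.+1) :
  sval al x1 = ord0 \/ sval al x1 = lift ord0 ord0.
Proof.
have /shufflingP[a1 a2 a3] := svalP al.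
case: (unliftP ord0 (sval al x1)) => [j e|]; last by left.
right; rewrite e; congr lift; apply: val_inj; case: j e => [[|j] hj] // e.
have [|x xl] := a3 (lift ord0 ord0) (sval al x1); first by rewrite e.
move/(_ x1 erefl); case: x xl => [[|x] hx] //.
have -> : Ordinal hx = ord0 by apply: val_inj.
by rewrite a2 => /(congr1 val).
Qed.

Lemma contrT_multi m : multilinear (V := fun _ : 'I_m.+1 => lie_car L)
  (fun a => tcons2 (Phi (a ord0)) (fun j => a (lift ord0 j))).
Proof.
move=> i e u v w [+ hj]; case: (unliftP ord0 i) hj => [i' ->|->] hj hi.
  have [<- <-] := hj ord0 (neq_lift _ _); apply: (@tcons2_multi _ _ _ _ i').
  by split=> // j ji; apply: hj; rewrite (inj_eq lift_inj).
have tl (j : 'I_m) := hj (lift ord0 j) ltac:(by rewrite eq_sym neq_lift).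
have <- : (fun j => u (lift ord0 j)) = (fun j => v (lift ord0 j)).
  by apply/funext => j; case: (tl j).
have <- : (fun j => u (lift ord0 j)) = (fun j => w (lift ord0 j)).
  by apply/funext => j; case: (tl j).
by rewrite hi Phi_lin tcons2_lin.
Qed.

(** [Phi] breaks the leading factor, the one with x_0 on the image of [gam_inc], into two. Up to
    sign this is the contracting homotopy. *)
Definition contrT m : tpow L m.+1 -> tpow L m.+2 :=
  tensLift (V := fun _ : 'I_m.+1 => lie_car L)
    (fun a => tcons2 (Phi (a ord0)) (fun j => a (lift ord0 j))).
Lemma contrT_lin m : linear (@contrT m).
Proof. exact/tensLift_lin/contrT_multi. Qed.
Lemma contrTE m (p : L) (c : 'I_m -> L) : contrT (tp (fcons p c)) = tcons2 (Phi p) c.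
Proof.
rewrite [LHS](tensLift_p (@contrT_multi m)) fcons0; congr tcons2.
by apply/funext => j; rewrite fconsS.
Qed.

Lemma contrT_homotopy m (al : shsurj N.+1 m.+1) t : fits al t ->
  dT (contrT (tp (fun i => ftree (t i) : L))) + contrT (dT (tp (fun i => ftree (t i) : L))) =
  - tp (fun i => ftree (t i) : L).
Proof.
have al0 w : actW (0 : L) w = 0 by exact: (lin0 (@actW_linl _ L w)).
have ar0 (x : L) : actW x 0 = 0 by exact: lin0 (@actW_linr _ L x).
have tl0 (x : L) : tpair 0 x = 0 by exact: lin0 (tpairl x).
have tr0 (x : L) : tpair x 0 = 0 by exact: lin0 (tpairr x).
have tc0 n (c : 'I_n -> L) : tcons2 0 c = 0 by exact: lin0 (tcons2_lin c).
move=> h; pose a0 : L := ftree (t ord0); pose b j : L := ftree (t (lift ord0 j)).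
have -> : (fun i => ftree (t i) : L) = fcons a0 b by apply: fcons_eq.
rewrite contrTE dTE (lin_bsum _ _ _ (@contrT_lin _)) bsum_cons.
have cE p : (fun c => contrT (tp (fcons (p : L) c))) = tcons2 (m := m) (Phi p).
  by apply/funext => c; rewrite contrTE.
rewrite cE.
have := fits_elim ord0 h; rewrite ?eqxx.
case: (shuffling_one al) => e1.
  (* x_1 is in the block of x_0: then [brW w] is [a0], which gives the term sought, and the [asum]
     and [bsum] terms of [dT_tcons2] cancel against those of [bsum_cons]. *)
  rewrite e1 eqxx => -[w [ev hw _]].
  have PE : Phi a0 = w by rewrite /Phi ev.
  rewrite PE dT_tcons2 hw -/a0.
  have -> : asum (fun l c => contrT (tp (fcons (lie_br a0 l) c))) b =
            asum (fun l c => tcons2 (actW l w) c) b.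
    apply: eq_asum => j; rewrite contrTE; congr tcons2.
    have := fits_elim (lift ord0 j) h; rewrite ?(negbTE (neq_lift _ _)) e1.
    rewrite (negbTE (neq_lift _ _)) => evj.
    by rewrite (Phi_br ev evj) tl0 ar0 !subr0.
  by rewrite -opprD -[X in X - _]addrA addrK.
(* x_1 is in the next block: [Phi a0] is 0, and among the brackets of [a0] with a later factor only
   the first contains both letters; [Phi] sends it back to a pair. *)
rewrite e1 (negbTE (_ : lift ord0 ord0 != ord0)) => [ev|]; last by rewrite eq_sym neq_lift.
have PE : Phi a0 = 0 by rewrite /Phi ev.
rewrite PE tc0 (lin0 (@dT_lin _ _ _)) add0r.
have -> : bsum (@lie_br _ L) (tcons2 (m := m) 0) b = 0.
  by rewrite /bsum big1 // => j _; rewrite big1 ?scaler0 // => i _; rewrite tc0.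
rewrite subr0; congr (- _).
rewrite /asum big_ord_recl expr0 scale1r [X in _ + X]big1 ?addr0 => [|j _].
  rewrite contrTE.
  have := fits_elim (lift ord0 ord0) h; rewrite ?(negbTE (neq_lift _ _)) e1 eqxx => ev1.
  rewrite (Phi_br ev ev1) !(ar0, tl0, al0) !(subr0, sub0r) opprK -/a0 tcons2E.
  by congr (tp (fcons _ _)); rewrite [RHS]fcons_eta.
rewrite contrTE.
have := fits_elim (lift ord0 (lift ord0 j)) h; rewrite ?(negbTE (neq_lift _ _)) e1.
rewrite (inj_eq lift_inj) (negbTE (neq_lift _ _)) => evj.
by rewrite (Phi_br ev evj) !(ar0, tl0, al0, tr0) !subr0 tc0 scaler0.
Qed.

(** Block 0 is cut into [p] and [q] and the later blocks move up by one. The result is shuffling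
    because [p] and [q] contain the two smallest indices, 0 and 1. *)
Lemma split_fits m (al : shsurj N.+1 m) t p q : fits al t ->
  perm_eq (leaves p ++ leaves q) (leaves (t ord0)) ->
  ord0 \in leaves p -> x1 \in leaves q ->
  exists al' : shsurj N.+1 m.+1, fits al' (fcons p (fcons q (fun j => t (lift ord0 j)))).
Proof.
move=> h pq p0 q1.
have /shufflingP[a1 a2 a3] := svalP al.
have upq : uniq (leaves p ++ leaves q) by rewrite (perm_uniq pq) (fits_uniq _ h).
have /and3P[up /hasPn npq uq] : [&& uniq (leaves p), ~~ has (mem (leaves p)) (leaves q)
   & uniq (leaves q)] by rewrite -cat_uniq.
have mpq x : (x \in leaves p) || (x \in leaves q) = (sval al x == ord0).
  by rewrite -mem_cat (perm_mem pq) (fits_mem _ _ h).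
pose al' : {ffun 'I_N.+2 -> 'I_m.+2} := [ffun x =>
  if x \in leaves p then ord0 else lift ord0 (sval al x)].
have al'p x : (x \in leaves p) = (al' x == ord0).
  by rewrite ffunE; case: ifP => // _; rewrite eq_sym (negbTE (neq_lift _ _)).
have al'q x : (x \in leaves q) = (al' x == lift ord0 ord0).
  rewrite ffunE; case: ifP => xp.
    by rewrite (negbTE (neq_lift _ _)); apply/negP => /npq; rewrite /= xp.
  by rewrite (inj_eq lift_inj) -mpq xp.
have al't x j : (x \in leaves (t (lift ord0 j))) = (al' x == lift ord0 (lift ord0 j)).
  rewrite (fits_mem _ _ h) ffunE; case: ifP => xp; last by rewrite (inj_eq lift_inj).
  rewrite (negbTE (neq_lift _ _)); have := mpq x; rewrite xp => /esym/eqP->.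
  by rewrite (negbTE (neq_lift _ _)).
have al'0 : al' ord0 = ord0 by apply/eqP; rewrite -al'p.
have al'1 : al' x1 = lift ord0 ord0 by apply/eqP; rewrite -al'q.
have sh : shuffling al'.
  apply/shufflingP; split=> // [i|i j].
    case: (unliftP ord0 i) => [i' ->|->]; last by exists ord0.
    case: (unliftP ord0 i') => [i'' ->|->]; last by exists x1.
    have [x hx] := a1 (lift ord0 i''); exists x; apply/eqP.
    by rewrite -al't (fits_mem _ _ h) hx.
  case: (unliftP ord0 i) => [i' ->|->] ij; last first.
    exists ord0 => // y yj; case: y yj => [[|y] hy] //.
    have -> : Ordinal hy = ord0 by apply: val_inj.
    by rewrite al'0 => j0; rewrite -j0 in ij.
  case: (unliftP ord0 i') ij => [i'' ->|->] ij; last first.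
    exists x1 => // y yj; case: y yj => [[|[|y]] hy] //.
      have -> : Ordinal hy = ord0 by apply: val_inj.
      by rewrite al'0 => j0; rewrite -j0 in ij.
    have -> : Ordinal hy = x1 by apply: val_inj.
    by rewrite al'1 => j0; rewrite -j0 ltnn in ij.
  case: (unliftP ord0 j) ij => [j' ->|->] // ij.
  case: (unliftP ord0 j') ij => [j'' ->|->] // ij.
  have [|x xi xmin] := a3 (lift ord0 i'') (lift ord0 j''); first by [].
  exists x; first by apply/eqP; rewrite -al't (fits_mem _ _ h) xi.
  by move=> y /eqP; rewrite -al't (fits_mem _ _ h) => /eqP; apply: xmin.
exists (exist [eta @shuffling N.+1 m.+1] al' sh) => i.
apply: uniq_perm; last first.
- move=> x; rewrite mem_enum in_fib [sval _]/=.
  case: (unliftP ord0 i) => [i' ->|->]; last by rewrite fcons0.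
  rewrite fconsS; case: (unliftP ord0 i') => [i'' ->|->]; last by rewrite fcons0.
  by rewrite fconsS.
- exact: enum_uniq.
case: (unliftP ord0 i) => [i' ->|->]; last by rewrite fcons0.
rewrite fconsS; case: (unliftP ord0 i') => [i'' ->|->]; last by rewrite fcons0.
by rewrite fconsS (fits_uniq _ h).
Qed.

(** [Phi] yields only pairs as in [split_fits], so [contrT] preserves the image of [gam_inc] and the
    homotopy descends to [gam]. *)
Lemma contrT_inc m (f : gam k N.+1 m) : exists g : gam k N.+1 m.+1,
  gam_inc g = contrT (gam_inc f).
Proof.
move: f; apply: gam_tree_ind.
- by exists 0; rewrite !(lin0 (@gam_inc_lin _ _ _)) (lin0 (@contrT_lin _)).
- move=> a x y [g hg] [g' hg']; exists (a *: g + g').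
  by rewrite !gam_inc_lin contrT_lin hg hg'.
move=> al t h; rewrite (gam_inc_tree k h).
pose b j : L := ftree (t (lift ord0 j)).
have -> : (fun i => ftree (t i) : L) = fcons (ftree (t ord0) : L) b by apply: fcons_eq.
rewrite contrTE; have := fits_elim ord0 h; rewrite ?eqxx; case: ifP => _; last first.
  move=> ev; exists 0; rewrite /Phi ev (lin0 (@gam_inc_lin _ _ _)) /=.
  by rewrite (lin0 (tcons2_lin b)).
move=> [w [ev _ hw]]; rewrite /Phi ev /=.
apply: (hw (fun w => exists g, gam_inc g = tcons2 w b)).
- by exists 0; rewrite (lin0 (@gam_inc_lin _ _ _)) (lin0 (tcons2_lin b)).
- move=> a x y [g hg] [g' hg']; exists (a *: g + g').
  by rewrite gam_inc_lin tcons2_lin hg hg'.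
move=> p q pq p0 q1; have [al' h'] := split_fits h pq p0 q1.
exists (gtree k (fcons p (fcons q (fun j => t (lift ord0 j))))).
rewrite (gam_inc_tree k h') tcons2E; congr tp.
apply: fcons_eq => [|j]; first by rewrite fcons0.
by rewrite fconsS; case: (unliftP ord0 j) => [i ->|->]; rewrite ?fconsS ?fcons0.
Qed.
End Contraction.

Lemma gam0S (k : comPzRingType) m (f : gam k 0 m.+1) : f = 0.
Proof.
move: f; apply: (gam_eq (f := id) (g := fun=> 0)) => // [e x y|al].
  by rewrite scaler0 addr0.
have /shufflingP[a1 a2 _] := svalP al.
have [x] := a1 ord_max; rewrite [x]ord1 a2 => /(congr1 val).
by [].
Qed.

Lemma gam_contraction (k : comPzRingType) r : exists h : forall m, gam k r m -> gam k r m.+1,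
  (forall m, linear (h m)) /\
  (forall m (f : gam k r m.+1),
     gcmp (leib_mor k m.+1) (h m.+1 f) + h m (gcmp (leib_mor k m) f) = f).
Proof.
case: r => [|N].
  (* There is no letter x_1 here, but also no surjection from [0] onto [m+1]. *)
  exists (fun _ _ => 0); split=> [m a x y|m f]; first by rewrite scaler0 addr0.
  by rewrite [RHS]gam0S [LHS]gam0S.
(* The sign compensates the one in [contrT_homotopy]. *)
exists (fun m f => - gam_retr (contrT (gam_inc f))); split=> [m a x y|m f].
  by rewrite gam_inc_lin contrT_lin gam_retr_lin opprD scalerN.
apply: (can_inj (@gam_incK _ _ _)).
have incK n (u : gam k N.+1 n) : gam_inc (gam_retr (contrT (gam_inc u))) = contrT (gam_inc u).
  by have [g <-] := contrT_inc u; rewrite gam_incK.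
rewrite (linD (@gam_inc_lin _ _ _)) gam_inc_leib !(linN (@gam_inc_lin _ _ _)) !incK.
rewrite gam_inc_leib (linN (@dT_lin _ _ _)) -opprD.
move: f; apply: gam_tree_ind.
- by rewrite !(lin0 (@gam_inc_lin _ _ _), lin0 (@dT_lin _ _ _), lin0 (@contrT_lin _ _ _)) addr0 oppr0.
- move=> a x y hx hy; rewrite !(gam_inc_lin, dT_lin, contrT_lin).
  by rewrite [X in - X]addrACA -scalerDr opprD -scalerN hx hy.
by move=> al t h; rewrite (gam_inc_tree k h) (contrT_homotopy k h) opprK.
Qed.

(** * The complex of a left module and the comparison with Tor *)

Section ModuleComplex.
Variable k : comPzRingType.
Local Notation G := (Gamma k).
Implicit Type F : leftMod G.

Definition leib_act F n : {linear F n.+1 -> F n} :=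
  linMap (lm_linr (l := F) (leib_mor k n : @mor k G n.+1 n)).

Lemma leib_act_sqr F n (u : F n.+2) : leib_act F n (leib_act F n.+1 u) = 0.
Proof.
rewrite /= -lm_cmp [cmp _ _]leib_mor_sqr.
exact: lin0 (@lm_linl _ _ F n.+2 n u).
Qed.

Lemma leib_act_nat F F' (h : lmHom F F') n u :
  h n (leib_act F n u) = leib_act F' n (h n.+1 u).
Proof. exact: lmh_nat. Qed.

(** The cover is a direct sum of representables, and their contractions, applied summand by summand,
    give a contraction of its complex. *)
Lemma leib_act_cover F (n : nat) (u : Defs.cover F n.+1) :
  leib_act (Defs.cover F) n u = 0 -> exists v, leib_act (Defs.cover F) n.+1 v = u.
Proof.
have H (x : G) := cid (gam_contraction k x).
pose h (x : G) m : gam k x m -> gam k x m.+1 := projT1 (H x) m.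
have hl x m : linear (h x m) := (projT2 (H x)).1 m.
have hK x m f : gcmp (leib_mor k m.+1) (h x m.+1 f) + h x m (gcmp (leib_mor k m) f) = f
  := (projT2 (H x)).2 m f.
pose c (m : nat) : Defs.cover F m -> Defs.cover F m.+1 :=
  dsumLift (fun j f => @cinj k G F m.+1 j (h (projT1 j) m f)).
have cl m : forall j, linear (fun f => @cinj k G F m.+1 j (h (projT1 j) m f)).
  by move=> j a f g; rewrite hl cinj_lin.
have c_lin (m : nat) : linear (c m) := dsumLift_lin (cl m).
have cE (m : nat) j f : c m (@cinj k G F m j f) = @cinj k G F m.+1 j (h (projT1 j) m f) := dsumLift_inj (cl m) f.
have dl (m : nat) : linear (leib_act (Defs.cover F) m).
  exact: (@lm_linr _ _ (Defs.cover F) m.+1 m).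
have cK (m : nat) (v : Defs.cover F m.+1) : leib_act (Defs.cover F) m.+1 (c m.+1 v) + c m (leib_act (Defs.cover F) m v) = v.
  move: v; apply: (@cov_eq k G F m.+1 _ (fun v : Defs.cover F m.+1 =>
    leib_act (Defs.cover F) m.+1 (c m.+1 v) + c m (leib_act (Defs.cover F) m v)) id) => //.
    move=> a x y; rewrite (c_lin m.+1) (dl m.+1) (dl m) (c_lin m).
    by rewrite addrACA -scalerDr.
  move=> j f; rewrite cE /= !cov_actE cE -(linD (@cinj_lin _ _ _ _ _)).
  exact: (congr1 (@cinj k G F m.+1 j) (hK (projT1 j) m f)).
by move=> u0; exists (c n.+1 u); rewrite -[RHS]cK u0 (lin0 (c_lin n)) addr0.
Qed.

(** Lifting the identity through [covAug] makes [F] a retract of its cover, and exactness passes to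
    retracts since the complex is natural. *)
Lemma leib_act_projective F n (u : F n.+1) : projective F ->
  leib_act F n u = 0 <-> exists v, leib_act F n.+1 v = u.
Proof.
move=> Fp; split=> [u0|[v <-]]; last exact: leib_act_sqr.
have idl (x : G) : linear (id : F x -> F x) by [].
pose idh : lmHom F F := LmHom idl (fun _ _ _ _ => erefl).
have [s sK] := Fp _ _ (covAug F) idh (@covAug_surj _ _ F).
have [|v hv] := @leib_act_cover F n (s n.+1 u).
  by rewrite -leib_act_nat u0 (lin0 (lmh_lin s (x := n))).
by exists (covAug F n.+2 v); rewrite -leib_act_nat hv sK.
Qed.

Lemma to_tensC_exact F (u : F 0%N) : to_tensC u = 0 <-> exists v, leib_act F 0 v = u.
Proof.
have E (v : F 1%N) : leib_act F 0 v = - d01_act F v.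
  by rewrite /= leib_mor0 (linN (@lm_linl _ _ F 1%N 0%N v)).
rewrite to_tensC_ker; split=> -[v <-]; exists (- v); rewrite ?E linearN ?E ?opprK //.
Qed.
End ModuleComplex.

Theorem mainTheorem1 (k : comPzRingType) (A : lieAlg k) (M : lieMod A)
    (P : projRes (Loday M)) (n : nat) :
  isoMod (HLeib M n) (Tor (tmod k) P n).
Proof.
(* The goals come in threes: commutation of the squares, exactness along the resolution, exactness
   in the Leibniz direction. *)
apply: (@double_complex_iso k (leib_complex M) (tor_complex (tmod k) P) (fun q m => P q m)
  (fun q m => linMap (lmh_lin (pr_d P q) (x := m)))
  (fun q m => leib_act (P q) m)
  (fun m => linMap (lmh_lin (pr_aug P) (x := m)))
  (fun q => linMap (to_tensC_lin (F := P q)))).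
- by move=> q m u; apply: leib_act_nat.
- move=> m u; rewrite [RHS]/= -lod_act_leib.
  exact: (leib_act_nat (pr_aug P)).
- by move=> q u; rewrite [RHS]/= to_tensC_nat.
- by move=> m a; apply: pr_surj.
- by move=> m u; exact (@pr_exact0 _ _ _ P m u).
- by move=> q m u; exact (@pr_exact _ _ _ P q m u).
- by move=> q b; apply: to_tensC_surj.
- by move=> q u; exact (to_tensC_exact u).
by move=> q m u; exact (leib_act_projective u (@pr_proj _ _ _ P q)).
Qed.
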